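(* Let $\alpha\in\mathbb{R}\setminus\mathbb{Q}$, let $v(x)=\sum_{k=-d}^d\hat v_ke^{2\pi ikx}$ be a real-valued trigonometric polynomial of degree $d\ge1$, and let $E\in\mathbb{R}$. If the dual cocycle $(\alpha,L_{E,v})$ is $PH2$, then there do not exist $B\in C^\omega(\mathbb{R}/\mathbb{Z},SL(2,\mathbb{R}))$ and $\psi\in C^\omega(\mathbb{R}/\mathbb{Z},\mathbb{R})$ with $\int_0^1\psi(x)dx=0$ such that $B(x+\alpha)^{-1}S_E^v(x)B(x)=R_{\psi(x)}$ for all $x$.
   Context: $S_E^v(x)=\begin{pmatrix}E-v(x)&-1\\1&0\end{pmatrix}$; $R_\theta=\begin{pmatrix}\cos2\pi\theta&-\sin2\pi\theta\\ \sin2\pi\theta&\cos2\pi\theta\end{pmatrix}$. The dual cocycle $(\alpha,L_{E,v})$ is $(\theta,w)\mapsto(\theta+\alpha,L_{E,v}(\theta)w)$, where $L_{E,v}(\theta)$ is the $2d\times2d$ matrix with first row $\frac1{\hat v_d}(-\hat v_{d-1},\dots,-\hat v_1,E-2\cos2\pi\theta-\hat v_0,-\hat v_{-1},\dots,-\hat v_{-d})$ and $(j+1)$-th row $e_j^T$ ($j=1,\dots,2d-1$); it is the transfer matrix of $\sum_k\hat v_ku_{n+k}+2\cos2\pi(\theta+n\alpha)u_n=Eu_n$. A cocycle $(\alpha,A)$ on $\mathbb{C}^m$ is $k$-dominated if there is a continuous invariant splitting $\mathbb{C}^m=E^+(\theta)\oplus E^-(\theta)$, $\dim E^+=k$, and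 $N\ge1$ with $\|A_N(\theta)u\|>\|A_N(\theta)w\|$ for all $\theta$ and unit $u\in E^+(\theta)$, $w\in E^-(\theta)$, where $A_N(\theta)=A(\theta+(N-1)\alpha)\cdots A(\theta)$. A $2d$-dimensional cocycle is $PH2$ if it is $(d-1)$-dominated and $(d+1)$-dominated. *)

(* Defs.v *)
From HB Require Import structures.
From mathcomp Require Import all_boot all_order all_algebra.
From mathcomp Require Import all_classical all_reals all_analysis.
From mathcomp Require Import complex.
Set Implicit Arguments. Unset Strict Implicit. Unset Printing Implicit Defensive.
Import Order.TTheory GRing.Theory Num.Theory.
Import numFieldNormedType.Exports.
Local Open Scope classical_set_scope.
Local Open Scope ring_scope.

Section Defs.
Variable R : realType.
Local Notation C := R[i].

Definition cexp2pi (t : R) : C := Complex (cos (2 * pi * t)) (sin (2 * pi * t)).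

Definition trig_sum (d : nat) (vhat : int -> C) (x : R) : C :=
  \sum_(k < (2 * d).+1)
     vhat ((k : nat)%:Z - d%:Z) * cexp2pi (((k : nat)%:Z - d%:Z)%:~R * x).

Definition trig_val (d : nat) (vhat : int -> C) (x : R) : R := complex.Re (trig_sum d vhat x).

Definition Schr (E : R) (v : R -> R) (x : R) : 'M[R]_2 :=
  \matrix_(i < 2, j < 2)
    if (i : nat) == 0%N then (if (j : nat) == 0%N then E - v x else -1)
    else (if (j : nat) == 0%N then 1 else 0).

Definition Rot (t : R) : 'M[R]_2 :=
  \matrix_(i < 2, j < 2)
    if (i : nat) == 0%N then
      (if (j : nat) == 0%N then cos (2 * pi * t) else - sin (2 * pi * t))
    else (if (j : nat) == 0%N then sin (2 * pi * t) else cos (2 * pi * t)).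

(* j-th (0-indexed) entry of the first row of L_{E,v}(theta):
   the coefficient index is k = d-1-j, running from d-1 down to -d *)
Definition dual_first (d : nat) (vhat : int -> C) (E t : R) (j : nat) : C :=
  let k : int := d%:Z - 1 - j%:Z in
  ((if k == 0 then (E - 2 * cos (2 * pi * t))%:C%C else 0) - vhat k) / vhat d%:Z.

Definition dualL (d : nat) (vhat : int -> C) (E : R) (t : R) : 'M[C]_(2 * d) :=
  \matrix_(i < 2 * d, j < 2 * d)
    if (i : nat) == 0%N then dual_first d vhat E t j
    else (if (i : nat) == (j : nat).+1 then 1 else 0).

Fixpoint cocycle_iter (m : nat) (alpha : R) (A : R -> 'M[C]_m) (N : nat) (t : R)
  : 'M[C]_m :=
  match N with
  | 0%N => 1%:M
  | N'.+1 => A (t + N'%:R * alpha) *m cocycle_iter alpha A N' t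
  end.

Definition cabs2 (z : C) : R := complex.Re z ^+ 2 + complex.Im z ^+ 2.

Definition norm2 (m : nat) (w : 'cV[C]_m) : R := \sum_(i < m) cabs2 (w i 0).

(* a subspace of C^m is represented by the row space of an m x m matrix S;
   the column vector w belongs to it iff w^T lies in that row space *)
Definition cmem (m : nat) (w : 'cV[C]_m) (S : 'M[C]_m) : bool := (w^T <= S)%MS.

Definition mx_continuous (m : nat) (P : R -> 'M[C]_m) : Prop :=
  forall (t0 : R) (i j : 'I_m) (e : R), 0 < e ->
    exists2 delta : R, 0 < delta &
      forall t : R, `|t - t0| < delta -> cabs2 (P t i j - P t0 i j) < e.

(* k-domination of the cocycle (alpha, A) on C^m (base R/Z):
   a continuous invariant splitting C^m = E+(theta) (+) E-(theta), dim E+ = k,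
   continuity expressed through the continuity of the associated projection
   onto E+ along E-, and N >= 1 with |A_N u| > |A_N w| for unit u in E+, w in E-. *)
Definition dominated (m k : nat) (alpha : R) (A : R -> 'M[C]_m) : Prop :=
  exists (Ep Em P : R -> 'M[C]_m),
    (forall t, \rank (Ep t) = k) /\
    (forall t : R, (\rank (Ep t) + \rank (Em t))%N = m /\ (Ep t + Em t == 1%:M)%MS) /\
    (forall t : R, (Ep (t + 1)%R == Ep t)%MS /\ (Em (t + 1)%R == Em t)%MS) /\
    (forall t : R, (Ep t *m (A t)^T == Ep (t + alpha)%R)%MS /\
               (Em t *m (A t)^T == Em (t + alpha)%R)%MS) /\
    (forall t (w : 'cV[C]_m), cmem (P t *m w) (Ep t) /\ cmem (w - P t *m w) (Em t)) /\
    mx_continuous P /\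
    exists2 N : nat, (1 <= N)%N &
      forall t (u w : 'cV[C]_m), cmem u (Ep t) -> cmem w (Em t) ->
        norm2 u = 1 -> norm2 w = 1 ->
        norm2 (cocycle_iter alpha A N t *m w) < norm2 (cocycle_iter alpha A N t *m u).

Definition PH2 (d : nat) (alpha : R) (A : R -> 'M[C]_(2 * d)) : Prop :=
  dominated (d - 1) alpha A /\ dominated d.+1 alpha A.

Definition real_analytic (f : R -> R) : Prop :=
  forall x0 : R, exists2 r : R, 0 < r &
    exists a : nat -> R, forall x : R, `|x - x0| < r ->
      (fun N : nat => \sum_(n < N) a n * (x - x0) ^+ n) @ \oo --> f x.

End Defs.

(* Main.v *)
Require Import Defs.
From HB Require Import structures.
From mathcomp Require Import all_boot all_order all_algebra.
From mathcomp Require Import all_classical all_reals all_analysis.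
From mathcomp Require Import complex polyrcf ring lra zify.
Set Implicit Arguments. Unset Strict Implicit. Unset Printing Implicit Defensive.
Import Order.TTheory GRing.Theory Num.Theory.
Import numFieldNormedType.Exports.
Import ComplexField.
Local Open Scope classical_set_scope.
Local Open Scope ring_scope.

(* A reduction of the Schrodinger cocycle to the rotations R_psi makes beta = B_00 - i B_01 an analytic
   function with exp(2 pi i psi(x)) beta(x + alpha) + exp(-2 pi i psi(x - alpha)) beta(x - alpha)
   + (v(x) - E) beta(x) = 0. As psi has mean zero, the equation g(x + alpha) - g(x) = psi(x) can be
   solved by a trigonometric polynomial on the frequencies below a denominator q of alpha: the error
   is exp(-c q), whereas g, which may grow with q, is only o(q) in an analytic norm. Hence the Fourier
   coefficients of f = exp(2 pi i g) beta and of its conjugate are two exp(-c q)-approximate solutions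
   at energy E of the dual equation, essentially supported on [-n, n] with n as small a multiple of q
   as one likes. The dual cocycle preserves a skew-Hermitian form, so the fast bundle of dimension
   d - 1 is isotropic, and a solution that is small at both ends is almost in the two-dimensional
   center, namely the part in the slow bundle of the orthogonal of the fast one, on which the form is
   nondegenerate. The form is preserved and small at the ends, so it is small on the two solutions:
   they are almost proportional. This contradicts f(x) conj f(y) - f(y) conj f(x) being close to 2 i
   for y = x - alpha, which is det B = 1. *)

(** Transfer matrices of the dual cocycle may grow like exp(l n); the order in which the constants
    are chosen defeats this growth. The rate l, the domination period N and the analytic rate c do
    not depend on q. Coefficients at distance a N n are of size exp(-c a N n), which beats exp(2 l
    n) on the window [-n, n] once a is large in terms of c and l; the residual exp(-c q) has to
    survive a N n steps, and this fixes the ratio b of q to n. Only when b is known is the norm of f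
    required to stay below exp(c n / 4), which is why g must be o(q) and a bound O(q) would not do.
    For Liouville alpha the equation for g may have no exact solution, so the solutions of the dual
    equation are only approximate and every estimate on the splitting is stated with an error.
    Analytic functions are handled through trigonometric polynomials interpolating them on a grid;
    the decay of the discrete Fourier coefficients, uniform in the grid, comes from finite
    differences. No complex extension and no Fourier integral occurs; the only integral is the mean
    of psi. *)

Lemma eq_ler (R : realType) (x y : R) : x = y -> x <= y.
Proof. by move->. Qed.

(** * The real-valued modulus on complex numbers *)

Section Modulus.
Variable R : realType.
Local Notation C := R[i].

Lemma complex_ext (z w : C) :
  complex.Re z = complex.Re w -> complex.Im z = complex.Im w -> z = w.
Proof. by case: z w => [? ?] [? ?] /= -> ->. Qed.

Definition cm (z : C) : R := Num.sqrt (cabs2 z).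

Lemma cmE (z : C) : cm z = Normc.normc z.
Proof. by case: z. Qed.

Lemma cm_ge0 z : 0 <= cm z.
Proof. exact: sqrtr_ge0. Qed.

Lemma cabs2_ge0 (z : C) : 0 <= cabs2 z.
Proof. by rewrite addr_ge0 ?sqr_ge0. Qed.

Lemma cm_sqr z : cm z ^+ 2 = cabs2 z.
Proof. by rewrite sqr_sqrtr ?cabs2_ge0. Qed.

Lemma cm0 : cm 0 = 0.
Proof. by rewrite cmE Normc.normc0. Qed.

Lemma cm1 : cm 1 = 1.
Proof. by rewrite cmE Normc.normc1. Qed.

Lemma cmM z w : cm (z * w) = cm z * cm w.
Proof. by rewrite !cmE Normc.normcM. Qed.

Lemma cmV z : cm z^-1 = (cm z)^-1.
Proof. by rewrite !cmE Normc.normcV. Qed.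

Lemma cmN z : cm (- z) = cm z.
Proof. by rewrite !cmE normcN. Qed.

Lemma cmB z w : cm (z - w) = cm (w - z).
Proof. by rewrite -cmN opprB. Qed.

Lemma cmD z w : cm (z + w) <= cm z + cm w.
Proof. by rewrite !cmE le_normcD. Qed.

Lemma cm_triB z w : cm (z - w) <= cm z + cm w.
Proof. by rewrite -[cm w]cmN cmD. Qed.

Lemma cm_eq0 z : (cm z == 0) = (z == 0).
Proof.
apply/eqP/eqP => [|->]; last exact: cm0.
by rewrite cmE => /Normc.eq0_normc.
Qed.

Lemma cm_gt0 z : (0 < cm z) = (z != 0).
Proof. by rewrite lt_def cm_eq0 cm_ge0 andbT. Qed.

Lemma cmJ z : cm (conjc z) = cm z.
Proof. by case: z => a b; rewrite /cm /cabs2 /= sqrrN. Qed.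

Lemma cmR (x : R) : cm x%:C%C = `|x|.
Proof. by rewrite /cm /cabs2 /= expr0n /= addr0 sqrtr_sqr. Qed.

Lemma cmX z n : cm (z ^+ n) = cm z ^+ n.
Proof. by elim: n => [|n IH]; rewrite ?expr0 ?cm1 // !exprS cmM IH. Qed.

Lemma cm_Re z : `|complex.Re z| <= cm z.
Proof.
case: z => a b; rewrite /cm /cabs2 /= -(sqrtr_sqr a).
by rewrite ler_wsqrtr // lerDl sqr_ge0.
Qed.

Lemma cm_Im z : `|complex.Im z| <= cm z.
Proof.
case: z => a b; rewrite /cm /cabs2 /= -(sqrtr_sqr b).
by rewrite ler_wsqrtr // lerDr sqr_ge0.
Qed.

Lemma cm_ReIm z : cm z <= `|complex.Re z| + `|complex.Im z|.
Proof.
have -> : z = (complex.Re z)%:C%C + 'i%C * (complex.Im z)%:C%C by rewrite -complexE.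
apply: le_trans (cmD _ _) _; rewrite cmM !cmR.
have -> : cm 'i%C = 1 by rewrite /cm /cabs2 /= expr0n /= add0r expr1n sqrtr1.
case: z => a b /=; rewrite !(mul0r, mul1r, mulr0, mulr1, addr0, add0r, subr0) //.
Qed.

Lemma cm_sum I (r : seq I) (P : pred I) (F : I -> C) :
  cm (\sum_(i <- r | P i) F i) <= \sum_(i <- r | P i) cm (F i).
Proof.
elim/big_ind2: _ => [|x1 x2 y1 y2 h1 h2|//]; first by rewrite cm0.
exact: le_trans (cmD _ _) (lerD h1 h2).
Qed.

Lemma cm_conjM z : conjc z * z = (cm z ^+ 2)%:C%C.
Proof.
rewrite cm_sqr; case: z => a b; rewrite /cabs2 /=.
by apply: complex_ext => /=; ring.
Qed.

End Modulus.

(** * The character x -> exp(2 pi i x) *)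

Section Character.
Variable R : realType.
Local Notation C := R[i].
Implicit Types x y : R.

Lemma cexp0 : cexp2pi (0 : R) = 1.
Proof. by rewrite /cexp2pi mulr0 cos0 sin0. Qed.

Lemma cexpD x y : cexp2pi (x + y) = cexp2pi x * cexp2pi y.
Proof.
by rewrite /cexp2pi mulrDr cosD sinD; apply: complex_ext => /=; ring.
Qed.

Lemma conj_cexp x : conjc (cexp2pi x) = cexp2pi (- x).
Proof. by rewrite /cexp2pi mulrN cosN sinN. Qed.

Lemma cm_cexp x : cm (cexp2pi x) = 1.
Proof. by rewrite /cm /cabs2 /= cos2Dsin2 sqrtr1. Qed.

Lemma cexp_neq0 x : cexp2pi x != 0.
Proof. by rewrite -cm_eq0 cm_cexp oner_neq0. Qed.

Lemma cexpN x : cexp2pi (- x) = (cexp2pi x)^-1.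
Proof.
apply: (mulfI (cexp_neq0 x)); rewrite -cexpD subrr cexp0 divff //.
exact: cexp_neq0.
Qed.

Lemma cexp1 : cexp2pi (1 : R) = 1.
Proof. by rewrite /cexp2pi mulr1 mulr_natl cos2pi sin2pi. Qed.

Lemma cexpMn x n : cexp2pi (n%:R * x) = cexp2pi x ^+ n.
Proof.
elim: n => [|n IH]; first by rewrite mul0r cexp0.
by rewrite exprS -IH -cexpD -natr1 mulrDl mul1r addrC.
Qed.

Lemma cexp_int (k : int) : cexp2pi (k%:~R : R) = 1.
Proof.
have e (n : nat) : cexp2pi (n%:R : R) = 1.
  by rewrite -[n%:R]mulr1 cexpMn cexp1 expr1n.
case: k => n; first exact: e.
by rewrite NegzE mulrNz cexpN e invr1.
Qed.

Lemma cexpD1 x : cexp2pi (x + 1) = cexp2pi x.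
Proof. by rewrite cexpD cexp1 mulr1. Qed.

End Character.

(** * The entrywise l1 norm and its comparison with the Euclidean norm *)

Section L1norm.
Variable R : realType.
Local Notation C := R[i].

(** Submultiplicative and free of square roots; passing to and from the Euclidean [norm2] of the
    definition of domination costs only powers of the dimension. *)
Definition l1 (m n : nat) (M : 'M[C]_(m, n)) : R := \sum_i \sum_j cm (M i j).

Lemma l1_ge0 m n (M : 'M[C]_(m, n)) : 0 <= l1 M.
Proof. by apply: sumr_ge0 => i _; apply: sumr_ge0 => j _; apply: cm_ge0. Qed.

Lemma l1_entry m n (M : 'M[C]_(m, n)) i j : cm (M i j) <= l1 M.
Proof.
rewrite /l1 (bigD1 i) //= (bigD1 j) //= -addrA lerDl addr_ge0 //.
  by apply: sumr_ge0 => k _; apply: cm_ge0.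
by apply: sumr_ge0 => k _; apply: sumr_ge0 => l _; apply: cm_ge0.
Qed.

Lemma l10 m n : l1 (0 : 'M[C]_(m, n)) = 0.
Proof. by rewrite /l1 big1 // => i _; rewrite big1 // => j _; rewrite mxE cm0. Qed.

Lemma l1_eq0 m n (M : 'M[C]_(m, n)) : (l1 M == 0) = (M == 0).
Proof.
apply/eqP/eqP => [h|->]; last exact: l10.
apply/matrixP => i j; rewrite mxE; apply/eqP; rewrite -cm_eq0 eq_le cm_ge0 andbT.
by rewrite -h l1_entry.
Qed.

Lemma l1_gt0 m n (M : 'M[C]_(m, n)) : (0 < l1 M) = (M != 0).
Proof. by rewrite lt_def l1_eq0 l1_ge0 andbT. Qed.

Lemma l1D m n (M N : 'M[C]_(m, n)) : l1 (M + N) <= l1 M + l1 N.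
Proof.
rewrite /l1 -big_split; apply: ler_sum => i _; rewrite -big_split; apply: ler_sum => j _.
by rewrite mxE cmD.
Qed.

Lemma l1N m n (M : 'M[C]_(m, n)) : l1 (- M) = l1 M.
Proof. by apply: eq_bigr => i _; apply: eq_bigr => j _; rewrite mxE cmN. Qed.

Lemma l1B m n (M N : 'M[C]_(m, n)) : l1 (M - N) <= l1 M + l1 N.
Proof. by rewrite -(l1N N) l1D. Qed.

Lemma l1C m n (M N : 'M[C]_(m, n)) : l1 (M - N) = l1 (N - M).
Proof. by rewrite -l1N opprB. Qed.

Lemma l1T m n (M : 'M[C]_(m, n)) : l1 M^T = l1 M.
Proof.
by rewrite /l1 exchange_big; apply: eq_bigr => i _; apply: eq_bigr => j _; rewrite mxE.
Qed.

Lemma l1J m n (M : 'M[C]_(m, n)) : l1 (map_mx (@conjc R) M) = l1 M.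
Proof. by apply: eq_bigr => i _; apply: eq_bigr => j _; rewrite mxE cmJ. Qed.

Lemma l1M m n p (M : 'M[C]_(m, n)) (N : 'M[C]_(n, p)) : l1 (M *m N) <= l1 M * l1 N.
Proof.
rewrite /l1 mulr_suml; apply: ler_sum => i _.
apply: (@le_trans _ _ (\sum_j \sum_k cm (M i j) * cm (N j k))).
  rewrite exchange_big; apply: ler_sum => k _; rewrite mxE.
  by apply: le_trans (cm_sum _ _ _) _; apply: ler_sum => j _; rewrite cmM.
rewrite mulr_suml; apply: ler_sum => j _; rewrite -mulr_sumr ler_wpM2l ?cm_ge0 //.
rewrite [leRHS](bigD1 j) //= lerDl.
by apply: sumr_ge0 => k _; apply: sumr_ge0 => l _; apply: cm_ge0.
Qed.

Lemma norm2_le_l1 m (w : 'cV[C]_m) : norm2 w <= l1 w ^+ 2.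
Proof.
rewrite expr2 {1}/l1 mulr_suml; apply: ler_sum => i _.
rewrite big_ord1 -cm_sqr expr2 ler_wpM2l ?cm_ge0 //; exact: l1_entry.
Qed.

Lemma norm2_ge0 m (w : 'cV[C]_m) : 0 <= norm2 w.
Proof. by apply: sumr_ge0 => i _; apply: cabs2_ge0. Qed.

Lemma l1_le_norm2 m (w : 'cV[C]_m) : l1 w ^+ 2 <= m%:R ^+ 2 * norm2 w.
Proof.
have h : l1 w <= m%:R * Num.sqrt (norm2 w).
  apply: (@le_trans _ _ (\sum_(i < m) Num.sqrt (norm2 w))); last first.
    by rewrite sumr_const card_ord mulr_natl.
  apply: ler_sum => i _; rewrite big_ord1 ler_wsqrtr //.
  rewrite /norm2 (bigD1 i) //= lerDl.
  by apply: sumr_ge0 => j _; apply: cabs2_ge0.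
rewrite -(sqr_sqrtr (norm2_ge0 w)) -exprMn ler_sqr ?nnegrE ?l1_ge0 //.
Qed.

Lemma norm2Z m (a : C) (w : 'cV[C]_m) : norm2 (a *: w) = cm a ^+ 2 * norm2 w.
Proof.
by rewrite /norm2 mulr_sumr; apply: eq_bigr => i _; rewrite mxE -!cm_sqr cmM exprMn.
Qed.

Lemma norm2_0 m : norm2 (0 : 'cV[C]_m) = 0.
Proof. by rewrite /norm2 big1 // => i _; rewrite mxE /cabs2 /= expr0n /= addr0. Qed.

Lemma norm2_eq0 m (w : 'cV[C]_m) : (norm2 w == 0) = (w == 0).
Proof.
apply/eqP/eqP => [h|->]; last exact: norm2_0.
apply/eqP; rewrite -l1_eq0 -sqrf_eq0 eq_le sqr_ge0 andbT.
by rewrite (le_trans (l1_le_norm2 _)) // h mulr0.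
Qed.

End L1norm.

(** * Continuity of complex-valued and matrix-valued maps *)

Section ComplexContinuity.
Variables (R : realType) (T : topologicalType).
Local Notation C := R[i].

(** Stated through real and imaginary parts, so that all the topology takes place over the reals. *)
Definition ccont (f : T -> C) : Prop :=
  continuous (fun p => complex.Re (f p)) /\ continuous (fun p => complex.Im (f p)).

Lemma ccont_cst (c : C) : ccont (fun=> c).
Proof. by split => p; apply: cvg_cst. Qed.

Lemma ccontD (f g : T -> C) : ccont f -> ccont g -> ccont (fun p => f p + g p).
Proof.
move=> [f1 f2] [g1 g2]; split => p.
  rewrite (_ : (fun _ => _) = (fun p => complex.Re (f p) + complex.Re (g p))).
    exact: cvgD (f1 p) (g1 p).
  by apply/funext => q; case: (f q) (g q) => [? ?] [].
rewrite (_ : (fun _ => _) = (fun p => complex.Im (f p) + complex.Im (g p))).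
  exact: cvgD (f2 p) (g2 p).
by apply/funext => q; case: (f q) (g q) => [? ?] [].
Qed.

Lemma ccontN (f : T -> C) : ccont f -> ccont (fun p => - f p).
Proof.
move=> [f1 f2]; split => p.
  rewrite (_ : (fun _ => _) = (fun p => - complex.Re (f p))).
    exact: cvgN (f1 p).
  by apply/funext => q; case: (f q).
rewrite (_ : (fun _ => _) = (fun p => - complex.Im (f p))).
  exact: cvgN (f2 p).
by apply/funext => q; case: (f q).
Qed.

Lemma ccontM (f g : T -> C) : ccont f -> ccont g -> ccont (fun p => f p * g p).
Proof.
move=> [f1 f2] [g1 g2]; split => p.
  rewrite (_ : (fun _ => _) = (fun p => complex.Re (f p) * complex.Re (g p)
      - complex.Im (f p) * complex.Im (g p))).
    exact: cvgB (cvgM (f1 p) (g1 p)) (cvgM (f2 p) (g2 p)).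
  by apply/funext => q; case: (f q) (g q) => [? ?] [].
rewrite (_ : (fun _ => _) = (fun p => complex.Re (f p) * complex.Im (g p)
      + complex.Im (f p) * complex.Re (g p))).
  exact: cvgD (cvgM (f1 p) (g2 p)) (cvgM (f2 p) (g1 p)).
by apply/funext => q; case: (f q) (g q) => [? ?] [].
Qed.

Lemma ccont_sum I (r : seq I) (F : I -> T -> C) :
  (forall i, ccont (F i)) -> ccont (fun p => \sum_(i <- r) F i p).
Proof.
move=> h; elim: r => [|i r IH].
  by under [fun p => _]eq_fun do rewrite big_nil; apply: ccont_cst.
by under [fun p => _]eq_fun do rewrite big_cons; apply: ccontD.
Qed.

Definition mcont m n (M : T -> 'M[C]_(m, n)) := forall i j, ccont (fun p => M p i j).

Lemma mcont_cst m n (M : 'M[C]_(m, n)) : mcont (fun=> M).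
Proof. by move=> i j; apply: ccont_cst. Qed.

Lemma mcontM m n q (M : T -> 'M[C]_(m, n)) (N : T -> 'M[C]_(n, q)) :
  mcont M -> mcont N -> mcont (fun p => M p *m N p).
Proof.
move=> hM hN i j; under [fun p => _]eq_fun do rewrite mxE.
by apply: ccont_sum => k; apply: ccontM.
Qed.

Lemma mcontB m n (M N : T -> 'M[C]_(m, n)) :
  mcont M -> mcont N -> mcont (fun p => M p - N p).
Proof.
move=> hM hN i j; under [fun p => _]eq_fun do rewrite !mxE.
by apply: ccontD => //; apply: ccontN.
Qed.

Lemma norm2_continuous m (w : T -> 'cV[C]_m) :
  mcont w -> continuous (fun p => norm2 (w p)).
Proof.
move=> hw; rewrite /norm2 => p.
elim: (index_enum _) => [|i r IH].
  by under [fun p => _]eq_fun do rewrite big_nil; apply: cvg_cst.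
under [fun p => _]eq_fun do rewrite big_cons.
apply: cvgD IH; have [h1 h2] := hw i 0.
by apply: cvgD; [apply: cvgM (h1 p) (h1 p) | apply: cvgM (h2 p) (h2 p)].
Qed.

End ComplexContinuity.

Lemma ccont_comp (R : realType) (T U : topologicalType) (f : U -> R[i]) (g : T -> U) :
  continuous g -> ccont f -> ccont (f \o g).
Proof.
move=> hg [h1 h2]; split=> p.
  exact: (@continuous_comp _ _ _ g (fun q => complex.Re (f q)) _ (hg p) (h1 _)).
exact: (@continuous_comp _ _ _ g (fun q => complex.Im (f q)) _ (hg p) (h2 _)).
Qed.

Lemma mcont_comp (R : realType) (T U : topologicalType) m n (f : U -> 'M[R[i]]_(m, n))
  (g : T -> U) : continuous g -> mcont f -> mcont (f \o g).
Proof. by move=> hg hf i j; apply: (ccont_comp hg (hf i j)). Qed.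

Lemma mx_continuous_mcont (R : realType) m (P : R -> 'M[R[i]]_m) :
  mx_continuous P -> mcont P.
Proof.
move=> hP i j.
have key : forall t0 (e : R), 0 < e -> \forall t \near t0, cm (P t i j - P t0 i j) < e.
  move=> t0 e e0; have [|del d0 hd] := hP t0 i j (e ^+ 2).
    by rewrite exprn_gt0.
  apply/nbhs_ballP; exists del => //= t; rewrite -ball_normE /= distrC => /hd.
  by rewrite -cm_sqr ltr_pXn2r // nnegrE ?cm_ge0 // ltW.
split => t0; apply/cvgrPdist_lt => e e0; near=> t.
  apply: le_lt_trans (_ : cm (P t i j - P t0 i j) < e); last by near: t; apply: key.
  rewrite distrC; apply: le_trans (cm_Re _).
  by case: (P t i j) (P t0 i j) => [? ?] [].
apply: le_lt_trans (_ : cm (P t i j - P t0 i j) < e); last by near: t; apply: key.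
rewrite distrC; apply: le_trans (cm_Im _).
by case: (P t i j) (P t0 i j) => [? ?] [].
Unshelve. all: by end_near.
Qed.

(** * Iterates of a cocycle *)

Section CocycleIterates.
Variables (R : realType) (m : nat) (alpha : R) (A : R -> 'M[R[i]]_m).
Local Notation it := (cocycle_iter alpha A).

Lemma it_add N M t : it (M + N) t = it M (t + N%:R * alpha) *m it N t.
Proof.
elim: M => [|M IH]; first by rewrite mul1mx.
rewrite addSn /= IH mulmxA; congr (A _ *m _ *m _).
by rewrite natrD; ring.
Qed.

Lemma it_unit : (forall t, A t \in unitmx) -> forall N t, it N t \in unitmx.
Proof.
move=> uA; elim => [|N IH] t /=; first exact: unitmx1.
by rewrite unitmx_mul uA IH.
Qed.

Lemma it_periodic : (forall t, A (t + 1) = A t) -> forall N t, it N (t + 1) = it N t.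
Proof.
move=> pA; elim => [//|N IH] t /=; rewrite IH; congr (_ *m _).
by rewrite -[RHS]pA; congr (A _); ring.
Qed.

Lemma it_mcont : mcont A -> forall N, mcont (it N).
Proof.
move=> cA; elim => [|N IH]; first exact: mcont_cst.
apply: mcontM IH; apply: mcont_comp cA => t.
by apply: cvgD; [exact: cvg_id | exact: cvg_cst].
Qed.

Lemma it_le (L : R) : 1 <= L -> (forall t, l1 (A t) <= L) ->
  forall N t (w : 'cV_m), l1 (it N t *m w) <= L ^+ N * l1 w.
Proof.
move=> L1 hA; elim => [|N IH] t w; first by rewrite /= mul1mx mul1r.
rewrite /= -mulmxA exprS -mulrA; apply: le_trans (l1M _ _) _.
by apply: ler_pM => //; apply: l1_ge0.
Qed.

End CocycleIterates.

Lemma periodic_reduce (R : realType) (Q : R -> Prop) :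
  (forall t, Q (t + 1) <-> Q t) -> (forall t, 0 <= t <= 1 -> Q t) -> forall t, Q t.
Proof.
move=> hQ h t.
have hn : forall n t, Q (t + n%:R) <-> Q t.
  elim => [|n IH] s; first by rewrite addr0.
  by rewrite -natr1 addrA hQ.
have hz (z : int) s : Q (s + z%:~R) <-> Q s.
  case: z => n; first exact: hn.
  by rewrite NegzE mulrNz -(hn n.+1 (s + _)) subrK.
rewrite -(hz (- Num.floor t)); apply: h.
have := floor_itv t; rewrite intrD mulrNz.
by move=> /andP[h1 h2]; lra.
Qed.

(** * Membership of column vectors in subspaces given as row spaces *)

Section Cmem.
Variables (R : realType) (m : nat).
Implicit Types (u w : 'cV[R[i]]_m) (S : 'M[R[i]]_m).

Lemma cmem0 S : cmem 0 S.
Proof. by rewrite /cmem trmx0 sub0mx. Qed.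

Lemma cmemD u w S : cmem u S -> cmem w S -> cmem (u + w) S.
Proof. by rewrite /cmem linearD; apply: addmx_sub. Qed.

Lemma cmemZ a u S : cmem u S -> cmem (a *: u) S.
Proof. by rewrite /cmem linearZ; apply: scalemx_sub. Qed.

Lemma cmemB u w S : cmem u S -> cmem w S -> cmem (u - w) S.
Proof. by move=> hu hw; rewrite -scaleN1r; apply: cmemD => //; apply: cmemZ. Qed.

Lemma cmem_eqmx S S' u : (S == S')%MS -> cmem u S = cmem u S'.
Proof. by move/eqmxP => h; rewrite /cmem h. Qed.

Lemma cmem_mul (B : 'M[R[i]]_m) S u : cmem u S -> cmem (B *m u) (S *m B^T).
Proof. by rewrite /cmem trmx_mul; apply: submxMr. Qed.

Lemma cmem_inj (B : 'M[R[i]]_m) S u : B \in unitmx ->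
  cmem u (S *m B^T) -> cmem (invmx B *m u) S.
Proof.
move=> uB; rewrite /cmem => /(submxMr (invmx B)^T).
by rewrite -mulmxA -!trmx_mul mulVmx // trmx1 mulmx1.
Qed.

Lemma projection_unique (F G P : 'M[R[i]]_m) u w :
  (forall x, cmem x F -> cmem x G -> x = 0) -> cmem (P *m w) F -> cmem (w - P *m w) G ->
  cmem u F -> cmem (w - u) G -> u = P *m w.
Proof.
move=> FG PF PG uF uG; apply/eqP; rewrite -subr_eq0; apply/eqP.
apply: FG; first exact: cmemB.
rewrite (_ : u - _ = (w - P *m w) - (w - u)); first exact: cmemB.
by apply/matrixP => i j; rewrite !mxE; ring.
Qed.

End Cmem.

(* Em is the slower bundle; P is the projection onto Ep along Em; K bounds P and absorbs the
   comparison between the l1 and the Euclidean norms. *)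
Record uniform_splitting (R : realType) (m k : nat) (alpha : R) (A : R -> 'M[R[i]]_m)
    (Ep Em P : R -> 'M[R[i]]_m) (N : nat) (K lam : R) : Prop := UniformSplitting {
  us_rank : forall t, \rank (Ep t) = k;
  us_rankD : forall t, (\rank (Ep t) + \rank (Em t))%N = m;
  us_direct : forall t (w : 'cV_m), cmem w (Ep t) -> cmem w (Em t) -> w = 0;
  us_inv_p : forall t, (Ep t *m (A t)^T == Ep (t + alpha)%R)%MS;
  us_inv_m : forall t, (Em t *m (A t)^T == Em (t + alpha)%R)%MS;
  us_P : forall t (w : 'cV_m), cmem (P t *m w) (Ep t);
  us_Q : forall t (w : 'cV_m), cmem (w - P t *m w) (Em t);
  us_N : (0 < N)%N;
  us_K : 1 <= K;
  us_bound : forall t, l1 (P t) <= K;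
  us_lam : 0 < lam < 1;
  us_dom : forall j t (f h : 'cV_m), cmem f (Ep t) -> cmem h (Em t) ->
    l1 (cocycle_iter alpha A (j * N) t *m h) * l1 f <=
      K * lam ^+ j * (l1 (cocycle_iter alpha A (j * N) t *m f) * l1 h) }.

(** * From pointwise domination to uniform exponential domination *)

Section UniformDomination.
Variables (R : realType) (m : nat) (alpha : R) (A : R -> 'M[R[i]]_m).
Local Notation it := (cocycle_iter alpha A).
Hypothesis A_periodic : forall t, A (t + 1) = A t.
Hypothesis A_cont : mcont A.
Hypothesis A_unit : forall t, A t \in unitmx.
Variables (k : nat) (Ep Em P : R -> 'M[R[i]]_m).
Hypothesis rk : forall t, \rank (Ep t) = k.
Hypothesis full : forall t, (\rank (Ep t) + \rank (Em t))%N = m /\ (Ep t + Em t == 1%:M)%MS.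
Hypothesis per : forall t, (Ep (t + 1)%R == Ep t)%MS /\ (Em (t + 1)%R == Em t)%MS.
Hypothesis inv : forall t, (Ep t *m (A t)^T == Ep (t + alpha)%R)%MS /\
   (Em t *m (A t)^T == Em (t + alpha)%R)%MS.
Hypothesis proj : forall t (w : 'cV_m), cmem (P t *m w) (Ep t) /\ cmem (w - P t *m w) (Em t).
Hypothesis P_cont : mcont P.
Variable N : nat.
Hypothesis N1 : (1 <= N)%N.
Hypothesis strict : forall t (u w : 'cV_m), cmem u (Ep t) -> cmem w (Em t) ->
  norm2 u = 1 -> norm2 w = 1 -> norm2 (it N t *m w) < norm2 (it N t *m u).

Lemma direct_cap t (w : 'cV_m) : cmem w (Ep t) -> cmem w (Em t) -> w = 0.
Proof.
move=> h1 h2; have [r /eqmxP e] := full t.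
have := mxrank_sum_cap (Ep t) (Em t).
rewrite e mxrank1 r => /eqP; rewrite -[X in _ == X]addn0 eqn_add2l mxrank_eq0 => /eqP c0.
have : (w^T <= Ep t :&: Em t)%MS by rewrite sub_capmx; apply/andP.
by rewrite c0 submx0 => /eqP wT0; rewrite -[w]trmxK wT0 trmx0.
Qed.

Lemma proj_unique t (u w : 'cV_m) :
  cmem u (Ep t) -> cmem (w - u) (Em t) -> u = P t *m w.
Proof.
by move=> uF uG; have [pF pG] := proj t w; apply: (projection_unique (@direct_cap t)).
Qed.

(** Domination assumes periodicity of the two bundles only; the projection inherits it because the
    splitting determines it. *)
Lemma proj_periodic t : P (t + 1) = P t.
Proof.
have h (w : 'cV_m) : P (t + 1) *m w = P t *m w.
  have [p1 p2] := per t; have [q1 q2] := proj (t + 1) w.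
  by apply: proj_unique; [rewrite -(cmem_eqmx _ p1) | rewrite -(cmem_eqmx _ p2)].
apply/matrixP => i j; have := h (delta_mx j 0).
by rewrite -!colE => /matrixP /(_ i 0); rewrite !mxE.
Qed.

Lemma periodic_mcont_bounded (M : R -> 'M[R[i]]_m) : mcont M ->
  (forall t, M (t + 1) = M t) -> exists2 K, 1 <= K & forall t, l1 (M t) <= K.
Proof.
move=> cM pM.
have hij i j : exists K, forall t, 0 <= t <= 1 -> cm (M t i j) <= K.
  have [c1 c2] := cM i j.
  have cc : continuous (fun t => norm2 (\col_(_ < 1) M t i j)).
    by apply: norm2_continuous => a b; under [fun p => _]eq_fun do rewrite mxE; exact: cM.
  have [c _ hc] := @EVT_max R _ 0 1 ler01 (continuous_subspaceT cc).
  exists (Num.sqrt (norm2 (\col_(_ < 1) M c i j))) => t t01.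
  have := hc t; rewrite in_itv /= => /(_ t01) h.
  apply: ler_wsqrtr; apply: le_trans h.
  by rewrite /norm2 big_ord1 mxE.
have [K hK] := choice (fun ij : 'I_m * 'I_m => hij ij.1 ij.2).
exists (1 + \sum_i \sum_j `|K (i, j)|); first by rewrite lerDl !sumr_ge0 // => i _; rewrite sumr_ge0.
apply: periodic_reduce => [t|t t01]; first by rewrite pM.
apply: ler_wpDl => //; apply: ler_sum => i _; apply: ler_sum => j _.
exact: le_trans (hK (i, j) t t01) (ler_norm _).
Qed.

Local Notation V2 := ('rV[R]_m * 'rV[R]_m)%type.
Local Notation T := (R * (V2 * V2))%type.
(** Complex vectors are parametrised by pairs of real row vectors, for which compactness of cubes is
    at hand. *)
Let vec (x : V2) : 'cV[R[i]]_m := \col_i Complex (x.1 0 i) (x.2 0 i).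

Lemma vec_mcont : mcont vec.
Proof.
move=> i j; split.
  rewrite (_ : (fun _ => _) = (fun x : 'rV[R]_m => x 0 i) \o fst).
    by move=> p; apply: continuous_comp; [exact: cvg_fst | exact: coord_continuous].
  by apply/funext => p; rewrite mxE.
rewrite (_ : (fun _ => _) = (fun x : 'rV[R]_m => x 0 i) \o snd).
  by move=> p; apply: continuous_comp; [exact: cvg_snd | exact: coord_continuous].
by apply/funext => p; rewrite mxE.
Qed.

Let tt (p : T) : R := p.1.
Let uu (p : T) := vec p.2.1.
Let ww (p : T) := vec p.2.2.

Lemma uu_mcont : mcont uu.
Proof.
apply: (@mcont_comp _ _ _ _ _ vec (fun p : T => p.2.1)) vec_mcont => p.
apply: (@continuous_comp T (V2 * V2)%type V2 snd fst); [exact: cvg_snd | exact: cvg_fst].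
Qed.

Lemma ww_mcont : mcont ww.
Proof.
apply: (@mcont_comp _ _ _ _ _ vec (fun p : T => p.2.2)) vec_mcont => p.
apply: (@continuous_comp T (V2 * V2)%type V2 snd snd); exact: cvg_snd.
Qed.

Let cube : set 'rV[R]_m := [set v | forall i, `[(-1 : R), 1]%classic (v ord0 i)].

Lemma cube_compact : compact cube.
Proof. by apply: (@rV_compact _ _ (fun=> `[(-1 : R), 1]%classic)) => _; apply: segment_compact. Qed.

Let box : set T := `[(0 : R), 1]%classic `*` ((cube `*` cube) `*` (cube `*` cube)).

Lemma box_compact : compact box.
Proof.
apply: compact_setX; first exact: segment_compact.
by apply: compact_setX; apply: compact_setX; apply: cube_compact.
Qed.

(** Its zeros are the triples of a phase, a unit vector of [Ep] and a unit vector of [Em].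
    Membership is written [P u = u] and [P w = 0], so continuity of [P] makes the zero set
    closed. *)
Let defect (p : T) : R :=
  (norm2 (uu p) - 1) ^+ 2 + (norm2 (ww p) - 1) ^+ 2 +
  norm2 (uu p - P (tt p) *m uu p) + norm2 (P (tt p) *m ww p).

Lemma tt_continuous : continuous tt.
Proof. by move=> p; exact: cvg_fst. Qed.

Lemma mcont_tt (M : R -> 'M[R[i]]_m) (w : T -> 'cV_m) : mcont M -> mcont w ->
  mcont (fun p => M (tt p) *m w p).
Proof. by move=> cM cw; apply: mcontM => //; exact: (mcont_comp tt_continuous cM). Qed.

Lemma defect_continuous : continuous defect.
Proof.
have h (w : T -> 'cV_m) : mcont w -> continuous (fun p => (norm2 (w p) - 1) ^+ 2).
  move=> cw p.
  have e : {for p, continuous (fun q => norm2 (w q) - 1)}.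
    by apply: cvgB (cvg_cst _); exact: norm2_continuous.
  exact: (cvgM e e).
move=> p; do 3?apply: cvgD.
- exact: h uu_mcont p.
- exact: h ww_mcont p.
- apply: (norm2_continuous (w := fun p => uu p - P (tt p) *m uu p)).
  by apply: mcontB uu_mcont _; apply: mcont_tt P_cont uu_mcont.
- exact: (norm2_continuous (mcont_tt P_cont ww_mcont)).
Qed.

Lemma defect0 p : defect p = 0 ->
  [/\ norm2 (uu p) = 1, norm2 (ww p) = 1, cmem (uu p) (Ep (tt p)) & cmem (ww p) (Em (tt p))].
Proof.
have := norm2_ge0 (uu p - P (tt p) *m uu p).
have := norm2_ge0 (P (tt p) *m ww p).
have := sqr_ge0 (norm2 (uu p) - 1); have := sqr_ge0 (norm2 (ww p) - 1).
rewrite /defect => h1 h2 h3 h4 h.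
have e1 : (norm2 (uu p) - 1) ^+ 2 = 0 by lra.
have e2 : (norm2 (ww p) - 1) ^+ 2 = 0 by lra.
have e3 : norm2 (uu p - P (tt p) *m uu p) = 0 by lra.
have e4 : norm2 (P (tt p) *m ww p) = 0 by lra.
have [pu qu] := proj (tt p) (uu p); have [pw qw] := proj (tt p) (ww p).
move/eqP: e3; rewrite norm2_eq0 subr_eq0 => /eqP e3; rewrite -e3 in pu.
move/eqP: e4 qw; rewrite norm2_eq0 => /eqP ->; rewrite subr0 => qw.
move/eqP: e1; rewrite sqrf_eq0 subr_eq0 => /eqP e1.
by move/eqP: e2; rewrite sqrf_eq0 subr_eq0 => /eqP e2; split.
Qed.

Lemma unit_in_cube (w : 'cV[R[i]]_m) : norm2 w = 1 ->
  exists x, [/\ vec x = w, cube x.1 & cube x.2].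
Proof.
move=> w1; exists (\row_i complex.Re (w i 0), \row_i complex.Im (w i 0)).
have hi i : cm (w i 0) <= 1.
  rewrite -(ler_pXn2r (n:=2)) // ?nnegrE ?cm_ge0 // expr1n -w1 cm_sqr /norm2.
  by rewrite (bigD1 i) //= lerDl sumr_ge0 // => k' _; apply: cabs2_ge0.
split.
- by apply/matrixP => i j; rewrite !mxE /= (ord1 j); case: (w i 0).
- move=> i /=; rewrite mxE in_itv /= -ler_norml; exact: le_trans (cm_Re _) (hi i).
- move=> i /=; rewrite mxE in_itv /= -ler_norml; exact: le_trans (cm_Im _) (hi i).
Qed.

(** The set of phases in [0, 1] with unit vectors in the two bundles is compact, so the strict
    inequality of domination has a positive minimal gap; periodicity extends it to all phases. *)
Lemma strict_gap : exists2 mu, 0 < mu & forall t (u w : 'cV_m),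
  cmem u (Ep t) -> cmem w (Em t) -> norm2 u = 1 -> norm2 w = 1 ->
  norm2 (it N t *m w) + mu <= norm2 (it N t *m u).
Proof.
pose S := box `&` [set p | defect p = 0].
pose g p := norm2 (it N (tt p) *m uu p) - norm2 (it N (tt p) *m ww p).
have cS : compact S.
  apply: compact_closedI; first exact: box_compact.
  apply: (@preimage_closed _ _ defect [set x | x = 0]); last exact: closed_eq.
  by move=> p _; apply: defect_continuous.
have cg : continuous g.
  have cit := it_mcont alpha A_cont N.
  move=> p; apply: cvgB.
    exact: (norm2_continuous (mcont_tt cit uu_mcont)).
  exact: (norm2_continuous (mcont_tt cit ww_mcont)).
have mem t (u w : 'cV_m) : 0 <= t <= 1 -> cmem u (Ep t) -> cmem w (Em t) ->
    norm2 u = 1 -> norm2 w = 1 -> exists p, [/\ S p, tt p = t, uu p = u & ww p = w].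
  move=> t01 hu hw u1 w1.
  have [x [xu x1 x2]] := unit_in_cube u1; have [y [yw y1 y2]] := unit_in_cube w1.
  exists (t, (x, y)); split=> //; split.
    by split=> //=; rewrite in_itv.
  rewrite /= /defect /uu /ww /tt /= xu yw u1 w1 subrr expr0n /= !add0r.
  have -> : P t *m u = u.
    by apply/esym; apply: proj_unique => //; rewrite subrr cmem0.
  have -> : P t *m w = 0.
    by apply/esym; apply: proj_unique; rewrite ?cmem0 ?subr0.
  by rewrite subrr norm2_0 addr0.
(* No pair of unit vectors exists when one of the bundles is zero, for instance when [k = 0]; any
   gap is then valid. *)
have [S0|S0] := pselect (S !=set0); last first.
  exists 1 => //; apply: periodic_reduce => [t|t t01 u w hu hw u1 w1].
    have [p1 p2] := per t.
    by split=> h u w; have := h u w; rewrite it_periodic // (cmem_eqmx _ p1) (cmem_eqmx _ p2).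
  by have [p [Sp _ _ _]] := mem t u w t01 hu hw u1 w1; case: S0; exists p.
have [c] := compact_EVT_min S0 cS (continuous_subspaceT cg).
rewrite inE => -[_ /defect0 [c1 c2 c3 c4]] hc.
exists (g c); first by rewrite subr_gt0; apply: strict.
apply: periodic_reduce => [t|t t01 u w hu hw u1 w1].
  have [p1 p2] := per t.
  by split=> h u w; have := h u w; rewrite it_periodic // (cmem_eqmx _ p1) (cmem_eqmx _ p2).
have [p [Sp pt pu pw]] := mem t u w t01 hu hw u1 w1.
have := hc p; rewrite inE => /(_ Sp).
by rewrite {2}/g pt pu pw; lra.
Qed.

(** The image of a unit vector of [Ep] has bounded norm, so the additive gap is a definite
    proportion of it. Scaling then removes the normalisation of the vectors. *)
Lemma strict_ratio : exists2 nu, 0 < nu < 1 & forall t (u w : 'cV_m),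
  cmem u (Ep t) -> cmem w (Em t) ->
  norm2 (it N t *m w) * norm2 u <= nu * (norm2 (it N t *m u) * norm2 w).
Proof.
have [mu mu0 hmu] := strict_gap.
have [L L1 hL] := periodic_mcont_bounded A_cont A_periodic.
(* The first term bounds [norm2] of the image of a unit vector; adding [2 * mu] keeps the ratio
   [1 - mu / B] positive. *)
pose B := (L ^+ N * m%:R) ^+ 2 + 2 * mu.
have B0 : 2 * mu <= B by rewrite lerDr sqr_ge0.
have Bp : 0 < B by apply: lt_le_trans B0; rewrite mulr_gt0.
have hB t (u : 'cV_m) : norm2 u = 1 -> norm2 (it N t *m u) <= B.
  move=> u1; apply: (@le_trans _ _ ((L ^+ N * m%:R) ^+ 2)); last first.
    by rewrite lerDl mulr_ge0 // ltW.
  apply: le_trans (norm2_le_l1 _) _; rewrite ler_sqr ?nnegrE ?l1_ge0 //; last first.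
    by rewrite mulr_ge0 // exprn_ge0 // (le_trans ler01).
  apply: le_trans (it_le _ L1 hL _ _ _) _; rewrite ler_wpM2l //.
    by rewrite exprn_ge0 // (le_trans ler01).
  rewrite -(ler_pXn2r (n:=2)) // ?nnegrE ?l1_ge0 //.
  by apply: le_trans (l1_le_norm2 _) _; rewrite u1 mulr1.
exists (1 - mu / B).
  rewrite subr_gt0 ltr_pdivrMr // mul1r gtrBl divr_gt0 // andbT.
  by apply: lt_le_trans B0; rewrite mulr2n mulrDl mul1r ltrDl.
move=> t u w hu hw.
have [->|u0] := eqVneq u 0; first by rewrite mulmx0 norm2_0 mulr0 mul0r mulr0.
have [->|w0] := eqVneq w 0; first by rewrite mulmx0 norm2_0 mulr0 mul0r mulr0.
have pos (x : 'cV[R[i]]_m) : x != 0 -> 0 < norm2 x.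
  by move=> x0; rewrite lt_def norm2_eq0 x0 norm2_ge0.
pose s (x : 'cV[R[i]]_m) : R[i] := ((Num.sqrt (norm2 x))^-1)%:C%C.
have cs x : x != 0 -> cm (s x) ^+ 2 = (norm2 x)^-1.
  move=> x0; rewrite cmR ger0_norm ?invr_ge0 ?sqrtr_ge0 // exprVn sqr_sqrtr //.
  exact: norm2_ge0.
have e x : x != 0 -> norm2 (s x *: x) = 1.
  by move=> x0; rewrite norm2Z cs // mulVf // norm2_eq0.
have := hmu t _ _ (cmemZ (s u) hu) (cmemZ (s w) hw) (e _ u0) (e _ w0).
have := hB t _ (e _ u0).
rewrite -!scalemxAr !norm2Z !cs //.
have pu := pos _ u0; have pw := pos _ w0.
set a := norm2 (it N t *m w); set b := norm2 (it N t *m u).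
set x := norm2 u; set y := norm2 w => h1 h2.
have h3 : y^-1 * a <= (1 - mu / B) * (x^-1 * b).
  apply: (@le_trans _ _ (x^-1 * b - mu)); first by rewrite lerBrDr.
  rewrite mulrBl mul1r lerD2l lerN2 mulrAC ler_pdivrMr //.
  by rewrite ler_wpM2l // ltW.
have -> : a * x = (y^-1 * a) * (x * y) by field; rewrite gt_eqF.
have -> : (1 - mu / B) * (b * y) = ((1 - mu / B) * (x^-1 * b)) * (x * y).
  by field; rewrite gt_eqF // gt_eqF.
by rewrite ler_wpM2r // ltW // mulr_gt0.
Qed.

Lemma splitting_iter (n : nat) t (w : 'cV_m) :
  (cmem w (Ep t) -> cmem (it n t *m w) (Ep (t + n%:R * alpha))) /\
  (cmem w (Em t) -> cmem (it n t *m w) (Em (t + n%:R * alpha))).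
Proof.
elim: n => [|n [IH1 IH2]]; first by rewrite mul0r addr0 mul1mx.
have e : t + n.+1%:R * alpha = (t + n%:R * alpha) + alpha by rewrite -natr1; ring.
have [i1 i2] := inv (t + n%:R * alpha).
rewrite e /= -!mulmxA -(cmem_eqmx _ i1) -(cmem_eqmx _ i2).
by split=> h; apply: cmem_mul; [apply: IH1 | apply: IH2].
Qed.

Lemma uniform_splittingP : exists K lam, uniform_splitting k alpha A Ep Em P N K lam.
Proof.
have [nu /andP[nu0 nu1] hnu] := strict_ratio.
have [K1 K11 hK1] := periodic_mcont_bounded P_cont proj_periodic.
have iter j t (u w : 'cV_m) : cmem u (Ep t) -> cmem w (Em t) ->
    norm2 (it (j * N) t *m w) * norm2 u <= nu ^+ j * (norm2 (it (j * N) t *m u) * norm2 w).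
  move=> hu hw; have [->|u0] := eqVneq u 0; first by rewrite mulmx0 norm2_0 mulr0 mul0r mulr0.
  have pos i : 0 < norm2 (it i t *m u).
    rewrite lt_def norm2_eq0 norm2_ge0 andbT; apply: contra_neq u0 => h.
    by rewrite -(mulKmx (it_unit alpha A_unit i t) u) h mulmx0.
  elim: j => [|j IH]; first by rewrite mul0n /= !mul1mx mul1r mulrC.
  rewrite mulSn it_add -!mulmxA.
  have := hnu _ _ _ ((splitting_iter (j * N) t u).1 hu) ((splitting_iter (j * N) t w).2 hw).
  set u1 := it (j * N) t *m u in IH *; set w1 := it (j * N) t *m w in IH *.
  set u2 := it N _ *m u1; set w2 := it N _ *m w1 => h.
  have p1 : 0 < norm2 u1 := pos _.
  rewrite -(ler_pM2r p1).
  apply: (@le_trans _ _ (nu * (norm2 u2 * norm2 w1) * norm2 u)).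
    by rewrite mulrAC ler_wpM2r // norm2_ge0.
  rewrite (_ : _ * norm2 u = (nu * norm2 u2) * (norm2 w1 * norm2 u)); last by ring.
  rewrite exprS [leRHS](_ : _ = (nu * norm2 u2) * (nu ^+ j * (norm2 u1 * norm2 w))); last by ring.
  by rewrite ler_wpM2l // mulr_ge0 ?norm2_ge0 // ltW.
(* The square root appears because [norm2] is a squared norm. Each of the two l1 norms on the left
   of [us_dom] costs a factor [m], whence the term [m ^ 2]. *)
exists (K1 + m%:R ^+ 2), (Num.sqrt nu); split => //.
- by move=> t; have [] := full t.
- exact: direct_cap.
- by move=> t; have [] := inv t.
- by move=> t; have [] := inv t.
- by move=> t w; have [] := proj t w.
- by move=> t w; have [] := proj t w.
- by apply: ler_wpDr => //; apply: exprn_ge0.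
- by move=> t; apply: ler_wpDr => //; apply: exprn_ge0.
- rewrite sqrtr_gt0 nu0 /= -(ltr_pXn2r (n:=2)) ?nnegrE ?sqrtr_ge0 // sqr_sqrtr ?expr1n //.
  exact: ltW.
move=> j t f h hf hh; have := iter j t f h hf hh.
set x := it _ _ *m h; set y := it _ _ *m f => H.
apply: (@le_trans _ _ (m%:R ^+ 2 * Num.sqrt nu ^+ j * (l1 y * l1 h))); last first.
  rewrite ler_wpM2r ?mulr_ge0 ?l1_ge0 // ler_wpM2r // lerDr.
  exact: le_trans K11.
rewrite -(ler_pXn2r (n:=2)) // ?nnegrE ?mulr_ge0 ?l1_ge0 ?exprn_ge0 //.
rewrite !exprMn (exprAC _ j 2) sqr_sqrtr ?(ltW nu0) //.
apply: (@le_trans _ _ ((m%:R ^+ 2 * norm2 x) * (m%:R ^+ 2 * norm2 f))).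
  by apply: ler_pM; rewrite ?sqr_ge0 // l1_le_norm2.
rewrite [leLHS](_ : _ = m%:R ^+ 2 * m%:R ^+ 2 * (norm2 x * norm2 f)); last by ring.
rewrite -(mulrA _ (nu ^+ j)) ler_wpM2l ?mulr_ge0 ?sqr_ge0 //; apply: le_trans H _.
rewrite ler_wpM2l ?exprn_ge0 ?(ltW nu0) //.
by apply: ler_pM; rewrite ?norm2_ge0 // norm2_le_l1.
Qed.

End UniformDomination.

Lemma dominated_uniform (R : realType) (m k : nat) (alpha : R) (A : R -> 'M[R[i]]_m) :
  (forall t, A (t + 1) = A t) -> mcont A -> (forall t, A t \in unitmx) ->
  dominated k alpha A ->
  exists Ep Em P N K lam, uniform_splitting k alpha A Ep Em P N K lam.
Proof.
move=> pA cA uA [Ep [Em [P [h1 [h2 [h3 [h4 [h5 [h6 [N N1 h7]]]]]]]]]].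
have [K [lam h]] := uniform_splittingP pA cA uA h1 h2 h3 h4 h5 (mx_continuous_mcont h6) N1 h7.
by exists Ep, Em, P, N, K, lam.
Qed.

Lemma geometric_small (R : realType) (c lam e : R) : 0 < lam < 1 -> 0 < e ->
  exists j, c * lam ^+ j < e.
Proof.
move=> /andP[l0 l1] e0.
have /cvgrPdist_lt h : (fun n => c * lam ^+ n) @ \oo --> (0 : R).
  rewrite -[X in _ --> X](mulr0 c); apply: cvgM; first exact: cvg_cst.
  by apply: cvg_expr; rewrite ger0_norm // ltW.
have [j _ hj] := h e e0; exists j; have := hj j (leqnn j).
by rewrite sub0r normrN; apply: le_lt_trans; exact: ler_norm.
Qed.

Lemma le_geometric_eq0 (R : realType) (a c lam : R) : 0 < lam < 1 -> 0 <= a ->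
  (forall j, a <= c * lam ^+ j) -> a = 0.
Proof.
move=> hl a0 h; apply/eqP; rewrite eq_le a0 andbT leNgt; apply/negP => ap.
by have [j] := geometric_small c hl ap; rewrite ltNge h.
Qed.

(** * Skew-Hermitian forms and orthogonal complements *)

Section HermitianForm.
Variables (R : realType) (m : nat) (Om : 'M[R[i]]_m).
Local Notation C := R[i].

Definition star p q (M : 'M[C]_(p, q)) : 'M[C]_(q, p) := (map_mx (@conjc R) M)^T.

Lemma starM p q r (M : 'M[C]_(p, q)) (N : 'M[C]_(q, r)) : star (M *m N) = star N *m star M.
Proof. by rewrite /star map_mxM trmx_mul. Qed.

Lemma starK p q (M : 'M[C]_(p, q)) : star (star M) = M.
Proof. by apply/matrixP => i j; rewrite !mxE conjcK. Qed.

Lemma l1_star p q (M : 'M[C]_(p, q)) : l1 (star M) = l1 M.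
Proof. by rewrite l1T l1J. Qed.

Definition hform (u w : 'cV[C]_m) : C := (star u *m Om *m w) 0 0.

Lemma hformDr u w w' : hform u (w + w') = hform u w + hform u w'.
Proof. by rewrite /hform mulmxDr mxE. Qed.

Lemma hformNr u w : hform u (- w) = - hform u w.
Proof. by rewrite /hform mulmxN mxE. Qed.

Lemma hformBr u w w' : hform u (w - w') = hform u w - hform u w'.
Proof. by rewrite hformDr hformNr. Qed.

Lemma hformDl u u' w : hform (u + u') w = hform u w + hform u' w.
Proof. by rewrite /hform /star map_mxD linearD /= !mulmxDl mxE. Qed.

Lemma hformNl u w : hform (- u) w = - hform u w.
Proof. by rewrite /hform /star map_mxN linearN /= !mulNmx mxE. Qed.

Lemma hformBl u u' w : hform (u - u') w = hform u w - hform u' w.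
Proof. by rewrite hformDl hformNl. Qed.

Lemma hform_le u w : cm (hform u w) <= l1 Om * (l1 u * l1 w).
Proof.
apply: le_trans (l1_entry _ _ _) _; apply: le_trans (l1M _ _) _.
rewrite mulrA ler_wpM2r ?l1_ge0 //; apply: le_trans (l1M _ _) _.
by rewrite l1_star mulrC.
Qed.

Lemma hform_invariant (B : 'M[C]_m) u w : star B *m Om *m B = Om ->
  hform (B *m u) (B *m w) = hform u w.
Proof. by move=> h; rewrite /hform starM -!mulmxA (mulmxA Om) (mulmxA (star B)) (mulmxA (star B)) h. Qed.

Hypothesis Om_unit : Om \in unitmx.

Lemma hform_dual x : hform x (invmx Om *m x) = (norm2 x)%:C%C.
Proof.
rewrite /hform mulmxA mulmxK // mxE /norm2 rmorph_sum /=.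
by apply: eq_bigr => i _; rewrite !mxE -cm_sqr cm_conjM.
Qed.

Definition perp (S : 'M[C]_m) : 'M[C]_m := kermx (Om^T *m star S).

Lemma rank_perp S : \rank (perp S) = (m - \rank S)%N.
Proof.
rewrite mxrank_ker eqmxMfull; last by rewrite row_full_unit unitmx_tr.
by rewrite /star mxrank_tr mxrank_map.
Qed.

Lemma star_perp S (x : 'cV_m) : cmem x (perp S) = (map_mx (@conjc R) S *m Om *m x == 0).
Proof.
rewrite /cmem; apply/sub_kermxP/eqP => h.
  by apply: trmx_inj; rewrite !trmx_mul trmx0; exact: h.
by move/(congr1 trmx): h; rewrite !trmx_mul trmx0; exact.
Qed.

Lemma perpP S (x : 'cV_m) : reflect (forall f, cmem f S -> hform f x = 0) (cmem x (perp S)).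
Proof.
rewrite star_perp; apply: (iffP eqP) => [h f /submxP[D hD]|h].
  rewrite /hform (_ : star f = map_mx (@conjc R) D *m map_mx (@conjc R) S); last first.
    by rewrite -map_mxM -hD /star map_trmx.
  by rewrite -!mulmxA (mulmxA (map_mx _ S)) h mulmx0 mxE.
apply/matrixP => i j; rewrite (ord1 j) [RHS]mxE.
have := h ((row i S)^T); rewrite /cmem trmxK row_sub => /(_ isT) <-.
by rewrite /hform /star map_trmx trmxK map_row -!row_mul [RHS]mxE.
Qed.

Hypothesis Om_skew : star Om = - Om.

Lemma hform_skew u w : hform u w = - conjc (hform w u).
Proof.
have -> : conjc (hform w u) = (star (star w *m Om *m u)) 0 0.
  by rewrite [RHS]mxE [RHS]mxE.
by rewrite !starM starK Om_skew mulNmx mulmxN mxE opprK /hform mulmxA.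
Qed.

Lemma hform_sym0 u w : hform u w = 0 -> hform w u = 0.
Proof. by move=> h; rewrite hform_skew h conjc0 oppr0. Qed.

End HermitianForm.

Lemma star_sandwich (R : realType) n (X G : 'M[R[i]]_n) i l :
  (star X *m G *m X) i l = (star (col i X) *m G *m col l X) 0 0.
Proof.
rewrite !mxE; apply: eq_bigr => b _; rewrite !mxE; congr (_ * _).
by apply: eq_bigr => a _; rewrite !mxE.
Qed.

(** * A dominated splitting that preserves a skew-Hermitian form *)

Section SymplecticSplitting.
Variables (R : realType) (m k : nat) (alpha : R) (A : R -> 'M[R[i]]_m) (Om : 'M[R[i]]_m).
Local Notation C := R[i].
Local Notation it := (cocycle_iter alpha A).
Local Notation om := (hform Om).
Hypothesis Om_unit : Om \in unitmx.
Hypothesis Om_skew : star Om = - Om.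
Hypothesis A_om : forall t, star (A t) *m Om *m A t = Om.
Hypothesis A_unit : forall t, A t \in unitmx.
Variables (Ep Em P : R -> 'M[C]_m) (N : nat) (K lam : R).
Hypothesis us : uniform_splitting k alpha A Ep Em P N K lam.
Hypothesis dim : m = (2 * k + 2)%N.

Let K0 : 0 <= K. Proof. exact: le_trans (us_K us). Qed.
Let lam_ge0 j : 0 <= lam ^+ j.
Proof. by have /andP[h _] := us_lam us; rewrite exprn_ge0 // ltW. Qed.
Let lam_le1 j : lam ^+ j <= 1.
Proof. by have /andP[h1 h2] := us_lam us; rewrite exprn_ile1 // ltW. Qed.

Lemma it_hform n t : star (it n t) *m Om *m it n t = Om.
Proof.
elim: n => [|n IH] /=; first by rewrite /star map_mx1 trmx1 mul1mx mulmx1.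
by rewrite starM -!mulmxA (mulmxA Om) (mulmxA (star (A _))) (mulmxA (star (A _)) Om)
           A_om mulmxA IH.
Qed.

Lemma hform_it n t (u w : 'cV_m) : om (it n t *m u) (it n t *m w) = om u w.
Proof. exact: hform_invariant (it_hform n t). Qed.

Lemma split_iter n t : (Ep t *m (it n t)^T == Ep (t + n%:R * alpha)%R)%MS /\
  (Em t *m (it n t)^T == Em (t + n%:R * alpha)%R)%MS.
Proof.
elim: n => [|n [/eqmxP IH1 /eqmxP IH2]].
  by rewrite /= trmx1 !mulmx1 mul0r addr0; split; apply/eqmxP.
have e : t + n.+1%:R * alpha = (t + n%:R * alpha) + alpha by rewrite -natr1; ring.
rewrite /= trmx_mul e !mulmxA; split; apply/eqmxP.
  exact: eqmx_trans (eqmxMr _ IH1) (eqmxP (us_inv_p us _)).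
exact: eqmx_trans (eqmxMr _ IH2) (eqmxP (us_inv_m us _)).
Qed.

Lemma iter_p n t (u : 'cV_m) : cmem u (Ep t) -> cmem (it n t *m u) (Ep (t + n%:R * alpha)).
Proof. by move=> h; rewrite -(cmem_eqmx _ (split_iter n t).1); apply: cmem_mul. Qed.

Lemma iter_m n t (u : 'cV_m) : cmem u (Em t) -> cmem (it n t *m u) (Em (t + n%:R * alpha)).
Proof. by move=> h; rewrite -(cmem_eqmx _ (split_iter n t).2); apply: cmem_mul. Qed.

Lemma us_proj_unique t (u w : 'cV_m) :
  cmem u (Ep t) -> cmem (w - u) (Em t) -> u = P t *m w.
Proof.
exact: (projection_unique (us_direct us (t := t)) (us_P us t w) (us_Q us t w)).
Qed.

Lemma proj_iter n t (w : 'cV_m) : it n t *m (P t *m w) = P (t + n%:R * alpha) *m (it n t *m w).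
Proof.
apply: us_proj_unique; first exact: iter_p (us_P us _ _).
by rewrite -mulmxBr; apply: iter_m (us_Q us _ _).
Qed.

Lemma back_p n t (u : 'cV_m) : cmem u (Ep t) ->
  exists2 u', cmem u' (Ep (t - n%:R * alpha)) & it n (t - n%:R * alpha) *m u' = u.
Proof.
move=> h; exists (invmx (it n (t - n%:R * alpha)) *m u); last first.
  by rewrite mulKVmx // it_unit.
apply: cmem_inj; first exact: it_unit.
by rewrite (cmem_eqmx _ (split_iter _ _).1) subrK.
Qed.

Lemma back_m n t (u : 'cV_m) : cmem u (Em t) ->
  exists2 u', cmem u' (Em (t - n%:R * alpha)) & it n (t - n%:R * alpha) *m u' = u.
Proof.
move=> h; exists (invmx (it n (t - n%:R * alpha)) *m u); last first.
  by rewrite mulKVmx // it_unit.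
apply: cmem_inj; first exact: it_unit.
by rewrite (cmem_eqmx _ (split_iter _ _).2) subrK.
Qed.

Let Q : R := 1 + m%:R ^+ 2 + (1 + K) * l1 (invmx Om) + l1 Om.

Let Q1 : 1 <= Q.
Proof.
rewrite /Q -!addrA lerDl !addr_ge0 ?l1_ge0 // mulr_ge0 ?l1_ge0 //.
by rewrite addr_ge0.
Qed.
Let Q0 : 0 <= Q. Proof. exact: le_trans Q1. Qed.

Lemma hform_leQ (u w : 'cV_m) : cm (om u w) <= Q * (l1 u * l1 w).
Proof.
apply: le_trans (hform_le _ _ _) _; rewrite ler_wpM2r ?mulr_ge0 ?l1_ge0 //.
by rewrite /Q lerDr !addr_ge0 // mulr_ge0 ?l1_ge0 // addr_ge0.
Qed.

(** The vector [invmx Om *m x] pairs with [x] to the squared norm of [x]. Removing its component in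
    [Ep] does not change this pairing, since [x] is orthogonal to [Ep], and leaves a vector of [Em]:
    vectors orthogonal to the fast bundle are detected by the slow one, with a uniform constant. *)
Lemma perp_pair t (x : 'cV_m) : (forall f, cmem f (Ep t) -> om f x = 0) ->
  exists h, [/\ cmem h (Em t), l1 h <= Q * l1 x & l1 x ^+ 2 <= Q * cm (om x h)].
Proof.
move=> hx; pose y := invmx Om *m x.
have xy : om x y = (norm2 x)%:C%C by exact: (hform_dual Om_unit x).
exists (y - P t *m y); split; first exact: (us_Q us).
  apply: le_trans (l1B _ _) _.
  have hy : l1 y <= l1 (invmx Om) * l1 x by exact: l1M.
  apply: (@le_trans _ _ ((1 + K) * l1 y)).
    rewrite mulrDl mul1r lerD2l; apply: le_trans (l1M _ _) _.
    by rewrite ler_wpM2r ?l1_ge0 // (us_bound us).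
  apply: (@le_trans _ _ ((1 + K) * (l1 (invmx Om) * l1 x))).
    by rewrite ler_wpM2l // addr_ge0.
  rewrite mulrA ler_wpM2r ?l1_ge0 // /Q.
  have := l1_ge0 Om; have := sqr_ge0 (m%:R : R); lra.
have -> : om x (y - P t *m y) = (norm2 x)%:C%C.
  rewrite hformBr xy (hform_sym0 Om_skew) ?subr0 //; apply: hx; exact: (us_P us).
rewrite cmR ger0_norm ?norm2_ge0 //; apply: le_trans (l1_le_norm2 _) _.
rewrite ler_wpM2r ?norm2_ge0 //.
have : 0 <= (1 + K) * l1 (invmx Om) by rewrite mulr_ge0 ?l1_ge0 ?addr_ge0.
rewrite /Q; have := l1_ge0 Om; lra.
Qed.

(** Both spaces have dimension [m - k = k + 2], and twice this exceeds [m = 2 * k + 2]. *)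
Lemma Em_meets_perp t : exists x : 'cV_m, [/\ x != 0, cmem x (Em t) & cmem x (perp Om (Ep t))].
Proof.
have rm := us_rankD us t; have rp := us_rank us t.
have rq := rank_perp Om_unit (Ep t).
have : (Em t :&: perp Om (Ep t))%MS != 0.
  rewrite -mxrank_eq0; have := mxrank_sum_cap (Em t) (perp Om (Ep t)).
  have := rank_leq_col (Em t + perp Om (Ep t))%MS.
  by rewrite rq; lia.
case/rowV0Pn => v vs v0; exists v^T; rewrite /cmem trmxK.
split; first by apply: contra_neq v0 => h; rewrite -[v]trmxK h trmx0.
  exact: submx_trans vs (capmxSl _ _).
exact: submx_trans vs (capmxSr _ _).
Qed.

(* For x in Em orthogonal to Ep, transport back by j periods: u is then smaller than x by a factor
   lam^j, and so is w times x, by duality with a vector of Em. *)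
Lemma isotropic t (u w : 'cV_m) : cmem u (Ep t) -> cmem w (Ep t) -> om u w = 0.
Proof.
move=> hu hw; have [x [x0 xm /perpP xp]] := Em_meets_perp t.
suff : l1 x * cm (om u w) = 0.
  by move/eqP; rewrite mulf_eq0 l1_eq0 (negbTE x0) /= cm_eq0 => /eqP.
apply: (@le_geometric_eq0 _ _ (Q * K * l1 u * (Q * Q * Q * K * l1 x * l1 w)) lam).
- exact: (us_lam us).
- by rewrite mulr_ge0 ?l1_ge0 ?cm_ge0.
move=> j; set n := (j * N)%N.
have [u' hu' eu] := back_p n hu; have [w' hw' ew] := back_p n hw.
have [x' hx' ex] := back_m n xm.
set t' := t - _ in hu' eu hw' ew hx' ex.
have tt : t' + n%:R * alpha = t by rewrite /t' subrK.
have xp' f : cmem f (Ep t') -> om f x' = 0.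
  by move=> hf; rewrite -(hform_it n t') ex xp // -tt; apply: iter_p.
have [h [hm h1 h2]] := perp_pair xp'.
have d1 := us_dom us j hw' hm; rewrite -/n ew in d1.
have d2 := us_dom us j hu' hx'; rewrite -/n ex eu in d2.
rewrite -(hform_it n t') ex in h2.
have h3 : l1 x' ^+ 2 <= Q * (Q * (l1 x * l1 (it n t' *m h))).
  by apply: le_trans h2 _; rewrite ler_wpM2l // hform_leQ.
have x'0 : 0 < l1 x'.
  by rewrite l1_gt0; apply: contra_neq x0 => e; rewrite -ex e mulmx0.
have h4 : l1 x' * l1 w' <= Q * Q * Q * K * lam ^+ j * l1 x * l1 w.
  rewrite -(ler_pM2l x'0) mulrA -expr2.
  apply: (@le_trans _ _ (Q * (Q * (l1 x * l1 (it n t' *m h))) * l1 w')).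
    by rewrite ler_wpM2r ?l1_ge0.
  rewrite [leLHS](_ : _ = (Q * Q * l1 x) * (l1 (it n t' *m h) * l1 w')); last by ring.
  have p1 : 0 <= Q * Q * l1 x by rewrite !mulr_ge0 ?l1_ge0.
  apply: le_trans (ler_wpM2l p1 d1) _.
  rewrite [leRHS](_ : _ = (Q * Q * l1 x) * (K * lam ^+ j * (l1 w * (Q * l1 x')))); last by ring.
  by rewrite !ler_wpM2l // ?mulr_ge0 ?l1_ge0.
rewrite -eu -ew hform_it.
apply: (@le_trans _ _ (l1 x * (Q * (l1 u' * l1 w')))).
  by rewrite ler_wpM2l ?l1_ge0 // hform_leQ.
rewrite [leLHS](_ : _ = Q * (l1 x * l1 u') * l1 w'); last by ring.
apply: (@le_trans _ _ (Q * (K * lam ^+ j * (l1 u * l1 x')) * l1 w')).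
  by rewrite ler_wpM2r ?l1_ge0 // ler_wpM2l.
rewrite [leLHS](_ : _ = (Q * K * lam ^+ j * l1 u) * (l1 x' * l1 w')); last by ring.
have p2 : 0 <= Q * K * lam ^+ j * l1 u by rewrite !mulr_ge0 ?l1_ge0.
apply: le_trans (ler_wpM2l p2 h4) _.
rewrite eu ew.
have p3 : 0 <= Q * K * l1 u * (Q * Q * Q * K * l1 x * l1 w) by rewrite !mulr_ge0 ?l1_ge0.
rewrite [leLHS](_ : _ = Q * K * l1 u * (Q * Q * Q * K * l1 x * l1 w) * lam ^+ j * lam ^+ j);
  last by ring.
by rewrite -[leRHS]mulr1; apply: ler_wpM2l => //; rewrite mulr_ge0.
Qed.

Let Q3 : R := 1 + Q * (Q * (K * Q)).
Let Q31 : 1 <= Q3. Proof. by rewrite lerDl !mulr_ge0. Qed.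

(** If a fast vector [u] shrank, the slow ones would shrink at least as much up to a constant. But
    [u] is orthogonal to [Ep] by isotropy, so some slow [h] of comparable size has [om u h] at least
    of the order of the square of [u], and this pairing is invariant. *)
Lemma no_contraction j t (u : 'cV_m) : cmem u (Ep t) -> l1 u <= Q3 * l1 (it (j * N) t *m u).
Proof.
move=> hu; have [->|u0] := eqVneq u 0; first by rewrite mulmx0 l10 mulr0.
have [h [hm h1 h2]] := perp_pair (fun f hf => isotropic hf hu).
rewrite -l1_gt0 in u0.
have d := us_dom us j hu hm.
rewrite -(hform_it (j * N) t) in h2.
set au := it _ _ *m u in d h2 *; set ah := it _ _ *m h in d h2 *.
have d' : l1 ah <= K * Q * l1 au.
  rewrite -(ler_pM2r u0); apply: le_trans d _.
  apply: (@le_trans _ _ (K * 1 * (l1 au * (Q * l1 u)))).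
    by rewrite !ler_pM ?mulr_ge0 ?l1_ge0 // ler_wpM2l ?l1_ge0.
  by apply: eq_ler; ring.
rewrite -(ler_pXn2r (n:=2)) // ?nnegrE ?mulr_ge0 ?l1_ge0 //; last exact: le_trans Q31.
apply: (@le_trans _ _ (Q * (Q * (l1 au * (K * Q * l1 au))))).
  apply: le_trans h2 _; rewrite ler_wpM2l //; apply: le_trans (hform_leQ _ _) _.
  by rewrite !ler_wpM2l ?l1_ge0.
rewrite exprMn [leLHS](_ : _ = Q * (Q * (K * Q)) * l1 au ^+ 2); last by ring.
rewrite ler_wpM2r ?sqr_ge0 //; apply: (@le_trans _ _ Q3); first by rewrite lerDr.
by rewrite expr2 ler_peMl // (le_trans ler01).
Qed.

(** The kernel [Kr] of [M0] is the center at phase 0: the vectors of [Em] orthogonal to [Ep].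
    Describing it by one matrix makes closeness quantitative: a vector [y] is within
    [l1 (pinvmx M0) * l1 (M0 *m y)] of the center. *)
Local Notation M0 := (col_mx (P 0) (map_mx (@conjc R) (Ep 0) *m Om)).
Local Notation Kr := (kermx M0^T).

Lemma centerP (z : 'cV_m) : cmem z Kr <-> P 0 *m z = 0 /\ cmem z (perp Om (Ep 0)).
Proof.
split=> [/sub_kermxP h|[h1 h2]].
  have : M0 *m z = 0 by apply: trmx_inj; rewrite trmx_mul h trmx0.
  rewrite mul_col_mx -(col_mx0 C m m 1) => /eq_col_mx [-> e]; split=> //.
  by rewrite star_perp; apply/eqP.
move/eqP: (etrans (esym (star_perp Om (Ep 0) z)) h2) => {}h2; apply/sub_kermxP; apply: trmx_inj.
by rewrite trmx_mul !trmxK trmx0 mul_col_mx h1 h2 col_mx0.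
Qed.

(** By isotropy [Ep] lies in its own orthogonal, so [x - P 0 *m x] stays in that orthogonal and
    belongs to the center. The center and [Ep] meet only in 0, so the center has dimension
    [(m - k) - k = 2]. *)
Lemma center_sum : (Kr + Ep 0 == perp Om (Ep 0))%MS /\ \rank Kr = 2%N.
Proof.
have eq : (Kr + Ep 0 == perp Om (Ep 0))%MS.
  apply/andP; split.
    rewrite addsmx_sub; apply/andP; split; apply/row_subP => i.
      have : cmem (row i Kr)^T Kr by rewrite /cmem trmxK row_sub.
      by move/centerP => [_]; rewrite /cmem trmxK.
    have : cmem (row i (Ep 0))^T (perp Om (Ep 0)); last by rewrite /cmem trmxK.
    apply/perpP => f hf; apply: isotropic hf _.
    by rewrite /cmem trmxK row_sub.
  apply/row_subP => i; set x := row i _.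
  have hx : cmem x^T (perp Om (Ep 0)) by rewrite /cmem trmxK row_sub.
  have px := us_P us 0 x^T.
  rewrite -[x]trmxK -[x^T](subrK (P 0 *m x^T)) linearD.
  apply: addmx_sub_adds; last exact: px.
  have : cmem (x^T - P 0 *m x^T) Kr.
    apply/centerP; split; last first.
      apply: cmemB => //; apply/perpP => f hf; exact: isotropic hf px.
    rewrite mulmxBr; apply/eqP; rewrite subr_eq0; apply/eqP.
    apply: us_proj_unique; last by rewrite subrr cmem0.
    exact: px.
  by [].
split=> //; have := mxrank_sum_cap Kr (Ep 0).
have -> : (Kr :&: Ep 0)%MS = 0.
  apply/eqP/rowV0P => v; rewrite sub_capmx => /andP[v1 v2].
  have c1 : cmem v^T Kr by rewrite /cmem trmxK.
  have c2 : cmem v^T (Ep 0) by rewrite /cmem trmxK.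
  have [p0 _] := (centerP _).1 c1.
  have : v^T = P 0 *m v^T by apply: us_proj_unique => //; rewrite subrr cmem0.
  by rewrite p0 => /(congr1 trmx); rewrite trmxK trmx0.
have -> : \rank (Kr + Ep 0)%MS = (m - k)%N.
  by rewrite (eqmx_rank eq) -(us_rank us 0); exact: rank_perp.
rewrite (us_rank us) mxrank0.
by have := us_rankD us 0; rewrite (us_rank us); lia.
Qed.

Lemma center_basis : exists B : 'M[C]_(2, m), row_free B /\ (B == Kr)%MS.
Proof.
have [_ r] := center_sum.
have : exists B : 'M[C]_(\rank Kr, m), row_free B /\ (B == Kr)%MS.
  by exists (row_base Kr); split; [exact: row_base_free | apply/eqmxP/eq_row_base].
by rewrite r.
Qed.

(** Such a [z] is orthogonal to the center and to [Ep], hence to their sum, the orthogonal of [Ep].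
    The double orthogonal of [Ep] is [Ep], so [z] is in [Ep], and [P 0] both fixes and kills it. *)
Lemma center_nondegenerate (z : 'cV_m) : cmem z Kr ->
  (forall w, cmem w Kr -> om w z = 0) -> z = 0.
Proof.
move=> hz h; have [/eqmxP eq r] := center_sum; have [pz /perpP qz] := (centerP z).1 hz.
have zz : cmem z (perp Om (perp Om (Ep 0))).
  apply/perpP => f; rewrite /cmem -eq => /sub_addsmxP [[D1 D2] /= hD].
  rewrite -[f]trmxK hD linearD hformDl [X in X + _]h ?[X in _ + X]qz ?add0r //.
    by rewrite /cmem trmxK submxMl.
  by rewrite /cmem trmxK submxMl.
have sub : (Ep 0 <= perp Om (perp Om (Ep 0)))%MS.
  apply/row_subP => i.
  have : cmem (row i (Ep 0))^T (perp Om (perp Om (Ep 0))); last by rewrite /cmem trmxK.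
  apply/perpP => f /perpP hf; apply: (hform_sym0 Om_skew); apply: hf.
  by rewrite /cmem trmxK row_sub.
have zE : cmem z (Ep 0).
  have [_ e] := mxrank_leqif_sup sub; apply: submx_trans zz _; rewrite -e.
  rewrite !(rank_perp Om_unit) (us_rank us); apply/eqP.
  by have := us_rankD us 0; rewrite (us_rank us); lia.
have : z = P 0 *m z by apply: us_proj_unique => //; rewrite subrr cmem0.
by rewrite pz.
Qed.

Lemma det2 (X : 'M[C]_2) : \det X = X 0 0 * X 1 1 - X 0 1 * X 1 0.
Proof.
rewrite (expand_det_row _ 0) !big_ord_recl big_ord0 addr0 /cofactor !det_mx11 !mxE /=.
rewrite expr0 mul1r expr1 mulN1r mulrN; congr (_ - _).
  by congr (X _ _ * X _ _); apply/val_inj.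
by congr (X _ _ * X _ _); apply/val_inj.
Qed.

Lemma center_gram (B : 'M[C]_(2, m)) : row_free B -> (B == Kr)%MS ->
  \det (star B^T *m Om *m B^T) != 0.
Proof.
move=> fB /eqmxP eB; rewrite -det_tr; apply/det0P => -[v v0 hv].
have hG : star B^T *m Om *m B^T *m v^T = 0.
  by apply: trmx_inj; rewrite trmx_mul trmxK hv trmx0.
have z0 : B^T *m v^T = 0.
  apply: center_nondegenerate.
    by rewrite /cmem trmx_mul !trmxK -eB submxMl.
  move=> w; rewrite /cmem -eB => /submxP[D hD].
  have -> : w = B^T *m D^T by rewrite -trmx_mul -hD trmxK.
  by move: hG; rewrite /hform starM -!mulmxA => ->; rewrite mulmx0 mxE.
have : v *m B = 0 by apply: trmx_inj; rewrite trmx_mul z0 trmx0.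
by move/eqP; rewrite mulmx_free_eq0 // (negbTE v0).
Qed.

(** Each end controls one half of [M0 *m y]. Smallness at the forward end bounds [P 0 *m y], a fast
    vector that cannot have contracted on the way. Smallness at the backward end bounds the pairing
    with a fast [u]: transport [u] back to [u'], which is no larger than a constant times [u], and
    pair it with the small [z]. *)
Lemma base_estimates : exists2 Q4, 1 <= Q4 & forall j (y z : 'cV[C]_m) (s : R),
  l1 (it (j * N) 0 *m y) <= s -> l1 z <= s ->
  l1 (y - it (j * N) (0 - (j * N)%:R * alpha) *m z) <= s ->
  l1 (M0 *m y) <= Q4 * s.
Proof.
exists (1 + Q3 * K + Q * (Q3 + 1) * l1 (Ep 0)).
  have Q30 : 0 <= Q3 by exact: le_trans Q31.
  by rewrite -addrA lerDl; apply: addr_ge0; rewrite !mulr_ge0 ?l1_ge0 // addr_ge0.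
move=> j y z s h1 h2 h3; set n := (j * N)%N in h1 h3 *; set t := 0 - _ in h3.
have Q30 : 0 <= Q3 by exact: le_trans Q31.
have s0 : 0 <= s by apply: le_trans h2; exact: l1_ge0.
have cpy : cmem (P 0 *m y) (Ep 0) by exact: (us_P us).
have a1 : l1 (P 0 *m y) <= Q3 * K * s.
  apply: le_trans (no_contraction j cpy) _; rewrite -mulrA ler_wpM2l //.
  rewrite -/n proj_iter; apply: le_trans (l1M _ _) _.
  by apply: ler_pM; rewrite ?l1_ge0 // (us_bound us).
have a2 u : cmem u (Ep 0) -> cm (om u y) <= Q * (Q3 + 1) * s * l1 u.
  move=> hu; have [u' hu' eu] := back_p n hu; rewrite -/t in hu' eu.
  have c := no_contraction j hu'; rewrite -/n eu in c.
  rewrite -(subrK (it n t *m z) y) hformDr -{2}eu hform_it; apply: le_trans (cmD _ _) _.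
  apply: (@le_trans _ _ (Q * (l1 u * s) + Q * ((Q3 * l1 u) * s))).
    apply: lerD; apply: le_trans (hform_leQ _ _) _; rewrite ler_wpM2l //.
      by rewrite ler_wpM2l ?l1_ge0.
    by rewrite ler_pM ?l1_ge0.
  by apply: eq_ler; ring.
rewrite mul_col_mx.
have -> : l1 (col_mx (P 0 *m y) (map_mx (@conjc R) (Ep 0) *m Om *m y)) =
    l1 (P 0 *m y) + l1 (map_mx (@conjc R) (Ep 0) *m Om *m y).
  rewrite /l1 big_split_ord /=; congr (_ + _); apply: eq_bigr => i _;
  by rewrite !big_ord1 ?col_mxEu ?col_mxEd.
rewrite [leRHS](_ : _ = s + (Q3 * K * s + Q * (Q3 + 1) * s * l1 (Ep 0))); last by ring.
apply: ler_wpDl => //; apply: lerD => //.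
rewrite /l1 mulr_sumr; apply: ler_sum => i _; rewrite big_ord1.
have := a2 (row i (Ep 0))^T; rewrite /cmem trmxK row_sub => /(_ isT).
rewrite (_ : om _ _ = (map_mx (@conjc R) (Ep 0) *m Om *m y) i 0); last first.
  by rewrite /hform /star map_trmx trmxK map_row -!row_mul mxE.
rewrite l1T /l1 big_ord1 => h; apply: le_trans h _; rewrite ler_wpM2l //.
  by rewrite !mulr_ge0 // addr_ge0.
by apply: ler_sum => l _; rewrite mxE.
Qed.

(** Both vectors are within [p * s] of the two-dimensional center, where their minors are multiples
    of the determinant of their coordinates. This determinant is controlled by the Gram matrix of
    the form. The form is skew-Hermitian and not alternating, so [om y y] need not vanish and all
    four Gram entries have to be estimated. *)
Lemma wedge_bound : exists2 Q5, 1 <= Q5 &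
  forall j (y y' z z' : 'cV[C]_m) (s Y : R), s <= Y -> l1 y <= Y -> l1 y' <= Y ->
  l1 (it (j * N) 0 *m y) <= s -> l1 z <= s ->
  l1 (y - it (j * N) (0 - (j * N)%:R * alpha) *m z) <= s ->
  l1 (it (j * N) 0 *m y') <= s -> l1 z' <= s ->
  l1 (y' - it (j * N) (0 - (j * N)%:R * alpha) *m z') <= s ->
  forall a b, cm (y a 0 * y' b 0 - y b 0 * y' a 0) <= Q5 * (s * Y).
Proof.
have [Q4 Q41 hQ4] := base_estimates.
have [B [fB eB]] := center_basis.
have dG := center_gram fB eB; set G := _ *m _ in dG.
have [p pE p0] : exists2 p, p = l1 (pinvmx M0) * Q4 & 0 <= p.
  by eexists; first reflexivity; rewrite mulr_ge0 ?l1_ge0 // (le_trans ler01).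
have [q qE q0] : exists2 q, q = Q * (1 + p) ^+ 2 & 0 <= q.
  by eexists; first reflexivity; rewrite mulr_ge0 ?sqr_ge0.
have [D DE D0] : exists2 D, D = 2 * q ^+ 2 / cm (\det G) & 0 <= D.
  by eexists; first reflexivity; rewrite mulr_ge0 ?invr_ge0 ?cm_ge0 // mulr_ge0 ?sqr_ge0.
have [W WE W0] : exists2 W, W = 2 * l1 B ^+ 2 * (1 + D) & 0 <= W.
  by eexists; first reflexivity; rewrite mulr_ge0 ?addr_ge0 // mulr_ge0 ?sqr_ge0.
exists (1 + (W + 4 * p + 2 * p ^+ 2)).
  by have := sqr_ge0 p; lra.
move=> j y y' z z' s Y sY hy hy' h1 h2 h3 h1' h2' h3' a b.
have s0 : 0 <= s by apply: le_trans h2; exact: l1_ge0.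
have Y0 : 0 <= Y by exact: le_trans sY.
have [pr prE] : exists pr : 'cV[C]_m -> 'cV[C]_m, forall x, pr x = x - pinvmx M0 *m (M0 *m x).
  by eexists.
have pr1 (x : 'cV[C]_m) : M0 *m pr x = 0.
  by rewrite prE mulmxBr (mulmxA M0 (pinvmx M0)) (mulmxA _ M0) mulmxKpV // subrr.
have pr2 (x z0 : 'cV[C]_m) : l1 (it (j * N) 0 *m x) <= s -> l1 z0 <= s ->
    l1 (x - it (j * N) (0 - (j * N)%:R * alpha) *m z0) <= s -> l1 (x - pr x) <= p * s.
  move=> g1 g2 g3; rewrite prE opprB addrC subrK; apply: le_trans (l1M _ _) _.
  by rewrite pE -mulrA ler_wpM2l ?l1_ge0 //; apply: hQ4 g1 g2 g3.
have pr3 (x : 'cV[C]_m) : exists c : 'cV[C]_2, pr x = B^T *m c.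
  have : ((pr x)^T <= B)%MS.
    by rewrite (eqmxP eB); apply/sub_kermxP; rewrite -trmx_mul pr1 trmx0.
  by case/submxP => D' hD; exists D'^T; rewrite -trmx_mul -hD trmxK.
have e1 := pr2 _ _ h1 h2 h3; have e2 := pr2 _ _ h1' h2' h3'.
have [c hc] := pr3 y; have [c' hc'] := pr3 y'.
set r := y - pr y in e1; set r' := y' - pr y' in e2.
have omb (x x' : 'cV[C]_m) : l1 x <= Y -> l1 x' <= Y ->
    l1 (it (j * N) 0 *m x) <= s -> l1 (it (j * N) 0 *m x') <= s ->
    l1 (x - pr x) <= p * s -> l1 (x' - pr x') <= p * s ->
    cm (om (pr x) (pr x')) <= q * (s * Y).
  move=> g1 g2 g3 g4 g5 g6.
  have -> : om (pr x) (pr x') = om x x' - om x (x' - pr x') - om (x - pr x) x'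
      + om (x - pr x) (x' - pr x').
    rewrite !(hformBl, hformBr); move: (om x x') (om x _) (om _ x') (om _ _) => a1 a2 a3 a4.
    by ring.
  (* Invariance moves the form to the forward end, where both vectors are at most [s]. *)
  have b1 : cm (om x x') <= Q * (s * Y).
    rewrite -(hform_it (j * N) 0); apply: le_trans (hform_leQ _ _) _; rewrite ler_wpM2l //.
    by apply: ler_pM; rewrite ?l1_ge0 // (le_trans g4).
  have b2 : cm (om x (x' - pr x')) <= Q * (p * (s * Y)).
    apply: le_trans (hform_leQ _ _) _; rewrite ler_wpM2l //.
    rewrite [leRHS](_ : _ = Y * (p * s)); last by ring.
    by apply: ler_pM; rewrite ?l1_ge0.
  have b3 : cm (om (x - pr x) x') <= Q * (p * (s * Y)).
    apply: le_trans (hform_leQ _ _) _; rewrite ler_wpM2l //.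
    rewrite [leRHS](_ : _ = (p * s) * Y); last by ring.
    by apply: ler_pM; rewrite ?l1_ge0.
  have b4 : cm (om (x - pr x) (x' - pr x')) <= Q * (p ^+ 2 * (s * Y)).
    apply: le_trans (hform_leQ _ _) _; rewrite ler_wpM2l //.
    apply: (@le_trans _ _ ((p * s) * (p * s))); first by rewrite ler_pM ?l1_ge0.
    rewrite [leLHS](_ : _ = p ^+ 2 * (s * s)); last by ring.
    by rewrite !ler_wpM2l ?sqr_ge0.
  apply: le_trans (cmD _ _) _; apply: le_trans (lerD (cm_triB _ _) b4) _.
  apply: le_trans (lerD (lerD (cm_triB _ _) b3) (lexx _)) _.
  apply: le_trans (lerD (lerD (lerD b1 b2) (lexx _)) (lexx _)) _.
  by apply: eq_ler; rewrite qE; ring.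
pose X : 'M[C]_2 := \matrix_(i, l) if l == 0 then c i 0 else c' i 0.
have colX l : B^T *m col l X = if l == 0 then pr y else pr y'.
  rewrite hc hc'; case: ifP => hl; congr (_ *m _); apply/matrixP => i0 j0;
  by rewrite !mxE hl (ord1 j0).
have entry i l : (star X *m G *m X) i l = om (B^T *m col i X) (B^T *m col l X).
  by rewrite star_sandwich /G /hform starM -!mulmxA.
have dX : cm (\det X) <= (1 + D) * (s * Y).
  (* Take determinants in the Gram matrix [star X *m G *m X], whose entries are at most
     [q * (s * Y)]; [G] is invertible by nondegeneracy on the center. *)
  have : cm (\det X) ^+ 2 * cm (\det G) <= 2 * q ^+ 2 * (s * Y) ^+ 2.
    have -> : cm (\det X) ^+ 2 * cm (\det G) = cm (\det (star X *m G *m X)).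
      rewrite !det_mulmx !cmM /star det_tr det_map_mx cmJ expr2; ring.
    rewrite det2 !entry !colX /=; apply: le_trans (cm_triB _ _) _; rewrite !cmM.
    rewrite [leRHS](_ : _ = (q * (s * Y)) * (q * (s * Y)) + (q * (s * Y)) * (q * (s * Y)));
      last by ring.
    by apply: lerD; apply: ler_pM; rewrite ?cm_ge0 //; apply: omb.
  rewrite -ler_pdivlMr ?cm_gt0 // => hh.
  rewrite -(ler_pXn2r (n:=2)) // ?nnegrE ?cm_ge0 ?mulr_ge0 ?addr_ge0 //.
  apply: le_trans hh _; rewrite mulrAC -DE [leRHS]exprMn ler_wpM2r ?sqr_ge0 //.
  by rewrite sqrrD expr1n mul1r mulr2n; have := sqr_ge0 D; lra.
have wz : cm (pr y a 0 * pr y' b 0 - pr y b 0 * pr y' a 0) <= W * (s * Y).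
  have e (x : 'cV[C]_2) i : (B^T *m x) i 0 = B 0 i * x 0 0 + B 1 i * x 1 0.
    rewrite mxE !big_ord_recl big_ord0 addr0 !mxE.
    by rewrite (_ : lift _ _ = 1) //; apply/val_inj.
  have -> : pr y a 0 * pr y' b 0 - pr y b 0 * pr y' a 0 =
      (B 0 a * B 1 b - B 1 a * B 0 b) * \det X.
    by rewrite hc hc' !e det2 !mxE /=; ring.
  rewrite cmM WE -(mulrA _ (1 + D)); apply: ler_pM; rewrite ?cm_ge0 //.
  apply: le_trans (cm_triB _ _) _; rewrite !cmM mulr2n mulrDl mul1r expr2.
  by apply: lerD; apply: ler_pM; rewrite ?cm_ge0 // l1_entry.
have en (x : 'cV[C]_m) i : cm (x i 0) <= l1 x by exact: l1_entry.
have -> : y a 0 * y' b 0 - y b 0 * y' a 0 =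
   (pr y a 0 * pr y' b 0 - pr y b 0 * pr y' a 0)
   + (r a 0 * y' b 0 - r b 0 * y' a 0) + (y a 0 * r' b 0 - y b 0 * r' a 0)
   - (r a 0 * r' b 0 - r b 0 * r' a 0).
  by rewrite /r /r' !mxE; ring.
have t1 i l : cm (r i 0 * y' l 0) <= p * (s * Y).
  rewrite cmM [leRHS](_ : _ = (p * s) * Y); last by ring.
  by rewrite ler_pM ?cm_ge0 // (le_trans (en _ _)).
have t2 i l : cm (y i 0 * r' l 0) <= p * (s * Y).
  rewrite cmM [leRHS](_ : _ = Y * (p * s)); last by ring.
  by rewrite ler_pM ?cm_ge0 // (le_trans (en _ _)).
have t3 i l : cm (r i 0 * r' l 0) <= p ^+ 2 * (s * Y).
  rewrite cmM; apply: (@le_trans _ _ ((p * s) * (p * s))).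
    by rewrite ler_pM ?cm_ge0 // (le_trans (en _ _)).
  rewrite [leLHS](_ : _ = p ^+ 2 * (s * s)); last by ring.
  by rewrite !ler_wpM2l ?sqr_ge0.
have tB (x x' : C) e : cm x <= e -> cm x' <= e -> cm (x - x') <= e + e.
  by move=> g1 g2; apply: le_trans (cm_triB _ _) (lerD g1 g2).
apply: le_trans (cm_triB _ _) _.
apply: le_trans (lerD (cmD _ _) (tB _ _ _ (t3 _ _) (t3 _ _))) _.
apply: le_trans (lerD (lerD (cmD _ _) (tB _ _ _ (t2 _ _) (t2 _ _))) (lexx _)) _.
apply: le_trans (lerD (lerD (lerD wz (tB _ _ _ (t1 _ _) (t1 _ _))) (lexx _)) (lexx _)) _.
have : 0 <= s * Y by rewrite mulr_ge0.
rewrite !mulrDl; lra.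
Qed.

End SymplecticSplitting.

(** * The invariant form of the dual cocycle *)

Section DualSymplectic.
Variables (R : realType) (d : nat) (vhat : int -> R[i]) (E : R).
Local Notation C := R[i].
Hypothesis d1 : (1 <= d)%N.
Hypothesis vd : vhat d%:Z != 0.
Hypothesis v_conj : forall k : nat, (k <= d)%N -> vhat (- k%:Z) = conjc (vhat k%:Z).

(* The Wronskian of the dual operator: i >= d labels the sites to the left of the cut, j < d
   those to the right. *)
Definition wronskian_entry (i j : nat) : C :=
  if [&& d <= i, j < d & i - j <= d]%N then vhat (i%:Z - j%:Z)
  else if [&& i < d, d <= j & j - i <= d]%N then - vhat (i%:Z - j%:Z) else 0.

Definition wronskian : 'M[C]_(2 * d) := \matrix_(i, j) wronskian_entry i j.

Lemma v_conjZ (k : int) : (`|k| <= d)%N -> vhat (- k) = conjc (vhat k).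
Proof.
case: (intP k) => [|n|n] h; first exact: v_conj.
  exact: v_conj.
by rewrite opprK v_conj ?conjcK //; move: h; rewrite absz_nat abszN absz_nat.
Qed.

Lemma wronskian_skew : star wronskian = - wronskian.
Proof.
apply/matrixP => i j; rewrite !mxE /wronskian_entry.
case: (leqP d i) => hi; case: (leqP d j) => hj /=; rewrite ?andbF ?conjc0 ?oppr0 //=.
  case: (leqP (i - j) d) => h; rewrite ?conjc0 ?oppr0 //.
  by rewrite rmorphN /= -v_conjZ ?opprB //; lia.
case: (leqP (j - i) d) => h; rewrite ?conjc0 ?oppr0 // opprK.
by rewrite -v_conjZ ?opprB //; lia.
Qed.

(** Both nonzero blocks are triangular. Column [p < d] meets only the rows from [d] to [d + p], the
    last one with coefficient [vhat d]; column [2 * d - 1 - p] meets only the rows from [d - 1 - p]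
    to [d - 1], the first one with coefficient [- vhat (- d)]. *)
Lemma wronskian_unit : wronskian \in unitmx.
Proof.
rewrite unitmxE unitfE; apply/det0P => -[x x0 hx].
have col (j : 'I_(2 * d)) : \sum_i x 0 i * wronskian_entry i j = 0.
  have := congr1 (fun M : 'rV[C]_(2 * d) => M 0 j) hx; rewrite mxE [RHS]mxE => e; rewrite -[RHS]e.
  by apply: eq_bigr => i _; rewrite mxE.
have right : forall p, (p < d)%N -> forall i : 'I_(2 * d), i = (d + p)%N :> nat -> x 0 i = 0.
  elim/ltn_ind => p IH pd i ip.
  have jp : (p < 2 * d)%N by lia.
  have := col (Ordinal jp); rewrite (bigD1 i) //= big1 ?addr0; last first.
    move=> l li; rewrite /wronskian_entry [X in if X then _ else _](_ : _ = (d <= l <= d + p)%N); last by lia.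
    case: ifP => [hl|_].
      rewrite (IH (l - d)%N) ?mul0r //; last by lia.
        by have : (l : nat) != i by []; lia.
      by lia.
    by rewrite [X in if X then _ else _](_ : _ = false) ?mulr0 //; lia.
  rewrite /wronskian_entry ip ifT; last by lia.
  rewrite (_ : _ - _ = d%:Z); last by lia.
  by move/eqP; rewrite mulf_eq0 (negbTE vd) orbF => /eqP.
have left : forall p, (p < d)%N -> forall i : 'I_(2 * d), i = (d - 1 - p)%N :> nat -> x 0 i = 0.
  elim/ltn_ind => p IH pd i ip.
  have jp : (2 * d - 1 - p < 2 * d)%N by lia.
  have := col (Ordinal jp); rewrite (bigD1 i) //= big1 ?addr0; last first.
    move=> l li; rewrite /wronskian_entry [X in if X then _ else _](_ : _ = false); last by lia.
    case: ifP => [hl|_]; last by rewrite mulr0.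
    have : (l : nat) != i by [].
    by rewrite ip => hli; rewrite (IH (d - 1 - l)%N) ?mul0r //; lia.
  rewrite /wronskian_entry ip ifF; last by lia.
  rewrite ifT; last by lia.
  rewrite (_ : _ - _ = - d%:Z); last by lia.
  move/eqP; rewrite mulf_eq0 oppr_eq0 v_conj // conjc_eq0 (negbTE vd) orbF => /eqP //.
move: x0; apply/negP; rewrite negbK; apply/eqP/rowP => i; rewrite [RHS]mxE.
have hi := ltn_ord i.
case: (leqP d i) => h; first by apply: (right (i - d)%N); lia.
by apply: (left (d - 1 - i)%N); lia.
Qed.

(** The shift part of the companion matrix moves both indices by one, which changes the entry only
    when [i + 1] or [j + 1] equals [d]; the first row of the matrix compensates exactly there. The
    phase enters only at [i = j = d - 1], where its two occurrences cancel because [E - 2 cos] is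
    real. *)
Lemma dualL_wronskian t : star (dualL d vhat E t) *m wronskian *m dualL d vhat E t = wronskian.
Proof.
set L := dualL _ _ _ _; set l := dual_first d vhat E t.
(* Rows are functions of a natural index, so that [F j.+1] makes sense for the last [j]; it is then
   read at [2 * d], one past the end, where [F] has to vanish. *)
have Lsum (F : nat -> C) (j : 'I_(2 * d)) : F (2 * d)%N = 0 ->
    \sum_(a < 2 * d) F a * L a j = F 0%N * l j + F j.+1.
  move=> F0; have p0 : (0 < 2 * d)%N by lia.
  rewrite (bigD1 (Ordinal p0)) //= mxE /=; congr (_ + _).
  have [hj|hj] := ltnP j.+1 (2 * d).
    rewrite (bigD1 (Ordinal hj)) //= mxE /= eqxx mulr1 big1 ?addr0 // => a /andP[a0 a1].
    rewrite mxE ifF; last by apply/negbTE.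
    by rewrite ifF ?mulr0 //; apply/negbTE.
  have -> : j.+1 = (2 * d)%N by have := ltn_ord j; lia.
  rewrite F0 big1 // => a a0; rewrite mxE ifF; last by apply/negbTE.
  rewrite ifF ?mulr0 //; apply/negbTE.
  by have := ltn_ord a; have := ltn_ord j; lia.
have w0 a : wronskian_entry a (2 * d)%N = 0.
  by rewrite /wronskian_entry ifF ?ifF //; lia.
have w0' b : wronskian_entry (2 * d)%N b = 0.
  by rewrite /wronskian_entry ifF ?ifF //; lia.
have LsumC (F : nat -> C) (j : 'I_(2 * d)) : F (2 * d)%N = 0 ->
    \sum_(a < 2 * d) conjc (L a j) * F a = conjc (l j) * F 0%N + F j.+1.
  move=> F0; rewrite -[LHS]conjcK rmorph_sum /=.
  under eq_bigr do rewrite rmorphM /= conjcK mulrC.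
  by rewrite (Lsum (fun a => conjc (F a))) ?F0 ?conjc0 // rmorphD rmorphM /= !conjcK mulrC.
apply/matrixP => i j.
have -> : (star L *m wronskian *m L) i j =
    \sum_(b < 2 * d) (\sum_(a < 2 * d) conjc (L a i) * wronskian_entry a b) * L b j.
  rewrite mxE; apply: eq_bigr => b _; congr (_ * _); rewrite mxE.
  by apply: eq_bigr => a _; rewrite !mxE.
under eq_bigr => b _ do rewrite (LsumC (fun a => wronskian_entry a b)) //.
rewrite (Lsum (fun b => conjc (l i) * wronskian_entry 0 b + wronskian_entry i.+1 b)) //; last first.
  by rewrite !w0 mulr0 addr0.
have -> : wronskian_entry 0 0 = 0 by rewrite /wronskian_entry ifF ?ifF //; lia.
rewrite mulr0 add0r mxE.
have wS b : wronskian_entry 0 b = if b == d then - vhat (- d%:Z) else 0.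
  rewrite /wronskian_entry ifF; last by lia.
  case: (eqVneq b d) => [->|hb]; last by rewrite ifF //; lia.
  by rewrite ifT ?sub0r //; lia.
have wS' a : wronskian_entry a 0 = if a == d then vhat d%:Z else 0.
  rewrite /wronskian_entry; case: (eqVneq a d) => [->|hb].
    by rewrite ifT ?subr0 //; lia.
  by rewrite ifF ?ifF //; lia.
have hl b : vhat d%:Z * l b =
    (if d%:Z - 1 - b%:Z == 0 then (E - 2 * cos (2 * pi * t))%:C%C else 0) - vhat (d%:Z - 1 - b%:Z).
  by rewrite /l /dual_first mulrCA divff // mulr1.
have hlc b : conjc (l b) * vhat (- d%:Z) =
    (if d%:Z - 1 - b%:Z == 0 then (E - 2 * cos (2 * pi * t))%:C%C else 0)
      - conjc (vhat (d%:Z - 1 - b%:Z)).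
  rewrite mulrC v_conj // -rmorphM hl rmorphB /=; congr (_ - _).
  by case: ifP => _; rewrite ?conjc0 ?conjc_real.
have hi := ltn_ord i; have hj := ltn_ord j.
rewrite wS wS'; case: (eqVneq i.+1 d) => ei; case: (eqVneq j.+1 d) => ej.
- rewrite hl mulrN hlc -v_conjZ; last by lia.
  have -> : d%:Z - 1 - i%:Z = 0 by lia.
  have -> : d%:Z - 1 - j%:Z = 0 by lia.
  rewrite oppr0 eqxx /wronskian_entry !ifF; [|lia..].
  by rewrite addr0 subrr.
- rewrite hl mulr0 add0r ifF; last by apply/eqP; lia.
  rewrite sub0r /wronskian_entry; have -> : d%:Z - 1 - j%:Z = i%:Z - j%:Z by lia.
  have [hjd|hjd] := leqP j.+1 d.
    rewrite ifT; last by lia.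
    rewrite !ifF; [|lia..].
    by rewrite (_ : i.+1%:Z - j.+1%:Z = i%:Z - j%:Z) ?addNr //; lia.
  do 3![rewrite ifF; last by lia].
  by rewrite ifT ?addr0 //; lia.
- rewrite mul0r add0r mulrN hlc ifF; last by apply/eqP; lia.
  rewrite sub0r opprK -v_conjZ; last by lia.
  rewrite opprB /wronskian_entry; have -> : i%:Z - (d%:Z - 1) = i%:Z - j%:Z by lia.
  have [hid|hid] := leqP i.+1 d.
    rewrite ifF; last by lia.
    rewrite ifT; last by lia.
    rewrite !ifF; [|lia..].
    by rewrite (_ : i.+1%:Z - j.+1%:Z = i%:Z - j%:Z) ?addrN //; lia.
  do 2![rewrite ifF; last by lia].
  by rewrite ifT ?addr0 //; lia.
rewrite mulr0 mul0r !add0r /wronskian_entry (_ : i.+1%:Z - j.+1%:Z = i%:Z - j%:Z); last by lia.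
rewrite subSS subSS.
have -> : (d <= i.+1)%N = (d <= i)%N by lia.
have -> : (d <= j.+1)%N = (d <= j)%N by lia.
have -> : (i.+1 < d)%N = (i < d)%N by lia.
by have -> : (j.+1 < d)%N = (j < d)%N by lia.
Qed.

Lemma dualL_unit t : dualL d vhat E t \in unitmx.
Proof.
have h := dualL_wronskian t.
have : (invmx wronskian *m star (dualL d vhat E t) *m wronskian) *m dualL d vhat E t = 1%:M.
  by rewrite -!mulmxA; move: h; rewrite -!mulmxA => ->; rewrite mulVmx ?wronskian_unit.
by case/mulmx1_unit.
Qed.

Lemma dualL_periodic t : dualL d vhat E (t + 1) = dualL d vhat E t.
Proof.
apply/matrixP => i j; rewrite !mxE /dual_first.
have -> // : cos (2 * pi * (t + 1)) = cos (2 * pi * t).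
have := cexpD1 t; rewrite /cexp2pi; by case.
Qed.

Lemma dualL_mcont : mcont (dualL d vhat E).
Proof.
move=> i j; under [fun p => _]eq_fun do rewrite mxE.
case: ((i : nat) == 0%N); last by case: ifP => _; apply: ccont_cst.
rewrite /dual_first; apply: ccontM; last exact: ccont_cst.
apply: ccontD; last exact: ccont_cst.
case: (d%:Z - 1 - j%:Z == 0); last exact: ccont_cst.
split => t /=; last exact: cvg_cst.
apply: cvgB; first exact: cvg_cst.
apply: cvgM; first exact: cvg_cst.
apply: (@continuous_comp _ _ _ (fun s : R => 2 * pi * s) (@cos R)); last exact: continuous_cos.
by apply: cvgM; [exact: cvg_cst | exact: cvg_id].
Qed.

End DualSymplectic.

(** * Quantitative bounds on the character and sums of roots of unity *)

Section CharacterBounds.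
Variable R : realType.
Local Notation C := R[i].
Implicit Types x y z : R.

Lemma sin_mean y : 0 <= y -> exists2 c, 0 <= c <= y & sin y = cos c * y.
Proof.
move=> y0.
have [|c] := @MVT_segment R sin cos 0 y y0 (fun x _ => is_derive_sin x).
  by apply: continuous_subspaceT => x; apply: continuous_sin.
by rewrite in_itv /= sin0 !subr0 => hc e; exists c.
Qed.

Lemma abs_sin_le y : `|sin y| <= `|y|.
Proof.
wlog y0 : y / 0 <= y => [h|].
  have [|/ltW yn] := leP 0 y; first exact: h.
  by have := h (- y); rewrite sinN !normrN; apply; rewrite oppr_ge0.
have [c _ ->] := sin_mean y0.
by rewrite normrM ler_piMl // cos_max.
Qed.

Lemma half_double y : y / 2 *+ 2 = y.
Proof. by rewrite mulr2n -splitr. Qed.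

Lemma one_sub_cos y : 1 - cos y = 2 * sin (y / 2) ^+ 2.
Proof.
have := cos2Dsin2 (y / 2); have := cos_mulr2n (y / 2).
rewrite half_double => -> h.
by rewrite mulr2n; lra.
Qed.

(** Write sin y = 2 sin(y/2) cos(y/2) = y cos(c) cos(y/2) with c at most y/2; the factor of y is at
    least cos(y/2)^2 = (1 + cos y)/2, hence at least 1/2. *)
Lemma sin_ge y : 0 <= y <= pi / 2 -> y / 2 <= sin y.
Proof.
move=> /andP[y0 y1]; have p0 := pi_gt0 R.
have [|c /andP[c0 c1] hc] := @sin_mean (y / 2); first by rewrite divr_ge0.
have e : sin y = (cos (y / 2) * cos c) * y.
  have := sin_mulr2n (y / 2); rewrite half_double => ->.
  by rewrite hc; field.
have cc : cos (y / 2) <= cos c.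
  rewrite le_eqVlt in c1; case/orP: c1 => [/eqP -> //|c1].
  by apply/ltW; rewrite ltr_cos // in_itv /=; apply/andP; split; lra.
have cy : 0 <= cos (y / 2) by apply: cos_ge0_pihalf; lra.
have c2 : 0 <= cos y by apply: cos_ge0_pihalf; lra.
have h : 2^-1 <= cos (y / 2) * cos (y / 2).
  have := cos_mulr2n (y / 2); rewrite half_double => ey.
  by move: c2; rewrite ey expr2 mulr2n; lra.
rewrite e [leLHS]mulrC ler_wpM2r //; apply: le_trans h _.
by rewrite ler_wpM2l.
Qed.

Lemma cm_cexpB1 x : cm (cexp2pi x - 1) = 2 * `|sin (pi * x)|.
Proof.
have -> : 2 * `|sin (pi * x)| = `|2 * sin (pi * x)| :> R by rewrite normrM ger0_norm.
rewrite -sqrtr_sqr /cm; congr Num.sqrt; rewrite /cabs2 /cexp2pi /= subr0.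
have := one_sub_cos (2 * pi * x); rewrite (_ : 2 * pi * x / 2 = pi * x); last by field.
have := cos2Dsin2 (2 * pi * x) => h1 h2.
rewrite (_ : (2 * sin (pi * x)) ^+ 2 = 2 * (2 * sin (pi * x) ^+ 2)); last by ring.
rewrite -h2 sqrrB1.
by rewrite mulr2n; lra.
Qed.

Lemma cexpB1_le x : cm (cexp2pi x - 1) <= 2 * pi * `|x|.
Proof.
rewrite cm_cexpB1 -mulrA ler_wpM2l //; apply: le_trans (abs_sin_le _) _.
by rewrite normrM ger0_norm // pi_ge0.
Qed.

Lemma cexpB_le x y : cm (cexp2pi x - cexp2pi y) <= 2 * pi * `|x - y|.
Proof.
have -> : cexp2pi x - cexp2pi y = (cexp2pi (x - y) - 1) * cexp2pi y.
  by rewrite mulrBl mul1r -cexpD subrK.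
by rewrite cmM cm_cexp mulr1 cexpB1_le.
Qed.

Lemma cexpB1_ge x : `|x| <= 2^-1 -> `|x| <= cm (cexp2pi x - 1).
Proof.
wlog x0 : x / 0 <= x => [h|] hx.
  have [x0|/ltW xn] := leP 0 x; first exact: h.
  have := h (- x); rewrite oppr_ge0 normrN => /(_ xn hx) g; apply: le_trans g _.
  by rewrite !cm_cexpB1 mulrN sinN normrN.
rewrite ger0_norm // in hx *; have p2 := pi_ge2 R.
rewrite cm_cexpB1; have hp : 0 <= pi * x <= pi / 2.
  rewrite mulr_ge0 ?pi_ge0 //=; apply: ler_wpM2l => //; exact: pi_ge0.
have hs := sin_ge hp.
rewrite ger0_norm; last by apply: le_trans hs; rewrite divr_ge0 ?mulr_ge0 ?pi_ge0.
apply: (@le_trans _ _ (2 * (pi * x / 2))); last by rewrite ler_wpM2l.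
by rewrite mulrC divfK // ler_peMl //; lra.
Qed.

Lemma cexp_linear z : `|2 * pi * z| <= 1 ->
  cm (1 + Complex 0 (2 * pi * z) - cexp2pi z) <= (2 * pi * z) ^+ 2.
Proof.
rewrite /cexp2pi; set y := 2 * pi * z => y1.
apply: le_trans (cm_ReIm _) _; rewrite /= addr0 add0r.
have b (u : R) : 0 <= 1 - cos u <= u ^+ 2 / 2.
  rewrite subr_ge0 cos_le1 one_sub_cos /=.
  rewrite [leRHS](_ : _ = 2 * (u / 2) ^+ 2); last by field.
  by rewrite ler_wpM2l // -real_normK ?num_real // -[leRHS]real_normK ?num_real //
    ler_pXn2r ?nnegrE // abs_sin_le.
have h1 : `|1 - cos y| <= y ^+ 2 / 2.
  by have /andP[g1 g2] := b y; rewrite ger0_norm.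
have h2 : `|y - sin y| <= y ^+ 2 / 2.
  wlog y0 : y y1 {h1} / 0 <= y => [h|].
    have [y0|/ltW yn] := leP 0 y; first exact: h.
    have := h (- y); rewrite normrN sinN sqrrN oppr_ge0 => /(_ y1 yn).
    by rewrite -opprD normrN.
  rewrite ger0_norm // in y1; have [c /andP[c0 c1] ->] := sin_mean y0.
  have /andP[g1 g2] := b c.
  rewrite (_ : y - cos c * y = (1 - cos c) * y); last by ring.
  rewrite ger0_norm ?mulr_ge0 //; apply: (@le_trans _ _ (1 - cos c)).
    by rewrite ler_piMr.
  by apply: le_trans g2 _; rewrite ler_wpM2r // ler_pXn2r ?nnegrE.
apply: le_trans (lerD h1 h2) _.
by rewrite -splitr.
Qed.

Lemma cexp_pow z n : cexp2pi (n.+1%:R^-1 * z) ^+ n.+1 = cexp2pi z.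
Proof. by rewrite -cexpMn mulrA divff ?mul1r ?pnatr_eq0. Qed.

Lemma sum_roots (k : int) (M : nat) : (0 < M)%N -> (`|k| < M)%N ->
  \sum_(j < M) cexp2pi (k%:~R * (j%:R / M%:R) : R) = if k == 0 then M%:R else 0.
Proof.
move=> M0 kM; have MR : (M%:R : R) != 0 by rewrite pnatr_eq0 -lt0n.
have e (j : nat) : cexp2pi (k%:~R * (j%:R / M%:R) : R) = cexp2pi (k%:~R / M%:R) ^+ j.
  by rewrite -cexpMn; congr cexp2pi; ring.
under eq_bigr do rewrite e.
have [->|k0] := eqVneq k 0.
  under eq_bigr do rewrite mul0r cexp0 expr1n.
  by rewrite sumr_const card_ord.
set z := cexp2pi _.
have zM : z ^+ M = 1 by rewrite -cexpMn mulrCA divff // mulr1 cexp_int.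
have z1 : z - 1 != 0.
  rewrite -cm_eq0 cm_cexpB1 mulf_neq0 ?pnatr_eq0 // normr_eq0.
  have M0' : 0 < (M%:R : R) by rewrite ltr0n.
  have pos (a : nat) : (0 < a < M)%N -> sin (pi * (a%:R / M%:R)) != 0 :> R.
    move=> /andP[a0 aM]; rewrite gt_eqF //; apply: sin_gt0_pi.
    rewrite mulr_gt0 ?pi_gt0 ?divr_gt0 ?ltr0n //= gtr_pMr ?pi_gt0 //.
    by rewrite ltr_pdivrMr // mul1r ltr_nat.
  case: (intP k) k0 kM => [//|n|n] _ kM; first by apply: pos; lia.
  by rewrite mulrNz mulNr mulrN sinN oppr_eq0; apply: pos; lia.
apply: (mulfI z1); rewrite mulr0 -(subrX1 z M) zM subrr //.
Qed.

End CharacterBounds.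

(** * Trigonometric polynomials, their weighted norms and their coefficients *)

Section TrigPolynomials.
Variable R : realType.
Local Notation C := R[i].

(* A trigonometric polynomial as a list of (coefficient, frequency); frequencies may repeat. *)
Definition tpoly := seq (C * int).
Implicit Types s t : tpoly.

Definition ev s (x : R) : C := \sum_(p <- s) p.1 * cexp2pi (p.2%:~R * x).
(** A weighted Wiener norm, the substitute for a supremum over a complex strip. It is taken on the
    list, without merging repeated frequencies: this only increases it, and it makes
    submultiplicativity immediate. *)
Definition wnorm (c : R) s : R := \sum_(p <- s) cm p.1 * expR (c * `|p.2|%N%:R).
Definition coef (n : int) s : C := \sum_(p <- s | p.2 == n) p.1.

Definition tscale (a : C) s : tpoly := [seq (a * p.1, p.2) | p <- s].
Definition tshift (h : R) s : tpoly := [seq (p.1 * cexp2pi (p.2%:~R * h), p.2) | p <- s].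
Definition tconj s : tpoly := [seq (conjc p.1, - p.2) | p <- s].
Definition tmul s t : tpoly := [seq (p.1 * r.1, p.2 + r.2) | p <- s, r <- t].
Definition tpow s n : tpoly := iter n (tmul s) [:: (1, 0)].

Lemma ev_cat s t x : ev (s ++ t) x = ev s x + ev t x.
Proof. by rewrite /ev big_cat. Qed.

Lemma ev_scale a s x : ev (tscale a s) x = a * ev s x.
Proof. by rewrite /ev big_map mulr_sumr; apply: eq_bigr => p _; rewrite mulrA. Qed.

Lemma ev_shift h s x : ev (tshift h s) x = ev s (x + h).
Proof.
rewrite /ev big_map; apply: eq_bigr => p _ /=.
by rewrite mulrDr cexpD; ring.
Qed.

Lemma ev_conj s x : ev (tconj s) x = conjc (ev s x).
Proof.
have e (a : C) y : conjc (a * cexp2pi y) = conjc a * cexp2pi (- y).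
  by rewrite -conj_cexp rmorphM.
rewrite /ev big_map rmorph_sum; apply: eq_bigr => p _.
by apply: etrans (esym (e p.1 _)); rewrite -mulNr -mulrNz.
Qed.

Lemma ev_mul s t x : ev (tmul s t) x = ev s x * ev t x.
Proof.
rewrite /ev big_allpairs_dep mulr_suml; apply: eq_bigr => p _.
rewrite mulr_sumr; apply: eq_bigr => r _ /=.
by rewrite intrD mulrDl cexpD; ring.
Qed.

Lemma ev_pow s n x : ev (tpow s n) x = ev s x ^+ n.
Proof.
elim: n => [|n IH] /=; first by rewrite /ev big_seq1 /= mul0r cexp0 mul1r.
by rewrite ev_mul IH exprS.
Qed.

Lemma wnorm_ge0 c s : 0 <= wnorm c s.
Proof. by apply: sumr_ge0 => p _; rewrite mulr_ge0 ?cm_ge0 ?expR_ge0. Qed.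

Lemma wnorm_cat c s t : wnorm c (s ++ t) = wnorm c s + wnorm c t.
Proof. by rewrite /wnorm big_cat. Qed.

Lemma wnorm_scale c a s : wnorm c (tscale a s) = cm a * wnorm c s.
Proof. by rewrite /wnorm big_map mulr_sumr; apply: eq_bigr => p _; rewrite cmM mulrA. Qed.

Lemma wnorm_conj c s : wnorm c (tconj s) = wnorm c s.
Proof. by rewrite /wnorm big_map; apply: eq_bigr => p _ /=; rewrite cmJ abszN. Qed.

Lemma wnorm_mul c s t : 0 <= c -> wnorm c (tmul s t) <= wnorm c s * wnorm c t.
Proof.
move=> c0; rewrite /wnorm big_allpairs_dep mulr_suml; apply: ler_sum => p _.
rewrite mulr_sumr; apply: ler_sum => r _ /=; rewrite cmM -mulrA mulrACA.
rewrite mulrA ler_wpM2l ?mulr_ge0 ?cm_ge0 // -expRD ler_expR -mulrDr ler_wpM2l //.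
by rewrite -natrD ler_nat; lia.
Qed.

Lemma wnorm_pow c s n : 0 <= c -> wnorm c (tpow s n) <= wnorm c s ^+ n.
Proof.
move=> c0; elim: n => [|n IH] /=.
  by rewrite /wnorm big_seq1 /= cm1 mulr0 expR0 mulr1.
by rewrite exprS; apply: le_trans (wnorm_mul _ _ c0) _; rewrite ler_wpM2l ?wnorm_ge0.
Qed.

Lemma cm_ev_le s x : cm (ev s x) <= wnorm 0 s.
Proof.
apply: le_trans (cm_sum _ _ _) _; apply: ler_sum => p _.
by rewrite cmM cm_cexp mul0r expR0.
Qed.

Lemma cm_coef_sum c s (FS : seq int) : uniq FS ->
  \sum_(n <- FS) cm (coef n s) * expR (c * `|n|%N%:R) <= wnorm c s.
Proof.
move=> uF; apply: (@le_trans _ _ (\sum_(n <- FS) \sum_(p <- s | p.2 == n)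
    cm p.1 * expR (c * `|p.2|%N%:R))).
  apply: ler_sum => n _.
  rewrite (eq_bigr (fun p : C * int => cm p.1 * expR (c * `|n|%N%:R))); last first.
    by move=> p /eqP ->.
  by rewrite -mulr_suml ler_wpM2r ?expR_ge0 // cm_sum.
rewrite /wnorm (exchange_big_dep xpredT) //=; apply: ler_sum => p _.
set F := cm _ * _; have F0 : 0 <= F by rewrite mulr_ge0 ?cm_ge0 ?expR_ge0.
rewrite big_const_seq iter_addr_0.
have : (count (fun n => p.2 == n) FS <= 1)%N.
  rewrite (eq_count (a2 := pred1 p.2)); last by move=> n; rewrite /= eq_sym.
  by rewrite count_uniq_mem //; case: (_ \in _).
by case: (count _ _) => [|[|//]] _; rewrite ?mulr0n ?mulr1n.
Qed.

Lemma cm_coef_le c s n : cm (coef n s) * expR (c * `|n|%N%:R) <= wnorm c s.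
Proof. by have := cm_coef_sum c s (isT : uniq [:: n]); rewrite big_seq1. Qed.

Lemma ev_coef s x (FS : seq int) : uniq FS -> {subset map snd s <= FS} ->
  ev s x = \sum_(n <- FS) coef n s * cexp2pi (n%:~R * x).
Proof.
move=> uF sub; rewrite (eq_bigr (fun n : int => \sum_(p <- s | p.2 == n)
    p.1 * cexp2pi (p.2%:~R * x))); last first.
  by move=> n _; rewrite mulr_suml; apply: eq_bigr => p /eqP ->.
rewrite (exchange_big_dep xpredT) //= /ev big_seq [RHS]big_seq.
apply: eq_bigr => p ps; rewrite big_const_seq iter_addr_0.
have -> : count (fun n => p.2 == n) FS = 1%N.
  rewrite (eq_count (a2 := pred1 p.2)); last by move=> n; rewrite /= eq_sym.
  by rewrite count_uniq_mem // sub //; apply/mapP; exists p.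
by rewrite mulr1n.
Qed.

Lemma coef_cat n s t : coef n (s ++ t) = coef n s + coef n t.
Proof. by rewrite /coef big_cat. Qed.

Lemma coef_scale n a s : coef n (tscale a s) = a * coef n s.
Proof. by rewrite /coef big_map mulr_sumr. Qed.

Lemma coef_shift n h s : coef n (tshift h s) = coef n s * cexp2pi (n%:~R * h).
Proof. by rewrite /coef big_map mulr_suml; apply: eq_bigr => p /= /eqP ->. Qed.

Lemma coef_mul n s t : coef n (tmul s t) = \sum_(p <- s) p.1 * coef (n - p.2) t.
Proof.
rewrite /coef big_mkcond big_allpairs_dep; apply: eq_bigr => p _.
rewrite mulr_sumr -big_mkcond /=; apply: eq_bigl => r.
by rewrite [RHS]eq_sym subr_eq [RHS]eq_sym addrC.
Qed.

(* Averaging over a grid finer than all the frequencies extracts a coefficient. *)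
Lemma cm_coef_sup n s (b : R) : (forall x, cm (ev s x) <= b) -> cm (coef n s) <= b.
Proof.
move=> hb; pose M := (\sum_(p <- s) `|p.2 - n|%N).+1.
have key : \sum_(j < M) ev s (j%:R / M%:R) * cexp2pi (- (n%:~R * (j%:R / M%:R)))
    = coef n s * M%:R.
  under eq_bigr => j _ do rewrite /ev mulr_suml.
  rewrite exchange_big /= /coef [in RHS]big_mkcond mulr_suml big_seq [RHS]big_seq.
  apply: eq_bigr => p ps.
  under eq_bigr => j _ do rewrite -mulrA -cexpD -mulNr -mulrDl -intrN -intrD.
  rewrite -mulr_sumr sum_roots //; last first.
    by rewrite /M ltnS (big_rem p ps) /= leq_addr.
  by rewrite subr_eq0; case: eqP => _; rewrite ?mulr0 ?mul0r.
have : cm (coef n s) * M%:R <= b * M%:R.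
  have -> : cm (coef n s) * M%:R = cm (coef n s * M%:R).
    rewrite cmM (_ : M%:R = (M%:R : R)%:C%C) ?cmR ?ger0_norm ?ler0n //.
    by rewrite rmorph_nat.
  rewrite -key; apply: le_trans (cm_sum _ _ _) _.
  apply: (@le_trans _ _ (\sum_(j < M) b)); last by rewrite sumr_const card_ord mulr_natr.
  by apply: ler_sum => j _; rewrite cmM cm_cexp mulr1.
by rewrite ler_pM2r.
Qed.

End TrigPolynomials.

(** * Approximate orbits of a cocycle *)

Section ApproximateOrbits.
Variables (R : realType) (m : nat) (alpha : R) (A : R -> 'M[R[i]]_m).
Local Notation C := R[i].
Local Notation it := (cocycle_iter alpha A).
Hypothesis A_unit : forall t, A t \in unitmx.
Variables (L : R).
Hypothesis L1 : 1 <= L.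
Hypothesis A_le : forall t, l1 (A t) <= L.
Hypothesis A_inv_le : forall t, l1 (invmx (A t)) <= L.

Definition approx_orbit (e : R) (U : int -> 'cV[C]_m) : Prop :=
  forall n : int, l1 (U (n + 1) - A (n%:~R * alpha) *m U n) <= e.

Let L0 : 0 <= L. Proof. exact: le_trans L1. Qed.

Lemma approx_orbit_ge0 e U : approx_orbit e U -> 0 <= e.
Proof. by move=> h; apply: le_trans (h 0); apply: l1_ge0. Qed.

Lemma approx_orbit_forward e U (n : int) (j : nat) : approx_orbit e U ->
  l1 (U (n + j%:Z) - it j (n%:~R * alpha) *m U n) <= e * j%:R * L ^+ j.
Proof.
move=> hU; have e0 := approx_orbit_ge0 hU.
elim: j => [|j IH]; first by rewrite addr0 mul1mx subrr l10 mulr0 mul0r.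
have -> : U (n + j.+1%:Z) - it j.+1 (n%:~R * alpha) *m U n =
    (U (n + j%:Z + 1) - A ((n + j%:Z)%:~R * alpha) *m U (n + j%:Z)) +
    A ((n + j%:Z)%:~R * alpha) *m (U (n + j%:Z) - it j (n%:~R * alpha) *m U n).
  have -> : n + j.+1%:Z = n + j%:Z + 1 by lia.
  by rewrite mulmxBr addrA subrK /= mulmxA intrD mulrDl.
apply: le_trans (l1D _ _) _.
apply: (@le_trans _ _ (e + L * (e * j%:R * L ^+ j))).
  apply: lerD => //; apply: le_trans (l1M _ _) _.
  by apply: ler_pM; rewrite ?l1_ge0.
rewrite -natr1 exprS [leRHS](_ : _ = e * (L * L ^+ j) + L * (e * j%:R * L ^+ j)); last by ring.
by rewrite lerD2r ler_peMr // -exprS exprn_ege1.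
Qed.

(** [T n] is the transfer matrix from site 0 to site [n], of either sign. It is chosen before the
    orbit, so that one [T] serves two approximate solutions and their minors at distant sites are
    bilinear in their minors at 0. *)
Lemma approx_orbit_transfer : exists T : int -> 'M[C]_m,
  (forall n, l1 (T n) <= l1 (1%:M : 'M[C]_m) * L ^+ `|n|) /\
  forall e U, approx_orbit e U -> forall n, l1 (U n - T n *m U 0) <= e * `|n|%N%:R * L ^+ `|n|.
Proof.
suff h n : exists T : 'M[C]_m, l1 T <= l1 (1%:M : 'M[C]_m) * L ^+ `|n| /\
    forall e U, approx_orbit e U -> l1 (U n - T *m U 0) <= e * `|n|%N%:R * L ^+ `|n|.
  have [T hT] := choice h; exists T; split=> [n|e U hU n]; first by have [] := hT n.
  by have [_] := hT n; apply.
have pos : forall k : nat, exists T : 'M[C]_m, l1 T <= l1 (1%:M : 'M[C]_m) * L ^+ k /\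
    forall e U, approx_orbit e U -> l1 (U k%:Z - T *m U 0) <= e * k%:R * L ^+ k.
  elim=> [|k [T [hT1 hT2]]].
    exists 1%:M; split=> [|e U hU]; first by rewrite mulr1.
    by rewrite mul1mx subrr l10 mulr0 mul0r.
  exists (A (k%:R * alpha) *m T); split=> [|e U hU].
    apply: le_trans (l1M _ _) _; rewrite exprS mulrCA.
    by apply: ler_pM; rewrite ?l1_ge0.
  have e0 := approx_orbit_ge0 hU.
  have -> : U k.+1%:Z - A (k%:R * alpha) *m T *m U 0 =
      (U (k%:Z + 1) - A (k%:Z%:~R * alpha) *m U k%:Z) + A (k%:R * alpha) *m (U k%:Z - T *m U 0).
    have -> : k.+1%:Z = k%:Z + 1 by lia.
    by rewrite mulmxBr addrA subrK mulmxA.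
  apply: le_trans (l1D _ _) _.
  apply: (@le_trans _ _ (e + L * (e * k%:R * L ^+ k))).
    apply: lerD => //; apply: le_trans (l1M _ _) _.
    by apply: ler_pM; rewrite ?l1_ge0 // hT2.
  rewrite -natr1 exprS [leRHS](_ : _ = e * (L * L ^+ k) + L * (e * k%:R * L ^+ k)); last by ring.
  by rewrite lerD2r ler_peMr // -exprS exprn_ege1.
have neg : forall k : nat, exists T : 'M[C]_m, l1 T <= l1 (1%:M : 'M[C]_m) * L ^+ k /\
    forall e U, approx_orbit e U -> l1 (U (- k%:Z) - T *m U 0) <= e * k%:R * L ^+ k.
  elim=> [|k [T [hT1 hT2]]].
    exists 1%:M; split=> [|e U hU]; first by rewrite mulr1.
    by rewrite mul1mx subrr l10 mulr0 mul0r.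
  pose p : int := - k.+1%:Z; pose An := A (p%:~R * alpha).
  exists (invmx An *m T); split=> [|e U hU].
    apply: le_trans (l1M _ _) _; rewrite exprS mulrCA.
    by apply: ler_pM; rewrite ?l1_ge0 // A_inv_le.
  have e0 := approx_orbit_ge0 hU.
  have -> : U (- k.+1%:Z) - invmx An *m T *m U 0 =
      invmx An *m ((U (- k%:Z) - T *m U 0) - (U (p + 1) - An *m U p)).
    have -> : p + 1 = - k%:Z by rewrite /p; lia.
    rewrite (_ : _ - _ - _ = An *m U p - T *m U 0); last by rewrite opprB addrC addrA subrK.
    by rewrite mulmxBr (mulKmx (A_unit _)) mulmxA.
  apply: le_trans (l1M _ _) _.
  apply: (@le_trans _ _ (L * (e * k%:R * L ^+ k + e))).
    apply: ler_pM; rewrite ?l1_ge0 // ?A_inv_le //.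
    by apply: le_trans (l1B _ _) _; apply: lerD => //; apply: hT2.
  rewrite -natr1 exprS [leRHS](_ : _ = L * (e * k%:R * L ^+ k + e * L ^+ k)); last by ring.
  by rewrite ler_wpM2l // lerD2l ler_peMr // exprn_ege1.
case: n => k; first exact: pos.
by rewrite NegzE abszN absz_nat; exact: neg.
Qed.

End ApproximateOrbits.

(** * Aubry duality: Fourier coefficients as orbits of the dual cocycle *)

Section DualOrbit.
Variables (R : realType) (alpha : R) (d : nat) (vhat : int -> R[i]) (E : R).
Local Notation C := R[i].
(** The dual solution is [u_n = coef (- n) f]. The sign is reversed because multiplication by v
    produces the convolution of [vhat k] with the coefficient [n - k], whereas the dual operator
    uses [u_(n + k)]. *)
Definition state (f : tpoly R) (n : int) : 'cV[C]_(2 * d) :=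
  \col_i coef (- (n + d%:Z - 1 - (i : nat)%:Z)) f.

Lemma state_le c K f (n : int) : 0 <= c -> wnorm c f <= K ->
  l1 (state f n) <= (2 * d)%:R * expR (c * d%:R) * K * expR (- (c * `|n|%N%:R)).
Proof.
move=> c0 hK; rewrite /l1.
apply: (@le_trans _ _ (\sum_(i < 2 * d) expR (c * d%:R) * K * expR (- (c * `|n|%N%:R)))); last first.
  by rewrite sumr_const card_ord -[leLHS]mulr_natl !mulrA.
apply: ler_sum => i _; rewrite big_ord1 mxE; set k := - _.
have h := le_trans (cm_coef_le c f k) hK.
rewrite -ler_pdivlMr ?expR_gt0 // in h; apply: le_trans h _.
have hn : (`|n|%N%:R : R) <= d%:R + `|k|%N%:R.
  by rewrite -natrD ler_nat /k; have := ltn_ord i; lia.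
have K0 : 0 <= K by apply: le_trans hK; apply: wnorm_ge0.
rewrite -expRN [leRHS](_ : _ = K * expR (c * d%:R - c * `|n|%N%:R)); last by rewrite expRD; ring.
rewrite ler_wpM2l // ler_expR.
by have := ler_wpM2l c0 hn; rewrite mulrDr; lra.
Qed.

Definition vpoly : tpoly R := [seq (vhat (k%:Z - d%:Z), k%:Z - d%:Z) | k <- iota 0 (2 * d).+1].

Lemma ev_vpoly x : ev vpoly x = trig_sum d vhat x.
Proof.
rewrite /ev big_map /trig_sum -(big_mkord xpredT (fun k => vhat (k%:Z - d%:Z) *
  cexp2pi ((k%:Z - d%:Z)%:~R * x))).
by rewrite /index_iota subn0.
Qed.

Definition residual (f : tpoly R) : tpoly R :=
  tshift alpha f ++ tshift (- alpha) f ++ tmul vpoly f ++ tscale (- (E%:C)%C) f.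

Lemma ev_residual f x : ev (residual f) x =
  ev f (x + alpha) + ev f (x - alpha) + (trig_sum d vhat x - (E%:C)%C) * ev f x.
Proof.
rewrite -ev_vpoly /residual; move: vpoly => V.
by rewrite !ev_cat !ev_shift ev_mul ev_scale; ring.
Qed.

Lemma coef_residual f n : coef n (residual f) =
  ((2 * cos (2 * pi * (n%:~R * alpha)) - E)%:C)%C * coef n f
  + \sum_(k < (2 * d).+1) vhat (k%:Z - d%:Z) * coef (n - (k%:Z - d%:Z)) f.
Proof.
have -> : coef n (residual f) = coef n f * cexp2pi (n%:~R * alpha)
    + (coef n f * cexp2pi (n%:~R * - alpha) + (coef n (tmul vpoly f) - (E%:C)%C * coef n f)).
  rewrite /residual; move: vpoly => V.
  by rewrite !coef_cat !coef_shift coef_scale mulNr.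
rewrite coef_mul big_map.
rewrite -(big_mkord xpredT (fun k => vhat (k%:Z - d%:Z) * coef (n - (k%:Z - d%:Z)) f)).
rewrite /index_iota subn0 /=.
have -> : ((2 * cos (2 * pi * (n%:~R * alpha)) - E)%:C)%C =
    cexp2pi (n%:~R * alpha) + cexp2pi (n%:~R * - alpha) - (E%:C)%C.
  by rewrite /cexp2pi !mulrN cosN sinN; apply: complex_ext => /=; ring.
by ring.
Qed.

Hypothesis d1 : (1 <= d)%N.
Hypothesis vd : vhat d%:Z != 0.

Lemma state_step f (n : int) :
  state f (n + 1) - dualL d vhat E (n%:~R * alpha) *m state f n =
  (coef (- n) (residual f) / vhat d%:Z) *: \col_i ((i : nat) == 0%N)%:R.
Proof.
apply/matrixP => i j; rewrite (ord1 j) !mxE.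
have [i0|i0] := eqVneq (i : nat) 0%N; last first.
  rewrite mulr0; apply/eqP; rewrite subr_eq0; apply/eqP.
  have ip : (i.-1 < 2 * d)%N by have := ltn_ord i; lia.
  rewrite (bigD1 (Ordinal ip)) //= big1 ?addr0.
    rewrite !mxE /= (negbTE i0) ifT; last by lia.
    by rewrite mul1r; congr coef; lia.
  move=> k; rewrite -val_eqE /= => hk; rewrite !mxE (negbTE i0) ifF ?mul0r //.
  by apply/eqP; move/eqP: hk; lia.
rewrite mulr1; apply: (mulIf vd); rewrite divfK // mulrBl [X in _ - X]mulr_suml.
under eq_bigr => k _.
  rewrite !mxE i0 eqxx /dual_first mulrAC divfK // mulrBl.
  over.
rewrite big_split sumrN /= coef_residual.
have -> : \sum_(k < 2 * d) (if d%:Z - 1 - (k : nat)%:Z == 0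
     then ((E - 2 * cos (2 * pi * (n%:~R * alpha)))%:C)%C else 0)
       * coef (- (n + d%:Z - 1 - (k : nat)%:Z)) f
   = ((E - 2 * cos (2 * pi * (n%:~R * alpha)))%:C)%C * coef (- n) f.
  have kp : (d - 1 < 2 * d)%N by lia.
  rewrite (bigD1 (Ordinal kp)) //= big1 ?addr0.
    rewrite ifT; last by lia.
    by congr (_ * coef _ _); lia.
  move=> k; rewrite -val_eqE /= => hk; rewrite ifF ?mul0r //.
  by apply/eqP; move/eqP: hk; lia.
have -> : \sum_(k < (2 * d).+1) vhat (k%:Z - d%:Z) * coef (- n - (k%:Z - d%:Z)) f =
   \sum_(k < 2 * d) vhat (d%:Z - 1 - (k : nat)%:Z) * coef (- (n + d%:Z - 1 - (k : nat)%:Z)) f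
   + vhat d%:Z * coef (- (n + 1 + d%:Z - 1 - (i : nat)%:Z)) f.
  rewrite big_ord_recr /=; congr (_ + _); last by congr (vhat _ * coef _ _); lia.
  rewrite (reindex_inj rev_ord_inj); apply: eq_bigr => k _ /=; have hk := ltn_ord k.
  by congr (vhat _ * coef _ _); lia.
have -> : cos (2 * pi * ((- n)%:~R * alpha)) = cos (2 * pi * (n%:~R * alpha)).
  by rewrite mulrNz mulNr mulrN cosN.
have -> : ((2 * cos (2 * pi * (n%:~R * alpha)) - E)%:C)%C =
   - ((E - 2 * cos (2 * pi * (n%:~R * alpha)))%:C)%C.
  by rewrite -rmorphN opprB.
by ring.
Qed.

Lemma state_approx f (b : R) : (forall x, cm (ev (residual f) x) <= b) ->
  approx_orbit alpha (dualL d vhat E) (b / cm (vhat d%:Z)) (state f).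
Proof.
move=> hb n; rewrite state_step.
have p0 : (0 < 2 * d)%N by lia.
rewrite /l1 (bigD1 (Ordinal p0)) //= big_ord1 [X in _ + X]big1 => [|i i0]; last first.
  by rewrite -val_eqE /= in i0; rewrite big_ord1 !mxE (negbTE i0) mulr0 cm0.
rewrite addr0 !mxE eqxx mulr1 cmM cmV ler_wpM2r ?invr_ge0 ?cm_ge0 //.
exact: cm_coef_sup.
Qed.

End DualOrbit.

(** The left side is a double Fourier sum of minors of coefficients. The pairs with both indices in
    the window contribute [mu] each; for the others [|n| + |m|] is at least [N], and the weights of
    the two norms yield [exp(- c N)]. *)
Lemma antisym_ev_bound (R : realType) (f g : tpoly R) (c K mu : R) (N : nat) :
  0 <= c -> 0 <= mu -> wnorm c f <= K -> wnorm c g <= K ->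
  (forall n m : int, (`|n| <= N)%N -> (`|m| <= N)%N ->
    cm (coef n f * coef m g - coef m f * coef n g) <= mu) ->
  forall x y, cm (ev f x * ev g y - ev f y * ev g x) <=
    (2 * N + 1)%:R ^+ 2 * mu + 2 * K ^+ 2 * expR (- (c * N%:R)).
Proof.
move=> c0 mu0 hf hg hmu x y.
pose FS := undup (map snd (f ++ g)).
have uF : uniq FS by exact: undup_uniq.
have sf : {subset map snd f <= FS}.
  by move=> n hn; rewrite mem_undup map_cat mem_cat hn.
have sg : {subset map snd g <= FS}.
  by move=> n hn; rewrite mem_undup map_cat mem_cat hn orbT.
pose F n := cm (coef n f) * expR (c * `|n|%N%:R).
pose G n := cm (coef n g) * expR (c * `|n|%N%:R).
pose I (n : int) : R := (`|n| <= N)%N%:R.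
have F0 n : 0 <= F n by rewrite mulr_ge0 ?cm_ge0 ?expR_ge0.
have G0 n : 0 <= G n by rewrite mulr_ge0 ?cm_ge0 ?expR_ge0.
have sI : \sum_(n <- FS) I n <= (2 * N + 1)%:R.
  have -> : \sum_(n <- FS) I n = (size [seq n <- FS | (`|n| <= N)%N])%:R.
    rewrite size_filter -sum1_count natr_sum [RHS]big_mkcond /=.
    by apply: eq_bigr => n _; rewrite /I; case: ifP.
  rewrite ler_nat -(size_iota 0 (2 * N + 1)) -(size_map (fun k : nat => k%:Z - N%:Z)).
  apply: uniq_leq_size; first exact: filter_uniq.
  move=> n; rewrite mem_filter => /andP[hn _]; apply/mapP.
  by exists (absz (n + N%:Z)); [rewrite mem_iota; lia | lia].
have sF : \sum_(n <- FS) F n <= K by apply: le_trans hf; apply: cm_coef_sum.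
have sG : \sum_(n <- FS) G n <= K by apply: le_trans hg; apply: cm_coef_sum.
rewrite !(ev_coef _ uF sf) !(ev_coef _ uF sg).
have -> : (\sum_(n <- FS) coef n f * cexp2pi (n%:~R * x)) *
    (\sum_(n <- FS) coef n g * cexp2pi (n%:~R * y)) -
    (\sum_(n <- FS) coef n f * cexp2pi (n%:~R * y)) *
    (\sum_(n <- FS) coef n g * cexp2pi (n%:~R * x)) =
    \sum_(n <- FS) \sum_(m <- FS) (coef n f * coef m g - coef m f * coef n g) *
      (cexp2pi (n%:~R * x) * cexp2pi (m%:~R * y)).
  rewrite mulrC [X in _ - X]mulrC !mulr_suml.
  under eq_bigr do rewrite mulr_sumr.
  under [X in _ - X]eq_bigr do rewrite mulr_sumr.
  rewrite [X in X - _]exchange_big -sumrB; apply: eq_bigr => n _.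
  by rewrite -sumrB; apply: eq_bigr => m _; ring.
set e := expR (- (c * N%:R)); have e0 : 0 <= e by exact: expR_ge0.
apply: (@le_trans _ _ (\sum_(n <- FS) \sum_(m <- FS)
    (I n * I m * mu + e * (F n * G m) + e * (F m * G n)))).
  apply: le_trans (cm_sum _ _ _) _; apply: ler_sum => n _.
  apply: le_trans (cm_sum _ _ _) _; apply: ler_sum => m _.
  rewrite !cmM !cm_cexp !mulr1.
  have [hnm|hnm] := boolP ((`|n| <= N)%N && (`|m| <= N)%N).
    have /andP[hn hm] := hnm.
    rewrite /I hn hm !mul1r -addrA; apply: ler_wpDr; last exact: hmu.
    by apply: addr_ge0; apply: mulr_ge0 => //; apply: mulr_ge0; rewrite ?F0 ?G0.
  have -> : I n * I m * mu = 0.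
    by rewrite /I; case: (_ <= N)%N hnm; case: (_ <= N)%N; rewrite //= ?mul0r ?mulr0 ?mul0r.
  rewrite add0r; apply: le_trans (cm_triB _ _) _; rewrite !cmM.
  have h (n' m' : int) : (N <= `|n'| + `|m'|)%N ->
      cm (coef n' f) * cm (coef m' g) <= e * (F n' * G m').
    move=> hN; rewrite /F /G mulrACA -expRD mulrCA -expRD ler_peMr ?mulr_ge0 ?cm_ge0 //.
    have hR : (N%:R : R) <= `|n'|%N%:R + `|m'|%N%:R by rewrite -natrD ler_nat.
    by rewrite -[leLHS]expR0 ler_expR; have := ler_wpM2l c0 hR; rewrite mulrDr; lra.
  have hN : (N <= `|n| + `|m|)%N by move: hnm; rewrite negb_and -!ltnNge; lia.
  by apply: lerD; apply: h => //; rewrite addnC.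
have -> : \sum_(n <- FS) \sum_(m <- FS) (I n * I m * mu + e * (F n * G m) + e * (F m * G n)) =
    (\sum_(n <- FS) I n) ^+ 2 * mu + 2 * e * ((\sum_(n <- FS) F n) * (\sum_(n <- FS) G n)).
  under eq_bigr do rewrite !big_split /= -!mulr_suml -!mulr_sumr -!mulr_suml.
  by rewrite !big_split /= -!mulr_suml -!mulr_sumr -!mulr_suml; ring.
apply: lerD.
  rewrite ler_wpM2r // ler_pXn2r ?nnegrE ?ler0n ?sumr_ge0 //.
rewrite mulrAC ler_wpM2r //.
by rewrite ler_wpM2l // expr2 ler_pM ?sumr_ge0.
Qed.

(** * Two approximate solutions of the dual equation, with explicit errors *)

Section DualCore.
Variables (R : realType) (alpha : R) (d : nat) (vhat : int -> R[i]) (E : R).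
Local Notation C := R[i].
Hypothesis d1 : (1 <= d)%N.
Hypothesis vd : vhat d%:Z != 0.
Hypothesis v_conj : forall k : nat, (k <= d)%N -> vhat (- k%:Z) = conjc (vhat k%:Z).
Hypothesis dom : dominated (d - 1) alpha (dualL d vhat E).
Local Notation A := (dualL d vhat E).
Local Notation Om := (wronskian d vhat).
Local Notation res := (residual alpha d vhat E).

Lemma dual_growth : exists2 l, 0 <= l &
  (forall t, l1 (A t) <= expR l) /\ (forall t, l1 (invmx (A t)) <= expR l).
Proof.
have [L L1 hL] := periodic_mcont_bounded (@dualL_mcont R d vhat E) (dualL_periodic d vhat E).
pose M := L * (1 + l1 (invmx Om) * l1 Om).
have L0 : 0 <= L by exact: le_trans L1.
have LM : L <= M by rewrite ler_peMr // lerDl mulr_ge0 ?l1_ge0.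
have M1 : 1 <= M by exact: le_trans LM.
have Mp : 0 < M by exact: lt_le_trans M1.
exists (ln M); first exact: ln_ge0.
rewrite lnK ?posrE //; split=> t; first exact: le_trans (hL t) LM.
have h := dualL_wronskian E d1 vd v_conj t.
have uA := dualL_unit E d1 vd v_conj t; have uO := wronskian_unit d1 vd v_conj.
(* The invariant form expresses the inverse through the adjoint, so a bound on [A] bounds its
   inverse. *)
have -> : invmx (A t) = invmx Om *m star (A t) *m Om.
  apply: (can_inj (mulmxK uA)); rewrite mulVmx // -!mulmxA.
  by move: h; rewrite -!mulmxA => ->; rewrite mulVmx.
apply: le_trans (l1M _ _) _; apply: (@le_trans _ _ (l1 (invmx Om) * L * l1 Om)).
  rewrite ler_wpM2r ?l1_ge0 //; apply: le_trans (l1M _ _) _.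
  by rewrite ler_wpM2l ?l1_ge0 // l1_star.
by rewrite mulrAC mulrC ler_wpM2l // lerDr.
Qed.

Lemma dual_wedge_bound : exists N Q, [/\ (0 < N)%N, 1 <= Q &
  forall j (y y' z z' : 'cV[C]_(2 * d)) (s Y : R), s <= Y -> l1 y <= Y -> l1 y' <= Y ->
  l1 (cocycle_iter alpha A (j * N) 0 *m y) <= s -> l1 z <= s ->
  l1 (y - cocycle_iter alpha A (j * N) (0 - (j * N)%:R * alpha) *m z) <= s ->
  l1 (cocycle_iter alpha A (j * N) 0 *m y') <= s -> l1 z' <= s ->
  l1 (y' - cocycle_iter alpha A (j * N) (0 - (j * N)%:R * alpha) *m z') <= s ->
  forall a b, cm (y a 0 * y' b 0 - y b 0 * y' a 0) <= Q * (s * Y)].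
Proof.
have [Ep [Em [P [N [K [lam us]]]]]] := dominated_uniform (dualL_periodic d vhat E)
  (@dualL_mcont R d vhat E) (dualL_unit E d1 vd v_conj) dom.
have dim : (2 * d = 2 * (d - 1) + 2)%N by lia.
have [Q Q1 h] := wedge_bound (wronskian_unit d1 vd v_conj) (wronskian_skew d1 vd v_conj)
  (dualL_wronskian E d1 vd v_conj) (dualL_unit E d1 vd v_conj) us dim.
by exists N, Q; split=> //; exact: (us_N us).
Qed.

(** Here [j * N] is the distance at which the solutions are seen to be small and [[-n, n]] the
    window of coefficients. [err] is the error accumulated over [j * N] steps, [Y] bounds the state
    at 0, [s] the states at both ends, and [eta] is the error of the transfer inside the window. The
    wedge bound holds at site 0; transfer to two sites of the window costs [exp(l n)] for each. *)
Lemma core_explicit : exists N Q l, [/\ (0 < N)%N, 1 <= Q, 0 <= l &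
  forall c K b f g (j n : nat), 0 <= c -> wnorm c f <= K -> wnorm c g <= K ->
  (forall x, cm (ev (res f) x) <= b) -> (forall x, cm (ev (res g) x) <= b) ->
  let eta := b * Q * n%:R * expR (l * n%:R) in
  let err := b * Q * (j * N)%:R * expR (l * (j * N)%:R) in
  let Y := Q * expR (c * d%:R) * K in
  let s := Y * expR (- (c * (j * N)%:R)) + err in
  forall x y, cm (ev f x * ev g y - ev f y * ev g x) <=
    (2 * n + 1)%:R ^+ 2 *
      (Q * (expR (l * n%:R) ^+ 2 * (s * (Y + err))) + 2 * (eta * (2 * K + eta)))
    + 2 * K ^+ 2 * expR (- (c * n%:R))].
Proof.
have a0P : (d - 1 < 2 * d)%N by lia.
have a0E (k : int) : - (- k + d%:Z - 1 - (d - 1)%N%:Z) = k by lia.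
have [l l0 [A_le A_inv]] := dual_growth.
have [N [Q5 [N0 Q51 wedge]]] := dual_wedge_bound.
have uA := dualL_unit E d1 vd v_conj.
have L1 : 1 <= expR l by rewrite -[leLHS]expR0 ler_expR.
have [T [T_le T_orbit]] := approx_orbit_transfer alpha uA L1 A_le A_inv.
set i1 := l1 (1%:M : 'M[C]_(2 * d)) in T_le.
have i10 : 0 <= i1 by exact: l1_ge0.
have Q50 : 0 <= Q5 by exact: le_trans Q51.
have vV : 0 <= (cm (vhat d%:Z))^-1 by rewrite invr_ge0 cm_ge0.
pose Q := 1 + (2 * d)%:R + (cm (vhat d%:Z))^-1 + i1 ^+ 2 * Q5.
have p1 : 0 <= i1 ^+ 2 * Q5 by rewrite mulr_ge0 ?sqr_ge0.
have p2 : 0 <= (2 * d)%:R :> R by exact: ler0n.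
have Q1 : 1 <= Q by rewrite /Q; lra.
have Q0 : 0 <= Q by exact: le_trans Q1.
have i1Q : i1 ^+ 2 * Q5 <= Q by rewrite /Q; lra.
exists N, Q, l; split=> // c K b f g j n c0 hf hg rf rg eta err Y s.
have b0 : 0 <= b by apply: le_trans (rf 0); exact: cm_ge0.
have K0 : 0 <= K by apply: le_trans hf; exact: wnorm_ge0.
have Y0 : 0 <= Y by rewrite !mulr_ge0 ?expR_ge0.
have err0 : 0 <= err by rewrite !mulr_ge0 ?expR_ge0.
have eta0 : 0 <= eta by rewrite !mulr_ge0 ?expR_ge0.
have Ye : Y * expR (- (c * (j * N)%:R)) <= Y.
  by rewrite ler_piMr // -[leRHS]expR0 ler_expR oppr_le0 mulr_ge0.
have s0 : 0 <= s by rewrite addr_ge0 // mulr_ge0 ?expR_ge0.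
have sY : s <= Y + err by rewrite lerD2r.
have sY0 : 0 <= s * (Y + err) by apply: mulr_ge0 => //; exact: addr_ge0.
have bQ : b / cm (vhat d%:Z) <= b * Q by rewrite ler_wpM2l // /Q; lra.
have orb h : (forall x, cm (ev (res h) x) <= b) -> approx_orbit alpha A (b * Q) (state d h).
  by move=> rh k; exact: (le_trans (state_approx d1 vd rh k) bQ).
have st h k : wnorm c h <= K -> l1 (state d h k) <= Y * expR (- (c * `|k|%N%:R)).
  move=> hh; apply: le_trans (state_le d k c0 hh) _.
  rewrite ler_wpM2r ?expR_ge0 // ler_wpM2r // ler_wpM2r ?expR_ge0 // /Q; lra.
have all3 h : wnorm c h <= K -> (forall x, cm (ev (res h) x) <= b) ->
    [/\ l1 (state d h 0) <= Y + err,
        l1 (cocycle_iter alpha A (j * N) 0 *m state d h 0) <= s,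
        l1 (state d h (- (j * N)%N%:Z)) <= s &
        l1 (state d h 0 - cocycle_iter alpha A (j * N) (0 - (j * N)%:R * alpha)
            *m state d h (- (j * N)%N%:Z)) <= s].
  move=> hh rh; have oh := orb h rh.
  have e1 : err = b * Q * (j * N)%:R * expR l ^+ (j * N).
    by rewrite /err [l * _]mulrC expRM_natl.
  split.
  - apply: le_trans (st h 0 hh) _; rewrite absz0 mulr0 oppr0 expR0 mulr1.
    by rewrite lerDl.
  - have := approx_orbit_forward L1 A_le 0 (j * N) oh.
    rewrite mul0r add0r -e1 => hF.
    rewrite -[X in l1 X](subrK (state d h (j * N)%N%:Z)) addrC /s.
    apply: le_trans (l1D _ _) _; apply: lerD; last by rewrite l1C.
    exact: st.
  - apply: le_trans (st h _ hh) _; rewrite abszN absz_nat lerDl //.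
  have := approx_orbit_forward L1 A_le (- (j * N)%N%:Z) (j * N) oh.
  rewrite addNr -e1 mulrNz mulNr sub0r => hF; apply: le_trans hF _.
  by rewrite lerDr mulr_ge0 ?expR_ge0.
have [f1 f2 f3 f4] := all3 f hf rf; have [g1 g2 g3 g4] := all3 g hg rg.
have W := wedge j _ _ _ _ s (Y + err) sY f1 g1 f2 f3 f4 g2 g3 g4.
set Yf := state d f 0 in W; set Yg := state d g 0 in W.
apply: antisym_ev_bound => //.
  apply: addr_ge0.
    by apply: mulr_ge0 => //; apply: mulr_ge0 => //; exact: sqr_ge0.
  by apply: mulr_ge0 => //; apply: mulr_ge0 => //; apply: addr_ge0 => //; exact: mulr_ge0.
(* Entry [d - 1] of the state at site [- k] is the coefficient of index [k]. *)
pose a0 : 'I_(2 * d) := Ordinal a0P.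
pose p h (k : int) := (T (- k) *m state d h 0) a0 0.
have pe h k : wnorm c h <= K -> (forall x, cm (ev (res h) x) <= b) -> (`|k| <= n)%N ->
    cm (coef k h - p h k) <= eta.
  move=> hh rh kn.
  have -> : coef k h - p h k = (state d h (- k) - T (- k) *m state d h 0) a0 0.
    by rewrite [RHS]mxE [X in _ = X + _]mxE /= a0E [X in _ = _ + X]mxE.
  apply: le_trans (l1_entry _ _ _) _; apply: le_trans (T_orbit _ _ (orb h rh) _) _.
  rewrite abszN /eta [l * _]mulrC expRM_natl; apply: ler_pM.
  - by rewrite !mulr_ge0.
  - by rewrite exprn_ge0 ?expR_ge0.
  - by rewrite ler_wpM2l ?mulr_ge0 // ler_nat.
  - by apply: ler_weXn2l.
have cK h k : wnorm c h <= K -> cm (coef k h) <= K.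
  move=> hh; apply: le_trans hh; apply: le_trans (cm_coef_le c h k).
  rewrite ler_peMr ?cm_ge0 // -[leLHS]expR0 ler_expR mulr_ge0 //.
have pw k m : (`|k| <= n)%N -> (`|m| <= n)%N ->
    cm (p f k * p g m - p f m * p g k) <= Q * (expR (l * n%:R) ^+ 2 * (s * (Y + err))).
  move=> kn mn.
  have -> : p f k * p g m - p f m * p g k =
     \sum_a \sum_b' T (- k) a0 a * T (- m) a0 b' * (Yf a 0 * Yg b' 0 - Yf b' 0 * Yg a 0).
    rewrite /p !mxE -/Yf -/Yg [X in _ - X]mulrC !mulr_suml -sumrB; apply: eq_bigr => a _.
    by rewrite !mulr_sumr -sumrB; apply: eq_bigr => b' _; ring.
  have w0 : 0 <= Q5 * (s * (Y + err)) by exact: mulr_ge0.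
  apply: (@le_trans _ _ (l1 (T (- k)) * l1 (T (- m)) * (Q5 * (s * (Y + err))))).
    apply: le_trans (cm_sum _ _ _) _.
    apply: (@le_trans _ _ ((\sum_a cm (T (- k) a0 a)) * (\sum_b' cm (T (- m) a0 b'))
       * (Q5 * (s * (Y + err))))).
      rewrite !mulr_suml; apply: ler_sum => a _; apply: le_trans (cm_sum _ _ _) _.
      rewrite mulr_sumr mulr_suml; apply: ler_sum => b' _; rewrite !cmM.
      by rewrite ler_wpM2l ?mulr_ge0 ?cm_ge0 // W.
    have row (M : 'M[C]_(2 * d)) : \sum_a cm (M a0 a) <= l1 M.
      rewrite /l1 [leRHS](bigD1 a0) //= lerDl sumr_ge0 // => a _.
      by rewrite sumr_ge0 // => *; apply: cm_ge0.
    rewrite ler_wpM2r // ler_pM ?sumr_ge0 // => *; exact: cm_ge0.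
  have TT k' : (`|k'| <= n)%N -> l1 (T (- k')) <= i1 * expR (l * n%:R).
    move=> hk; apply: le_trans (T_le _) _; rewrite abszN mulrC [l * _]mulrC expRM_natl mulrC.
    by rewrite ler_wpM2l //; apply: ler_weXn2l.
  apply: (@le_trans _ _ ((i1 * expR (l * n%:R)) * (i1 * expR (l * n%:R)) * (Q5 * (s * (Y + err))))).
    by rewrite ler_wpM2r // ler_pM ?l1_ge0 // TT.
  rewrite [leLHS](_ : _ = i1 ^+ 2 * Q5 * (expR (l * n%:R) ^+ 2 * (s * (Y + err)))); last by ring.
  rewrite ler_wpM2r; first by [].
    by apply: mulr_ge0 => //; exact: sqr_ge0.
  exact: i1Q.
move=> k m kn mn.
have -> : coef k f * coef m g - coef m f * coef k g =
   (p f k * p g m - p f m * p g k)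
   + ((coef k f - p f k) * coef m g + p f k * (coef m g - p g m)
   - ((coef m f - p f m) * coef k g + p f m * (coef k g - p g k))) by ring.
have q h k' : wnorm c h <= K -> (forall x, cm (ev (res h) x) <= b) -> (`|k'| <= n)%N ->
    cm (p h k') <= K + eta.
  move=> hh rh kn'; rewrite -(subrK (coef k' h) (p h k')) addrC.
  by apply: le_trans (cmD _ _) _; apply: lerD; [apply: cK | rewrite cmB; apply: pe].
have half k' m' : (`|k'| <= n)%N -> (`|m'| <= n)%N ->
    cm ((coef k' f - p f k') * coef m' g + p f k' * (coef m' g - p g m')) <= eta * (2 * K + eta).
  move=> hk hm; apply: le_trans (cmD _ _) _; rewrite !cmM.
  rewrite [leRHS](_ : _ = eta * K + (K + eta) * eta); last by ring.
  by apply: lerD; apply: ler_pM; rewrite ?cm_ge0 // ?cK ?pe ?q.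
apply: le_trans (cmD _ _) _; apply: lerD; first exact: pw.
apply: le_trans (cm_triB _ _) _; rewrite [leRHS]mulr_natl [leRHS]mulr2n.
by apply: lerD; apply: half.
Qed.

End DualCore.

Lemma nat_above (R : realType) (x : R) : exists n : nat, x <= n%:R.
Proof. by exists (Num.truncn x).+1; apply/ltW/truncnS_gt. Qed.

Lemma expR_neg_small (R : realType) (C k : R) : 0 <= C -> 0 < k ->
  exists n0 : nat, forall n : nat, (n0 <= n)%N -> C * expR (- (k * n%:R)) <= 2^-1.
Proof.
move=> C0 k0; have [n0 h] := nat_above (2 * C / k); exists n0 => n hn.
have kn : 2 * C <= k * n%:R.
  rewrite [leRHS]mulrC -ler_pdivrMr //; apply: (le_trans h); by rewrite ler_nat.
have e1 := expR_ge1Dx (k * n%:R).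
rewrite expRN ler_pdivrMr ?expR_gt0 //.
lra.
Qed.

(** * Choice of the rates *)

Section Core.
Variables (R : realType) (alpha : R) (d : nat) (vhat : int -> R[i]) (E : R).
Hypothesis d1 : (1 <= d)%N.
Hypothesis vd : vhat d%:Z != 0.
Hypothesis v_conj : forall k : nat, (k <= d)%N -> vhat (- k%:Z) = conjc (vhat k%:Z).
Hypothesis dom : dominated (d - 1) alpha (dualL d vhat E).
Local Notation res := (residual alpha d vhat E).

(** All terms of [core_explicit] become constants times exponentials in [n], and [a] and [b] make
    the exponents negative. The norms are allowed the rate [c / 4] because the product of two of
    them then still leaves [exp(- c n / 2)] of the tail [exp(- c n)]. *)
Lemma almost_proportional (c K h : R) : 0 < c -> 0 < K -> 0 < h ->
  exists b n0 : nat, (0 < b)%N /\ forall n : nat, (n0 <= n)%N -> forall f g : tpoly R,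
  wnorm c f <= K * expR (c / 4 * n%:R) -> wnorm c g <= K * expR (c / 4 * n%:R) ->
  (forall x, cm (ev (res f) x) <= K * expR (- (h * b%:R * n%:R))) ->
  (forall x, cm (ev (res g) x) <= K * expR (- (h * b%:R * n%:R))) ->
  forall x y, cm (ev f x * ev g y - ev f y * ev g x) <= 1.
Proof.
move=> c0 K0 h0; have [N [Q [l [N0 Q1 l0 main]]]] := core_explicit d1 vd v_conj dom.
have Qp : 0 < Q by exact: lt_le_trans Q1.
(* The solutions are compared at distance [a * n * N]. The exponents to be beaten are 2 for the
   number of pairs in the window, [2 * l] for the two transfers and [c / 2] for the two norms; one
   more unit is left for the constants. *)
have [a ha] := nat_above ((3 + 2 * l + c / 2) / c).
have ca : 3 + 2 * l + c / 2 <= c * a%:R by rewrite [leRHS]mulrC -ler_pdivrMr.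
have a0 : 1 <= a%:R :> R.
  rewrite ler1n lt0n; apply/eqP => az; move: ca; rewrite az mulr0; lra.
have NR : 1 <= N%:R :> R by rewrite ler1n.
have aN : 1 <= a%:R * N%:R :> R by rewrite -[leLHS]mulr1 ler_pM.
(* The residual must absorb the growth [l * (a * N)] along the orbit and still be as small as
   [exp(- c a n)]; the unit pays for the linear prefactor. *)
have [b hb] := nat_above ((1 + l * (a%:R * N%:R) + c * a%:R) / h).
have hbE : 1 + l * (a%:R * N%:R) + c * a%:R <= h * b%:R by rewrite [leRHS]mulrC -ler_pdivrMr.
have b0 : (0 < b)%N.
  rewrite lt0n; apply/eqP => bz; move: hbE; rewrite bz mulr0.
  have : 0 <= l * (a%:R * N%:R) by rewrite mulr_ge0.
  have : 0 <= c * a%:R by rewrite mulr_ge0 // ltW.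
  lra.
pose D := Q * expR (c * d%:R) * K + K * Q * (a%:R * N%:R).
have D1 : 0 <= Q * expR (c * d%:R) * K by rewrite !mulr_ge0 ?expR_ge0 // ltW.
have D2 : 0 <= K * Q * (a%:R * N%:R) by rewrite !mulr_ge0 // ltW.
have D0 : 0 <= D by exact: addr_ge0.
pose C1 := 9 * (Q * (4 * D ^+ 2) + 2 * (D * (2 * K + D))).
have DK0 : 0 <= 2 * K + D by apply: addr_ge0 => //; apply: mulr_ge0 => //; exact: ltW.
have P1 : 0 <= Q * (4 * D ^+ 2).
  by apply: mulr_ge0; [exact: ltW | apply: mulr_ge0 => //; exact: sqr_ge0].
have P2 : 0 <= 2 * (D * (2 * K + D)) by apply: mulr_ge0 => //; exact: mulr_ge0.
have C10 : 0 <= C1 by apply: mulr_ge0 => //; exact: addr_ge0.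
have [n1 hn1] := expR_neg_small C10 ltr01.
have [||n2 hn2] := @expR_neg_small _ (2 * K ^+ 2) (c / 2); first by rewrite mulr_ge0 ?sqr_ge0.
  by rewrite divr_gt0.
exists b, (maxn n1 n2); split=> // n hn f g wf wg rf rg x y.
have {hn1} k1 := hn1 n (leq_trans (leq_maxl _ _) hn).
have {hn2} k2 := hn2 n (leq_trans (leq_maxr _ _) hn).
have := main c _ _ f g (a * n)%N n (ltW c0) wf wg rf rg x y; rewrite /=.
set X : R := n%:R in wf wg rf rg k1 k2 *; have X0 : 0 <= X by exact: ler0n.
pose ee (r : R) := expR (r * X).
have eeM r s : ee r * ee s = ee (r + s) by rewrite /ee mulrDl expRD.
have ee0 r : 0 <= ee r by exact: expR_ge0.
have ee_le r s : r <= s -> ee r <= ee s by move=> rs; rewrite ler_expR ler_wpM2r.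
have ee1 : X <= ee 1 by rewrite /ee mul1r; have := expR_ge1Dx X; lra.
have ee00 : ee 0 = 1 by rewrite /ee mul0r expR0.
have -> : ((a * n * N)%N%:R : R) = a%:R * N%:R * X by rewrite !natrM /X; ring.
have -> : ((2 * n + 1)%N%:R : R) = 2 * X + 1 by rewrite natrD natrM.
set aNR := a%:R * N%:R in aN hbE D D1 D2 D0 DK0 P1 P2 C1 C10 k1 *.
have -> : expR (l * X) = ee l by [].
have -> : expR (l * (aNR * X)) = ee (l * aNR) by rewrite /ee mulrA.
have -> : expR (- (c * (aNR * X))) = ee (- (c * aNR)) by rewrite /ee mulrA mulNr.
have -> : expR (- (h * b%:R * X)) = ee (- (h * b%:R)) by rewrite /ee mulNr.
have -> : expR (- (c * X)) = ee (- c) by rewrite /ee mulNr.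
have -> : expR (c / 4 * X) = ee (c / 4) by [].
set q := ee (c / 4); set z := ee (- (c * a%:R)).
have q1 : 1 <= q by rewrite -[leLHS]ee00; apply: ee_le; lra.
have q0 : 0 <= q by exact: le_trans q1.
have z0 : 0 <= z by exact: ee0.
have z1 : z <= 1 by rewrite -[leRHS]ee00; apply: ee_le; lra.
set err := K * ee _ * Q * _ * _; set eta := K * ee _ * Q * X * _.
set Y := Q * _ * (K * q); set s := Y * _ + err => hmain.
have errz : err <= D * z.
  rewrite /err [leLHS](_ : _ = K * Q * aNR * (X * (ee (- (h * b%:R)) * ee (l * aNR)))); last by ring.
  apply: (@le_trans _ _ (K * Q * aNR * z)); last by rewrite ler_wpM2r // lerDr.
  rewrite ler_wpM2l // eeM; apply: le_trans (ler_wpM2r (ee0 _) ee1) _.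
  by rewrite eeM; apply: ee_le; lra.
have etaz : eta <= D * z.
  rewrite /eta [leLHS](_ : _ = K * Q * (X * (ee (- (h * b%:R)) * ee l))); last by ring.
  apply: (@le_trans _ _ (K * Q * aNR * z)); last by rewrite ler_wpM2r // lerDr.
  rewrite [leRHS](_ : _ = K * Q * (aNR * z)); last by ring.
  rewrite ler_wpM2l ?mulr_ge0 ?(ltW K0) ?(ltW Qp) // -[leLHS]mul1r ler_pM //.
    by rewrite mulr_ge0 // eeM.
  rewrite eeM; apply: le_trans (ler_wpM2r (ee0 _) ee1) _.
  rewrite eeM; apply: ee_le; have : l <= l * aNR by rewrite ler_peMr.
  lra.
have Yq : Y <= D * q.
  by rewrite /Y mulrA ler_wpM2r // lerDl.
have Y0 : 0 <= Y by rewrite /Y mulr_ge0 ?mulr_ge0 ?expR_ge0 // ltW.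
have err0 : 0 <= err by rewrite /err !mulr_ge0 // ltW // (lt_le_trans ltr01).
have eta0 : 0 <= eta by rewrite /eta !mulr_ge0 // ltW.
have sz : s <= 2 * D * (q * z).
  rewrite /s [leRHS](_ : _ = D * q * z + D * q * z); last by ring.
  apply: lerD.
    apply: ler_pM => //; apply: ee_le; rewrite lerN2 ler_wpM2l ?(ltW c0) //.
    by rewrite ler_peMr // (le_trans ler01).
  apply: le_trans errz _; rewrite mulrAC ler_peMr ?mulr_ge0 //.
have s0 : 0 <= s by rewrite /s addr_ge0 // mulr_ge0.
have Ye : Y + err <= 2 * D * q.
  rewrite [leRHS](_ : _ = D * q + D * q); last by ring.
  apply: lerD => //; apply: le_trans errz _; rewrite ler_wpM2l //.
  exact: le_trans q1.
have mu1 : Q * (ee l ^+ 2 * (s * (Y + err))) <= Q * (4 * D ^+ 2) * (ee (2 * l) * (q * q) * z).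
  rewrite [leRHS](_ : _ = Q * (ee (2 * l) * ((2 * D * (q * z)) * (2 * D * q)))); last by ring.
  rewrite ler_wpM2l ?(ltW Qp) //; apply: ler_pM.
  - exact: sqr_ge0.
  - by apply: mulr_ge0 => //; exact: addr_ge0.
  - by rewrite expr2 eeM; apply: ee_le; lra.
  by apply: ler_pM => //; exact: addr_ge0.
have mu2 : 2 * (eta * (2 * (K * q) + eta)) <= 2 * (D * (2 * K + D)) * (ee (2 * l) * (q * q) * z).
  apply: (@le_trans _ _ (2 * ((D * z) * ((2 * K + D) * q)))).
    have Kq : 0 <= 2 * (K * q) by do 2![apply: mulr_ge0 => //]; exact: ltW.
    have e1 : eta <= D * q.
      by apply: le_trans etaz _; rewrite ler_wpM2l //; exact: le_trans q1.
    rewrite ler_wpM2l //; apply: ler_pM => //; first exact: addr_ge0.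
    by rewrite [leRHS](_ : _ = 2 * (K * q) + D * q); [rewrite lerD2l | ring].
  rewrite [leLHS](_ : _ = 2 * (D * (2 * K + D)) * (q * z)); last by ring.
  rewrite ler_wpM2l // ler_wpM2r //.
  have e2 : 1 <= ee (2 * l) by rewrite -[leLHS]ee00; apply: ee_le; rewrite mulr_ge0.
  by rewrite mulrA ler_peMl // -[leLHS]mul1r ler_pM.
have X3 : (2 * X + 1) ^+ 2 <= 9 * ee 2.
  have e3 : 2 * X + 1 <= 3 * ee 1.
    by have := ee_le 0 1 ler01; rewrite ee00; lra.
  have -> : ee 2 = ee 1 ^+ 2 by rewrite expr2 eeM.
  rewrite [leRHS](_ : _ = (3 * ee 1) ^+ 2); last by ring.
  by rewrite ler_pXn2r // nnegrE; [lra | apply: mulr_ge0].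
apply: le_trans hmain _; rewrite [leRHS](splitr (1 : R)) mul1r; apply: lerD.
  apply: le_trans k1.
  apply: (@le_trans _ _ (9 * ee 2 * ((Q * (4 * D ^+ 2) + 2 * (D * (2 * K + D)))
      * (ee (2 * l) * (q * q) * z)))).
    apply: ler_pM; rewrite ?sqr_ge0 //.
      apply: addr_ge0; first by apply: mulr_ge0; [exact: ltW | apply: mulr_ge0;
        [exact: sqr_ge0 | apply: mulr_ge0 => //; exact: addr_ge0]].
      by do 2![apply: mulr_ge0 => //]; apply: addr_ge0 => //; do 2![apply: mulr_ge0 => //]; exact: ltW.
    by rewrite [leRHS]mulrDl; apply: lerD.
  rewrite [leLHS](_ : _ = C1 * (ee 2 * (ee (2 * l) * (q * q) * z))); last by rewrite /C1; ring.
  have -> : expR (- (1 * X)) = ee (- 1) by rewrite /ee mulN1r mul1r.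
  by rewrite ler_wpM2l // /q /z !eeM; apply: ee_le; lra.
rewrite [leLHS](_ : _ = 2 * K ^+ 2 * (q * q * ee (- c))); last by ring.
apply: le_trans k2; have -> : expR (- (c / 2 * X)) = ee (- (c / 2)) by rewrite /ee mulNr.
apply: ler_wpM2l; first by rewrite mulr_ge0 ?sqr_ge0.
by rewrite /q !eeM; apply: ee_le; lra.
Qed.

End Core.

(** * Finite differences of real analytic functions *)

Section FiniteDifferences.
Variable R : realType.
Implicit Types (s x y : R) (p : {poly R}) (f g : R -> R).

Definition fdiff s f x := f (x + s) - f x.
Definition fdiffn s m f := iter m (fdiff s) f.
Definition pdiff s p : {poly R} := p \Po ('X + s%:P) - p.

Lemma fdiffnS s m f x : fdiffn s m.+1 f x = fdiffn s m f (x + s) - fdiffn s m f x.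
Proof. by []. Qed.

Lemma pdiffE s p x : (pdiff s p).[x] = p.[x + s] - p.[x].
Proof. by rewrite /pdiff hornerD hornerN horner_comp hornerD hornerX hornerC. Qed.

Lemma pdiffnE s m p x : (iter m (pdiff s) p).[x] = fdiffn s m (horner p) x.
Proof. by elim: m x => [//|m IH] x; rewrite /= pdiffE !IH. Qed.

Lemma deriv_pdiff s p m : (pdiff s p)^`(m) = pdiff s p^`(m).
Proof.
elim: m => [//|m IH]; rewrite !derivnS IH /pdiff derivB deriv_comp derivD derivX derivC.
by rewrite addr0 mulr1.
Qed.

(** Every difference is turned into a derivative by the mean value theorem. Working with polynomials
    suffices: the partial sums of a power series pass to the limit in a finite difference, and no
    derivative of the limit is required. *)
Lemma pdiffn_le s m p x (B : R) : 0 <= s ->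
  (forall y, x <= y <= x + m%:R * s -> `|p^`(m).[y]| <= B) ->
  `|(iter m (pdiff s) p).[x]| <= s ^+ m * B.
Proof.
move=> s0; elim: m p B => [|m IH] p B hB.
  by rewrite mul1r; apply: hB; rewrite mul0r addr0 lexx.
rewrite iterSr exprSr -mulrA; apply: IH => y /andP[y1 y2].
rewrite deriv_pdiff pdiffE.
move: s0; rewrite le_eqVlt => /orP[/eqP <-|s0].
  by rewrite addr0 subrr normr0 mul0r.
have [|c] := @poly_mvt _ y (y + s) p^`(m); first by rewrite ltrDl.
rewrite in_itv /= => /andP[c1 c2] ->.
rewrite (_ : y + s - y = s); last by rewrite addrAC subrr add0r.
rewrite normrM (gtr0_norm s0) mulrC ler_wpM2l ?(ltW s0) // -derivnS; apply: hB.
rewrite -natr1 mulrDl mul1r; apply/andP; split; lra.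
Qed.

Lemma bin_le_exp2 n m : ('C(n, m) <= 2 ^ n)%N.
Proof.
elim: n m => [|n IH] [|m] //; first by rewrite bin0 expn_gt0.
by rewrite binS expnS mul2n -addnn addnC leq_add.
Qed.

Lemma half_geometric n : \sum_(i < n) (2^-1 : R) ^+ i <= 2.
Proof.
suff -> : \sum_(i < n) (2^-1 : R) ^+ i = 2 - 2 * 2^-1 ^+ n.
  by rewrite lerBlDr lerDl mulr_ge0 // exprn_ge0.
elim: n => [|n IH]; first by rewrite big_ord0 mulr1 subrr.
by rewrite big_ord_recr IH exprS /= ; field.
Qed.

(** A Cauchy estimate made on coefficients, uniform in the truncation [N]. The binomial coefficient
    of [m + i] over [m] is at most [2 ^ (m + i)], so evaluation at a quarter of the radius leaves a
    geometric series of ratio 1/2. *)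
Lemma derivn_poly_le (a : nat -> R) (C rho : R) (N m : nat) y :
  0 <= C -> 0 < rho -> (forall n, `|a n| <= C * rho ^- n) -> `|y| <= rho / 4 ->
  `|(\poly_(n < N) a n)^`(m).[y]| <= 2 * C * m`!%:R * (2 / rho) ^+ m.
Proof.
move=> C0 r0 ha hy; set p := \poly_(_ < _) _.
rewrite (@horner_coef_wide _ N _ y); last first.
  apply: leq_trans (size_poly N a).
  elim: m {ha} => [//|m IH]; rewrite derivnS; apply: leq_trans IH.
  have [->|q0] := eqVneq p^`(m) 0; first by rewrite linear0 size_poly0.
  exact/ltnW/lt_size_deriv.
apply: le_trans (ler_norm_sum _ _ _) _.
apply: (@le_trans _ _ (\sum_(i < N) C * m`!%:R * (2 / rho) ^+ m * 2^-1 ^+ i)); last first.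
  rewrite -mulr_sumr; apply: le_trans (ler_wpM2l _ (half_geometric N)) _.
    by rewrite !mulr_ge0 // exprn_ge0 // divr_ge0 // ltW.
  by apply: eq_ler; ring.
apply: ler_sum => i _; rewrite coef_derivn -[_ *+ (_ ^_ _)]mulr_natr !normrM normr_nat.
have h1 : `|p`_(m + i)| <= C * rho ^- (m + i).
  rewrite coef_poly; case: ifP => _; first exact: ha.
  by rewrite normr0 mulr_ge0 // invr_ge0 exprn_ge0 // ltW.
have h2 : ((m + i) ^_ m)%:R <= m`!%:R * 2 ^+ (m + i) :> R.
  by rewrite -natrX -natrM ler_nat -bin_ffact mulnC leq_mul // bin_le_exp2.
have h3 : `|y ^+ i| <= (rho / 4) ^+ i by rewrite normrX lerXn2r // nnegrE // divr_ge0 // ltW.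
apply: (@le_trans _ _ (C * rho ^- (m + i) * (m`!%:R * 2 ^+ (m + i)) * (rho / 4) ^+ i)).
  by apply: ler_pM => //; apply: ler_pM.
apply: eq_ler.
have r1 : rho != 0 by rewrite gt_eqF.
rewrite !exprMn !exprVn !exprD (_ : (4 : R) = 2 * 2) ?exprMn //; last by ring.
have t1 : (2 : R) != 0 by rewrite pnatr_eq0.
have := expf_neq0 m r1; have := expf_neq0 i r1.
have := expf_neq0 m t1; have := expf_neq0 i t1.
move: (rho ^+ m) (rho ^+ i) (2 ^+ m) (2 ^+ i) => r_m r_i t_m t_i h4 h5 h6 h7.
by field; rewrite ?h4 ?h5 ?h6 ?h7.
Qed.

Lemma fdiffn_cvg s m (F : nat -> R -> R) f x : 0 <= s ->
  (forall y, x <= y <= x + m%:R * s -> (fun N => F N y) @ \oo --> f y) ->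
  (fun N => fdiffn s m (F N) x) @ \oo --> fdiffn s m f x.
Proof.
move=> s0; elim: m x => [|m IH] x h.
  by apply: h; rewrite mul0r addr0 lexx.
rewrite fdiffnS; apply: cvgB; apply: IH => y /andP[y1 y2]; apply: h;
  rewrite -natr1 mulrDl mul1r.
  by apply/andP; split; lra.
by apply/andP; split; lra.
Qed.

Lemma fdiffn_shift s m f x0 x :
  fdiffn s m (fun y => f (y - x0)) x = fdiffn s m f (x - x0).
Proof.
by elim: m x => [//|m IH] x; rewrite !fdiffnS !IH addrAC.
Qed.

(** Convergence at one point off the center bounds the coefficients geometrically, which bounds the
    differences of all the partial sums and so those of their limit. *)
Lemma analytic_fdiffn_local f x0 : real_analytic f -> exists C rho,
  [/\ 0 < C, 0 < rho & forall m s x, 0 <= s -> `|x - x0| <= rho ->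
  `|x + m%:R * s - x0| <= rho -> `|fdiffn s m f x| <= C * m`!%:R * (s / rho) ^+ m].
Proof.
move=> /(_ x0) [r r0 [a ha]].
(* The series converges at [x0 + t], strictly inside the interval, so its partial sums there are
   bounded; the final radius is [t / 4], as [derivn_poly_le] demands. *)
pose t := r / 2; have t0 : 0 < t by rewrite divr_gt0.
have tr : t < r by rewrite /t; lra.
have cvt : (fun N => \sum_(n < N) a n * t ^+ n) @ \oo --> f (x0 + t).
  have := ha (x0 + t); rewrite addrAC subrr add0r gtr0_norm // => h; exact: h.
have [M [_ hM]] := cvg_seq_bounded (cvgP _ cvt).
have hM1 : forall N, `|\sum_(n < N) a n * t ^+ n| <= `|M| + 1.
  move=> N; apply: (hM (`|M| + 1)) => //.
  by apply: le_lt_trans (ler_norm _) _; rewrite ltrDl.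
pose C := 2 * (`|M| + 1).
have C0 : 0 < C by rewrite mulr_gt0 // ltr_wpDl.
have aC n : `|a n| <= C * t ^- n.
  have e : a n * t ^+ n = \sum_(i < n.+1) a i * t ^+ i - \sum_(i < n) a i * t ^+ i.
    by rewrite big_ord_recr /= addrAC subrr add0r.
  have : `|a n * t ^+ n| <= C.
    by rewrite e; apply: le_trans (ler_normB _ _) _; have := hM1 n; have := hM1 n.+1; rewrite /C; lra.
  by rewrite normrM normrX (gtr0_norm t0) -ler_pdivlMr // exprn_gt0.
exists (2 * C), (t / 4); split; [by rewrite mulr_gt0 | by rewrite divr_gt0 |].
move=> m s x s0 h1 h2.
have rng y : x <= y <= x + m%:R * s -> `|y - x0| <= t / 4.
  move=> /andP[y1 y2]; move: h1 h2; rewrite !ler_norml => /andP[g1 g2] /andP[g3 g4].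
  by apply/andP; split; lra.
pose p N : {poly R} := \poly_(n < N) a n.
have cv : (fun N => fdiffn s m (fun y => (p N).[y - x0]) x) @ \oo --> fdiffn s m f x.
  apply: fdiffn_cvg => // y hy.
  have := ha y; rewrite (le_lt_trans (rng y hy)); last by rewrite /t; lra.
  move=> /(_ isT); apply: cvg_trans; apply: near_eq_cvg; near=> N.
  by rewrite /p horner_poly.
have bd N : `|fdiffn s m (fun y => (p N).[y - x0]) x| <= 2 * C * m`!%:R * (s / (t / 4)) ^+ m.
  rewrite (fdiffn_shift s m (horner (p N)) x0) -pdiffnE.
  apply: le_trans (pdiffn_le s0 (B := 2 * C * m`!%:R * (2 / t) ^+ m) _) _.
    move=> y /andP[y1 y2]; apply: derivn_poly_le => //; first exact: ltW.
    by rewrite -[y](addrK x0); apply: rng; apply/andP; split; lra.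
  rewrite mulrCA -exprMn; apply: ler_wpM2l; first by rewrite !mulr_ge0 // ltW.
  have e : s / (t / 4) = s * (4 / t) by rewrite invf_div.
  have t2 : 0 <= 2 / t by rewrite divr_ge0 // ltW.
  have t4 : 2 / t <= 4 / t by rewrite ler_wpM2r ?invr_ge0 ?(ltW t0) //; lra.
  rewrite e; apply: lerXn2r; rewrite ?nnegrE; first exact: mulr_ge0.
    by rewrite mulr_ge0 // (le_trans t2).
  by rewrite ler_wpM2l.
have cvn : (fun N => `|fdiffn s m (fun y => (p N).[y - x0]) x|) @ \oo --> `|fdiffn s m f x|.
  exact: cvg_norm.
rewrite -(cvg_lim _ cvn) //; apply: limr_le; first by apply/cvg_ex; exists `|fdiffn s m f x|.
by near=> N; exact: bd.
Unshelve. all: by end_near.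
Qed.

Lemma fdiffn_periodic s m f : (forall x, f (x + 1) = f x) ->
  forall x, fdiffn s m f (x + 1) = fdiffn s m f x.
Proof. by move=> pf; elim: m => [//|m IH] x; rewrite !fdiffnS addrAC !IH. Qed.

(* The local bounds are made uniform by compactness of [0, 1]. *)
Lemma analytic_fdiffn f : real_analytic f -> (forall x, f (x + 1) = f x) ->
  exists k : nat, (0 < k)%N /\ forall m s x, 0 <= s -> m%:R * s <= k%:R^-1 ->
  `|fdiffn s m f x| <= k%:R * m`!%:R * (k%:R * s) ^+ m.
Proof.
move=> af pf.
(* A single integer is at once the constant, the rate and the reciprocal of the range, so that each
   local bound holds for all large [k]. *)
pose P (k : nat) x := forall m s, (0 < k)%N -> 0 <= s -> m%:R * s <= k%:R^-1 ->
  `|fdiffn s m f x| <= k%:R * m`!%:R * (k%:R * s) ^+ m.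
have cpt : compact `[(0 : R), 1]%classic by exact: segment_compact.
have /compact_near_coveringP /(_ nat \oo%classic P _) h := cpt.
have : \forall k \near \oo, `[(0 : R), 1]%classic `<=` P k.
  apply: h => x0 _; have [C [rho [C0 r0 hb]]] := analytic_fdiffn_local x0 af.
  have near_x : \forall x \near x0, `|x - x0| <= rho / 2.
    apply/nbhs_ballP; exists (rho / 2); first by rewrite /= divr_gt0.
    by move=> x; rewrite -ball_normE /= distrC => /ltW.
  have near_k : \forall k \near \oo, Num.max (2 / rho) C <= k%:R.
    exact: nbhs_infty_ger.
  near=> x k => m s k0 s0 hms.
  have hx : `|x - x0| <= rho / 2 by near: x.
  have : Num.max (2 / rho) C <= k%:R by near: k.
  rewrite ge_max => /andP[k1 k2].
  have kR : 0 < (k%:R : R) by rewrite ltr0n.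
  have ki : (k%:R : R)^-1 <= rho / 2.
    by rewrite -[leRHS]invrK lef_pV2 ?posrE ?invr_gt0 ?divr_gt0 // invf_div.
  have ms0 : 0 <= m%:R * s by rewrite mulr_ge0.
  apply: le_trans (hb m s x s0 _ _) _.
  - by apply: le_trans hx _; lra.
  - by move: hx; rewrite !ler_norml => /andP[g1 g2]; apply/andP; split; lra.
  apply: ler_pM; rewrite ?mulr_ge0 ?exprn_ge0 ?divr_ge0 ?(ltW C0) ?(ltW r0) //.
    by rewrite ler_wpM2r.
  apply: lerXn2r; rewrite ?nnegrE ?mulr_ge0 ?invr_ge0 ?(ltW r0) //.
  rewrite mulrC ler_wpM2r //; apply: le_trans k1.
  by rewrite ler_peMl ?invr_ge0 ?(ltW r0) //; lra.
case=> k0 _ hk; exists k0.+1; split=> // m s x s0 hms; move: x.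
have H x : 0 <= x <= 1 -> `|fdiffn s m f x| <= k0.+1%:R * m`!%:R * (k0.+1%:R * s) ^+ m.
  move=> x01; have xi : `[(0 : R), 1]%classic x by rewrite /= in_itv /=.
  exact: (hk _ (leqnSn k0) x xi m s).
by apply: (periodic_reduce _ H) => x; rewrite fdiffn_periodic.
Unshelve. all: by end_near.
Qed.

End FiniteDifferences.

Fixpoint irange (n : nat) : seq int :=
  if n is n'.+1 then [:: n%:Z, - n%:Z & irange n'] else [:: 0].

Lemma sum_irange (V : nmodType) n (F : int -> V) :
  \sum_(k <- irange n) F k = \sum_(j < (2 * n).+1) F (j%:Z - n%:Z).
Proof.
elim: n F => [|n IH] F; first by rewrite big_seq1 big_ord1.
rewrite /= !big_cons IH mulnS [RHS]big_ord_recl [X in _ = _ + X]big_ord_recr /=.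
rewrite addrCA; congr (F _ + _); first by lia.
rewrite addrC; congr (_ + F _); last by rewrite /bump /=; lia.
by apply: eq_bigr => j _; congr F; rewrite /bump /=; lia.
Qed.

Lemma mem_irange n (k : int) : (k \in irange n) = (`|k| <= n)%N.
Proof.
elim: n => [|n IH]; first by rewrite inE; apply/eqP/idP; lia.
rewrite /= !inE IH; apply/idP/idP; last by lia.
by case/or3P => [/eqP -> | /eqP -> |]; lia.
Qed.

Lemma sum_geometric_irange (R : realType) (z : R) n : 0 <= z < 1 ->
  \sum_(k <- irange n) z ^+ `|k| <= 1 + 2 * z / (1 - z).
Proof.
move=> /andP[z0 z1]; have z2 : 1 - z != 0 by rewrite gt_eqF // subr_gt0.
suff -> : \sum_(k <- irange n) z ^+ `|k| = 1 + 2 * z / (1 - z) - 2 * z ^+ n.+1 / (1 - z).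
  by rewrite gerBl !mulr_ge0 ?exprn_ge0 ?invr_ge0 ?subr_ge0 // ltW.
elim: n => [|n IH]; first by rewrite big_seq1 expr1 addrK.
by rewrite /= !big_cons IH abszN absz_nat !exprS; field.
Qed.

(** * Trigonometric interpolation on a grid, with uniform exponential decay *)

Section Interpolation.
Variable R : realType.
Local Notation C := R[i].
Implicit Types (f g : R -> R) (n : nat) (k : int).

Local Notation M n := ((2 * n).+1).

Definition dft n f k : C :=
  (\sum_(j < M n) (f (j%:R / (M n)%:R))%:C%C * cexp2pi (- (k%:~R * (j%:R / (M n)%:R)))) / (M n)%:R.

Definition interp n f : tpoly R := [seq (dft n f k, k) | k <- irange n].

Let MR n : (M n)%:R != 0 :> R. Proof. by rewrite pnatr_eq0. Qed.
Let MC n : (M n)%:R != 0 :> C. Proof. by rewrite pnatr_eq0. Qed.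
Let M0 n : 0 < (M n)%:R :> R. Proof. by rewrite ltr0n. Qed.

Lemma cm_nat (m : nat) : cm (m%:R : C) = m%:R.
Proof. by rewrite (_ : m%:R = (m%:R : R)%:C%C) ?cmR ?ger0_norm // rmorph_nat. Qed.

Lemma dft_le n f k (B : R) : (forall x, `|f x| <= B) -> cm (dft n f k) <= B.
Proof.
move=> hB; rewrite /dft cmM cmV cm_nat ler_pdivrMr //.
apply: le_trans (cm_sum _ _ _) _.
apply: (@le_trans _ _ (\sum_(j < M n) B)); last by rewrite sumr_const card_ord mulr_natr.
by apply: ler_sum => j _; rewrite cmM cm_cexp mulr1 cmR.
Qed.

Lemma dft_shift n f k : (forall x, f (x + 1) = f x) ->
  dft n (fun x => f (x + (M n)%:R^-1)) k = cexp2pi (k%:~R * (M n)%:R^-1) * dft n f k.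
Proof.
move=> pf; rewrite /dft mulrA; congr (_ / _).
pose h (j : nat) := (f (j%:R / (M n)%:R))%:C%C * cexp2pi (- (k%:~R * (j%:R / (M n)%:R))).
have -> : \sum_(j < M n) (f (j%:R / (M n)%:R + (M n)%:R^-1))%:C%C
     * cexp2pi (- (k%:~R * (j%:R / (M n)%:R))) =
   cexp2pi (k%:~R * (M n)%:R^-1) * \sum_(j < M n) h j.+1.
  rewrite mulr_sumr; apply: eq_bigr => j _; rewrite /h [RHS]mulrCA -cexpD.
  have -> : j.+1%:R / (M n)%:R = j%:R / (M n)%:R + (M n)%:R^-1 :> R.
    by rewrite -natr1 mulrDl mul1r.
  by congr (_ * cexp2pi _); ring.
congr (_ * _).
have e : \sum_(j < (M n).+1) h j = h 0%N + \sum_(j < M n) h j.+1 by rewrite big_ord_recl.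
rewrite big_ord_recr /= in e.
have hM : h (M n) = h 0%N.
  rewrite /h divff // mul0r mulr1 mulr0 oppr0 cexp0 -intrN cexp_int.
  by rewrite -(add0r 1) pf.
by apply: (addrI (h 0%N)); rewrite -e hM addrC.
Qed.

Lemma dftB n f g k : dft n (fun x => f x - g x) k = dft n f k - dft n g k.
Proof.
rewrite /dft -mulrBl -sumrB; congr (_ / _); apply: eq_bigr => j _.
by rewrite rmorphB mulrBl.
Qed.

(** Discrete integration by parts: with the grid spacing as step, a shift is a permutation of the
    grid by periodicity and acts on the coefficient as a character. *)
Lemma dft_fdiffn n m f k : (forall x, f (x + 1) = f x) ->
  dft n (fdiffn (M n)%:R^-1 m f) k = (cexp2pi (k%:~R * (M n)%:R^-1) - 1) ^+ m * dft n f k.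
Proof.
move=> pf; elim: m => [|m IH]; first by rewrite mul1r.
rewrite [LHS](dftB n (fun x => fdiffn (M n)%:R^-1 m f (x + (M n)%:R^-1)) (fdiffn _ m f)).
rewrite dft_shift; last exact: fdiffn_periodic.
by rewrite IH exprS; ring.
Qed.

Lemma interp_grid n f (l : nat) : (l < M n)%N ->
  ev (interp n f) (l%:R / (M n)%:R) = (f (l%:R / (M n)%:R))%:C%C.
Proof.
move=> lM; rewrite /ev big_map /=; under eq_bigr => k _ do rewrite /dft mulrAC mulr_suml.
rewrite -mulr_suml exchange_big /=; apply: (mulIf (MC n)); rewrite divfK //.
have key (j : 'I_(M n)) : \sum_(k <- irange n) (f (j%:R / (M n)%:R))%:C%C *
    cexp2pi (- (k%:~R * (j%:R / (M n)%:R))) * cexp2pi (k%:~R * (l%:R / (M n)%:R)) =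
    if j == Ordinal lM then (f (j%:R / (M n)%:R))%:C%C * (M n)%:R else 0.
  pose t : int := l%:Z - (j : nat)%:Z.
  under eq_bigr => k _.
    rewrite -mulrA -cexpD (_ : _ + _ = k%:~R * (t%:~R / (M n)%:R)); last first.
      by rewrite /t intrB; ring.
    over.
  rewrite -mulr_sumr sum_irange.
  under eq_bigr => i _.
    rewrite (_ : _ * _ = t%:~R * ((i : nat)%:R / (M n)%:R) - n%:R * (t%:~R / (M n)%:R)); last first.
      by rewrite intrB; ring.
    rewrite cexpD.
    over.
  rewrite -mulr_suml sum_roots //; last by have := ltn_ord j; lia.
  have -> : (t == 0) = (j == Ordinal lM).
    by rewrite -val_eqE /= /t; apply/eqP/eqP; lia.
  case: eqP => [jl|_]; last by rewrite mul0r mulr0.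
  have -> : t = 0 by rewrite /t jl /=; lia.
  by rewrite mul0r mulr0 oppr0 cexp0 mulr1.
under eq_bigr => j _ do rewrite key.
by rewrite -big_mkcond big_pred1_eq.
Qed.

Section Decay.
Variables (f : R -> R) (K : nat).
Hypothesis pf : forall x, f (x + 1) = f x.
Hypothesis K0 : (0 < K)%N.
Hypothesis bf : forall m s x, 0 <= s -> m%:R * s <= K%:R^-1 ->
  `|fdiffn s m f x| <= K%:R * m`!%:R * (K%:R * s) ^+ m.

Let KR : 0 < K%:R :> R. Proof. by rewrite ltr0n. Qed.

(** Take [m] differences with [m] about [|k| / (2 K)]. The multiplier is at least [(|k| / M) ^ m]
    and the differences are at most [K m! (K / M) ^ m], so the grid size cancels; [m! <= m ^ m]
    leaves [(m K / |k|) ^ m], at most [2 ^ (- m)]. *)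
Lemma dft_decay n k : (`|k| <= n)%N -> cm (dft n f k) <= K%:R * 2^-1 ^+ (`|k| %/ (2 * K)).
Proof.
move=> kn; set m := (_ %/ _)%N; set s : R := (M n)%:R^-1.
have s0 : 0 <= s by rewrite invr_ge0.
have mk : (m * (2 * K) <= `|k|)%N by exact: leq_trunc_div.
have ms : m%:R * s <= K%:R^-1.
  rewrite ler_pdivrMr // mulrC ler_pdivlMr // -natrM ler_nat; nia.
have [m0|m0] := posnP m.
  rewrite m0 mulr1; apply: dft_le => x; rewrite m0 in ms.
  by have := bf x s0 ms; rewrite fact0 expr0 !mulr1.
have k0 : (0 < `|k|)%N by nia.
have kR : 0 < (`|k|%N)%:R :> R by rewrite ltr0n.
have h1 : cm ((cexp2pi (k%:~R * s) - 1) ^+ m * dft n f k) <= K%:R * m`!%:R * (K%:R * s) ^+ m.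
  by rewrite -dft_fdiffn //; apply: dft_le => x; exact: bf.
rewrite cmM cmX in h1.
have h2 : (`|k|%N)%:R * s <= cm (cexp2pi (k%:~R * s) - 1).
  have -> : (`|k|%N)%:R * s = `|k%:~R * s|.
    by rewrite normrM (ger0_norm s0) -intr_norm -abszE.
  apply: cexpB1_ge; rewrite normrM (ger0_norm s0) -intr_norm -abszE.
  rewrite ler_pdivrMr // -ler_pdivrMl // invrK -[X in _ * X]/(_%:R) -natrM ler_nat; lia.
have h3 : ((`|k|%N)%:R * s) ^+ m * cm (dft n f k) <= K%:R * m`!%:R * (K%:R * s) ^+ m.
  apply: le_trans h1; rewrite ler_wpM2r ?cm_ge0 // lerXn2r // nnegrE ?cm_ge0 //.
  by rewrite mulr_ge0.
have sm : 0 < s ^+ m by rewrite exprn_gt0 // invr_gt0.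
have h4 : (`|k|%N)%:R ^+ m * cm (dft n f k) <= K%:R * m`!%:R * K%:R ^+ m.
  rewrite -(ler_pM2r sm); move: h3; rewrite !exprMn.
  by rewrite [X in X <= _ -> _](_ : _ = (`|k|%N)%:R ^+ m * cm (dft n f k) * s ^+ m) ?mulrA //; ring.
have kp : 0 < (`|k|%N)%:R ^+ m :> R by rewrite exprn_gt0.
rewrite -(ler_pM2l kp); apply: le_trans h4 _.
rewrite [leLHS](_ : _ = K%:R * (m`!%:R * K%:R ^+ m)); last by ring.
rewrite [leRHS](_ : _ = K%:R * ((`|k|%N)%:R ^+ m * 2^-1 ^+ m)); last by ring.
rewrite ler_wpM2l // -exprMn; apply: (@le_trans _ _ ((m%:R * K%:R) ^+ m)).
  rewrite exprMn ler_wpM2r ?exprn_ge0 // -natrX ler_nat.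
  elim: (m) => [//|m' IH]; rewrite factS expnS leq_mul //.
  by apply: leq_trans IH _; case: (m') => [//|m'']; rewrite leq_exp2r.
apply: lerXn2r; rewrite ?nnegrE ?mulr_ge0 ?invr_ge0 //.
by rewrite ler_pdivlMr // -!natrM ler_nat -mulnA (mulnC K).
Qed.

Let c : R := ln 2 / (2 * K%:R).

Let c0 : 0 < c.
Proof. by rewrite divr_gt0 ?mulr_gt0 // ln_gt0 // ltr1n. Qed.

Lemma dft_exp_decay n k : (`|k| <= n)%N ->
  cm (dft n f k) <= 2 * K%:R * expR (- (c * (`|k|%N)%:R)).
Proof.
move=> kn; apply: le_trans (dft_decay kn) _.
rewrite (mulrC 2) -mulrA ler_wpM2l //; set q := (_ %/ _)%N.
have l2 : 0 <= ln 2 :> R by rewrite ln_ge0 // ler1n.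
have e2 : expR (ln 2) = 2 :> R by rewrite lnK // posrE.
rewrite -[X in X^-1 ^+ _]e2 -[X in _ <= X * _]e2 -expRN -expRM_natl -expRD ler_expR.
have hq : (`|k|%N)%:R <= (q.+1)%:R * (2 * K%:R) :> R.
  by rewrite -!natrM ler_nat ltnW // ltn_ceil //; lia.
have : c * (`|k|%N)%:R <= ln 2 * (q.+1)%:R.
  by rewrite /c mulrAC ler_pdivrMr ?mulr_gt0 // -mulrA ler_wpM2l.
rewrite (_ : q.+1%:R = q%:R + 1); last by rewrite natr1.
by rewrite mulrDr mulr1; lra.
Qed.

Let z : R := expR (- (c / 2)).
Let L : R := 2 * K%:R * (2 * pi) * (2 / c) * (1 + 2 * z / (1 - z)).

Let z01 : 0 <= z < 1.
Proof. by rewrite expR_ge0 /= /z -[ltRHS]expR0 ltr_expR oppr_lt0 divr_gt0. Qed.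

Let L0 : 0 <= L.
Proof.
have /andP[z0 z1] := z01.
rewrite !mulr_ge0 ?pi_ge0 ?addr_ge0 ?mulr_ge0 ?invr_ge0 ?subr_ge0 // ltW //.
Qed.

Lemma interp_lipschitz n x y : cm (ev (interp n f) x - ev (interp n f) y) <= L * `|x - y|.
Proof.
rewrite /ev -sumrB !big_map; apply: le_trans (cm_sum _ _ _) _.
apply: (@le_trans _ _ (\sum_(k <- irange n)
    2 * K%:R * (2 * pi) * (2 / c) * `|x - y| * z ^+ `|k|)); last first.
  rewrite -mulr_sumr /L [leRHS]mulrAC ler_wpM2l ?sum_geometric_irange //.
  by rewrite !mulr_ge0 ?pi_ge0 ?invr_ge0 // ltW.
rewrite big_seq [leRHS]big_seq; apply: ler_sum => k; rewrite mem_irange => kn /=.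
rewrite -mulrBr cmM.
have e1 := dft_exp_decay kn.
have e2 := cexpB_le (k%:~R * x) (k%:~R * y).
rewrite -mulrBr normrM -intr_norm -abszE in e2.
have zk : z ^+ `|k| = expR (- (c / 2 * (`|k|%N)%:R)) by rewrite -expRM_natl mulrN mulrC.
have e3 : (`|k|%N)%:R * expR (- (c * (`|k|%N)%:R)) <= 2 / c * z ^+ `|k|.
  have h := expR_ge1Dx (c / 2 * (`|k|%N)%:R).
  have -> : expR (- (c * (`|k|%N)%:R)) = z ^+ `|k| * z ^+ `|k|.
    by rewrite zk -expRD; congr expR; field.
  rewrite mulrA ler_wpM2r ?zk ?expR_ge0 // expRN ler_pdivrMr ?expR_gt0 //.
  apply: (@le_trans _ _ (2 / c * (c / 2 * (`|k|%N)%:R))).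
    by apply: eq_ler; field; rewrite gt_eqF.
  apply: ler_wpM2l; first by rewrite divr_ge0 // ltW.
  by apply: le_trans h; rewrite lerDr.
apply: (@le_trans _ _ (2 * K%:R * expR (- (c * (`|k|%N)%:R)) * (2 * pi * ((`|k|%N)%:R * `|x - y|)))).
  by rewrite ler_pM ?cm_ge0.
rewrite [leLHS](_ : _ = 2 * K%:R * (2 * pi) * `|x - y| *
   ((`|k|%N)%:R * expR (- (c * (`|k|%N)%:R)))); last by ring.
rewrite [leRHS](_ : _ = 2 * K%:R * (2 * pi) * `|x - y| * (2 / c * z ^+ `|k|)); last by ring.
by rewrite ler_wpM2l // !mulr_ge0 ?pi_ge0.
Qed.

Lemma ev_periodic (s : tpoly R) x : ev s (x + 1) = ev s x.
Proof.
rewrite /ev; apply: eq_bigr => p _; congr (_ * _).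
by rewrite mulrDr mulr1 cexpD cexp_int mulr1.
Qed.

(** The function and its interpolant agree on the grid and are both Lipschitz at the scale of a grid
    cell, with constants independent of [n]. The rate 1/M is slow but sufficient, as refining the
    grid does not spoil the decay of the coefficients. *)
Lemma interp_close n x : (K <= M n)%N ->
  cm (ev (interp n f) x - (f x)%:C%C) <= (L + K%:R ^+ 2) / (M n)%:R.
Proof.
move=> KM; move: x; apply: periodic_reduce => [x|x /andP[x0 x1]].
  by rewrite ev_periodic pf.
set l := Num.truncn (x * (M n)%:R).
have xM0 : 0 <= x * (M n)%:R by rewrite mulr_ge0.
have l1 : l%:R <= x * (M n)%:R by rewrite truncn_le.
have l2 : x * (M n)%:R < l%:R + 1 by rewrite natr1 truncnS_gt.
have lM : (l <= M n)%N.
  by rewrite -(ler_nat R); apply: le_trans l1 _; rewrite ler_piMl.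
set y : R := l%:R / (M n)%:R.
have yx : 0 <= x - y.
  by rewrite subr_ge0 ler_pdivrMr.
have xy : x - y <= (M n)%:R^-1.
  rewrite lerBlDr -[X in X + _]mul1r -mulrDl ler_pdivlMr // addrC; exact: ltW.
have ey : ev (interp n f) y = (f y)%:C%C.
  move: lM; rewrite leq_eqVlt => /orP[/eqP lM|lM]; last exact: interp_grid.
  rewrite /y lM divff // -(add0r 1) ev_periodic pf.
  by have := @interp_grid n f 0 isT; rewrite mul0r.
have fx : `|f x - f y| <= K%:R ^+ 2 / (M n)%:R.
  have h : 1%:R * (x - y) <= K%:R^-1.
    by rewrite mul1r; apply: le_trans xy _; rewrite lef_pV2 ?posrE // ler_nat.
  have := bf y yx h; rewrite /fdiffn /= /fdiff (_ : y + (x - y) = x); last by rewrite addrC subrK.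
  rewrite factS fact0 muln1 mulr1 expr1.
  move=> g; apply: le_trans g _; rewrite mulrA expr2 ler_wpM2l // mulr_ge0 //.
rewrite -(subrK (ev (interp n f) y) (ev (interp n f) x)) -addrA; apply: le_trans (cmD _ _) _.
rewrite mulrDl; apply: lerD.
  apply: le_trans (interp_lipschitz _ _ _) _; rewrite ler_wpM2l //.
  by rewrite ger0_norm.
by rewrite ey -rmorphB cmR distrC.
Qed.

End Decay.

Lemma trig_approx f : real_analytic f -> (forall x, f (x + 1) = f x) ->
  exists A c : R, [/\ 0 < A, 0 < c & forall tau, 0 < tau -> exists n,
    (forall x, cm (ev (interp n f) x - (f x)%:C%C) <= tau) /\
    (forall k, (`|k| <= n)%N -> cm (dft n f k) <= A * expR (- (c * (`|k|%N)%:R)))].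
Proof.
move=> af pf; have [K [K0 bf]] := analytic_fdiffn af pf.
have KR : 0 < K%:R :> R by rewrite ltr0n.
exists (2 * K%:R), (ln 2 / (2 * K%:R)); split=> [||tau tau0].
- by rewrite mulr_gt0.
- by rewrite divr_gt0 ?mulr_gt0 // ln_gt0 // ltr1n.
have [L hL] : exists L, forall n x, (K <= (M n))%N ->
    cm (ev (interp n f) x - (f x)%:C%C) <= L / (M n)%:R.
  by eexists => n x; exact: (interp_close pf K0 bf).
pose N := (Num.truncn (L / tau)).+1; exists (N + K)%N; split=> [x|k]; last exact: dft_exp_decay.
apply: le_trans (hL _ _ _) _; first by lia.
rewrite ler_pdivrMr // mulrC -ler_pdivrMr //; apply/ltW/(lt_le_trans (truncnS_gt _)).
rewrite ler_nat /N; move: (Num.truncn _) => t; clear; lia.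
Qed.

End Interpolation.

(** * The mean of a trigonometric polynomial *)

Section ZeroMean.
Variable R : realType.
Local Notation C := R[i].

Lemma ReD (u v : C) : complex.Re (u + v) = complex.Re u + complex.Re v.
Proof. by case: u v => [? ?] []. Qed.

Lemma is_derive_linear (w x : R) : is_derive x (1 : R) (fun y : R => w * y) w.
Proof.
have d : is_derive x (1 : R) (w \*: (id : R -> R)) (w *: (1 : R)).
  exact: is_deriveZ (is_derive_id x (1 : R)).
by rewrite /GRing.scale /= mulr1 in d.
Qed.

Lemma trig_antiderivative (a : C) (k : int) : exists F : R -> R,
  (forall x : R, is_derive x (1 : R) F (complex.Re (a * cexp2pi (k%:~R * x)))) /\
  F 1 - F 0 = if k == 0 then complex.Re a else 0.
Proof.
pose w : R := 2 * pi * k%:~R.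
have ReE x : complex.Re (a * cexp2pi (k%:~R * x)) =
    complex.Re a * cos (w * x) - complex.Im a * sin (w * x).
  by rewrite /cexp2pi (mulrA (2 * pi) k%:~R x) -/w; case: a.
have [k0|k0] := eqVneq k 0.
  exists (fun x => complex.Re a * x); split=> [x|]; last by rewrite mulr1 mulr0 subr0.
  rewrite ReE /w k0 mulr0 mul0r cos0 sin0 mulr1 mulr0 subr0.
  exact: is_derive_linear.
have kR : k%:~R != 0 :> R by rewrite intr_eq0.
have p0 : pi != 0 :> R by rewrite gt_eqF // pi_gt0.
have w0 : w != 0 by rewrite /w !mulf_neq0 // pnatr_eq0.
exists (fun x => complex.Re a / w * sin (w * x) + complex.Im a / w * cos (w * x)); split=> [x|].
  have d := is_derive_linear w x.
  have ds := is_derive1_comp (is_derive_sin (w * x)) d.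
  have dc := is_derive1_comp (is_derive_cos (w * x)) d.
  rewrite ReE.
  have h := is_deriveD (is_deriveZ (complex.Re a / w) ds) (is_deriveZ (complex.Im a / w) dc).
  by apply: (is_derive_eq h); rewrite /GRing.scale /=; field.
have e : cexp2pi (k%:~R : R) = 1 by exact: cexp_int.
have ec : cos w = 1 by move: e; rewrite /cexp2pi /w; case.
have es : sin w = 0 by move: e; rewrite /cexp2pi /w; case.
by rewrite !mulr1 !mulr0 ec es cos0 sin0 !mulr0 subrr.
Qed.

Lemma tpoly_antiderivative (s : tpoly R) : exists F : R -> R,
  (forall x : R, is_derive x (1 : R) F (complex.Re (ev s x))) /\ F 1 - F 0 = complex.Re (coef 0 s).
Proof.
elim: s => [|[a k] s [F [dF eF]]].
  exists (fun=> 0); rewrite subrr /coef big_nil; split=> // x.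
  by rewrite /ev big_nil; exact: is_derive_cst.
have [G [dG eG]] := trig_antiderivative a k.
exists (G + F); split=> [x|].
  have := is_deriveD (dG x) (dF x).
  by rewrite -ReD /ev big_cons.
rewrite /coef big_cons /= (_ : (G + F) 1 - (G + F) 0 = (G 1 - G 0) + (F 1 - F 0)); last first.
  by rewrite /= opprD addrACA.
by rewrite eF eG /coef; case: (k == 0); rewrite ?ReD ?add0r.
Qed.

Lemma ev_continuous (s : tpoly R) : continuous (fun x => complex.Re (ev s x)).
Proof.
elim: s => [|[a k] s IH].
  by under [fun p => _]eq_fun do rewrite /ev big_nil; move=> x; exact: cvg_cst.
have h : ccont (fun x : R => a * cexp2pi (k%:~R * x)).
  apply: ccontM; first exact: ccont_cst.
  have hk : continuous (fun x : R => 2 * pi * (k%:~R * x)).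
    by move=> x; apply: cvgM; [exact: cvg_cst | apply: cvgM; [exact: cvg_cst | exact: cvg_id]].
  split=> x.
    exact: (@continuous_comp _ _ _ _ (@cos R) _ (hk x) (@continuous_cos R _)).
  exact: (@continuous_comp _ _ _ _ (@sin R) _ (hk x) (@continuous_sin R _)).
rewrite (_ : (fun _ => _) = (fun x => complex.Re (a * cexp2pi (k%:~R * x)) + complex.Re (ev s x))).
  by move=> x; apply: cvgD; [exact: h.1 | exact: IH].
by apply/funext => x; rewrite -ReD /ev big_cons.
Qed.

Lemma integral_tpoly (s : tpoly R) (b : R) :
  (\int[lebesgue_measure]_(x in `[0%R, 1%R]) (complex.Re (ev s x) + b)%:E =
   (complex.Re (coef 0 s) + b)%:E)%E.
Proof.
have [F [dF eF]] := tpoly_antiderivative s.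
pose G x := F x + b * x.
have dG (x : R) : is_derive x (1 : R) G (complex.Re (ev s x) + b).
  have d := is_derive_linear b x.
  exact: is_deriveD (dF x) d.
have cG : continuous G.
  by move=> x; apply: differentiable_continuous; apply/derivable1_diffP; exact: ex_derive.
rewrite (@continuous_FTC2 _ _ G) //.
- by rewrite -EFinB /G mulr1 mulr0 addr0 -eF; congr EFin; ring.
- apply: continuous_subspaceT => x; apply: cvgD; [exact: ev_continuous | exact: cvg_cst].
- split=> [x _||].
  + exact: ex_derive.
  + exact/cvg_at_right_filter/cG.
  + exact/cvg_at_left_filter/cG.
by move=> x _; rewrite derive1E; exact: derive_val.
Qed.

Lemma analytic_continuous (f : R -> R) : real_analytic f -> (forall x, f (x + 1) = f x) ->
  continuous f.
Proof.
move=> af pf; have [K [K0 bf]] := analytic_fdiffn af pf.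
have KR : 0 < K%:R :> R by rewrite ltr0n.
have lip x y : 0 <= y - x -> y - x <= K%:R^-1 -> `|f y - f x| <= K%:R ^+ 2 * (y - x).
  move=> xy h; have h1 : 1%:R * (y - x) <= K%:R^-1 by rewrite mul1r.
  have := bf _ _ x xy h1; rewrite /fdiffn /= /fdiff (_ : x + (y - x) = y); last by rewrite addrC subrK.
  by rewrite factS fact0 muln1 mulr1 expr1 mulrA expr2.
have lip2 x y : `|y - x| <= K%:R^-1 -> `|f y - f x| <= K%:R ^+ 2 * `|y - x|.
  have [h|h] := leP 0 (y - x); first by rewrite ger0_norm //; exact: lip.
  rewrite ltr0_norm // opprB => g; rewrite distrC; apply: lip => //.
  by rewrite -opprB oppr_ge0 ltW.
move=> x; apply/cvgrPdist_le => e e0; near=> y.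
have xy1 : `|x - y| <= K%:R^-1.
  by near: y; apply: cvgr_dist_le; [exact: cvg_id | rewrite invr_gt0].
have xy2 : `|x - y| <= e / K%:R ^+ 2.
  by near: y; apply: cvgr_dist_le; [exact: cvg_id | rewrite divr_gt0 // exprn_gt0].
apply: le_trans (lip2 _ _ xy1) _.
by rewrite -ler_pdivlMl ?exprn_gt0 // mulrC.
Unshelve. all: by end_near.
Qed.

(** The integral of [Re (ev s)] over a period is [Re (coef 0 s)], and integration is monotone. It
    controls the zero frequency, which no difference [g(x + alpha) - g(x)] of a trigonometric
    polynomial contains. *)
Lemma zero_mean_coef (f : R -> R) (s : tpoly R) tau :
  real_analytic f -> (forall x, f (x + 1) = f x) ->
  (\int[lebesgue_measure]_(x in `[0%R, 1%R]) (f x)%:E = 0)%E ->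
  (forall x, cm (ev s x - (f x)%:C%C) <= tau) -> `|complex.Re (coef 0 s)| <= tau.
Proof.
move=> af pf f0 close; have cf := analytic_continuous af pf.
have rc x : `|complex.Re (ev s x) - f x| <= tau.
  apply: le_trans (close x); apply: le_trans (cm_Re _).
  by case: (ev s x).
have cs b : continuous (fun x => complex.Re (ev s x) + b).
  by move=> x; apply: cvgD; [exact: ev_continuous | exact: cvg_cst].
have int (g : R -> R) : continuous g ->
    (@lebesgue_measure R).-integrable `[(0 : R), 1]%classic (EFin \o g).
  move=> cg; apply: continuous_compact_integrable; first exact: segment_compact.
  exact: continuous_subspaceT.
rewrite ler_norml; apply/andP; split.
  have : (\int[lebesgue_measure]_(x in `[0%R, 1%R]) (f x)%:E <=
      \int[lebesgue_measure]_(x in `[0%R, 1%R]) (complex.Re (ev s x) + tau)%:E)%E.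
    apply: le_integral; [by [] | exact: int | exact: int |].
    move=> x _; rewrite lee_fin; have := rc x; rewrite ler_norml => /andP[h1 h2]; lra.
  by rewrite f0 integral_tpoly lee_fin; lra.
have : (\int[lebesgue_measure]_(x in `[0%R, 1%R]) (complex.Re (ev s x) + (- tau))%:E <=
    \int[lebesgue_measure]_(x in `[0%R, 1%R]) (f x)%:E)%E.
  apply: le_integral; [by [] | exact: int | exact: int |].
  move=> x _; rewrite lee_fin; have := rc x; rewrite ler_norml => /andP[h1 h2]; lra.
by rewrite f0 integral_tpoly lee_fin; lra.
Qed.

End ZeroMean.

(** * Good denominators of an irrational number *)

Section Diophantine.
Variables (R : realType) (alpha : R).
Hypothesis irr : forall q : rat, alpha != ratr q.

Definition int_dist (x : R) : R :=
  Num.min (x - (Num.floor x)%:~R) ((Num.floor x)%:~R + 1 - x).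

Lemma int_dist_le x (p : int) : int_dist x <= `|x - p%:~R|.
Proof.
have := floor_itv x; rewrite intrD /int_dist => /andP[f1 f2].
have [pf|pf] := lerP p (Num.floor x).
  have pR : p%:~R <= (Num.floor x)%:~R :> R by rewrite ler_int.
  by rewrite ge_min; apply/orP; left; apply: le_trans (ler_norm _); lra.
have pR : (Num.floor x)%:~R + 1 <= p%:~R :> R by rewrite -[1]/(1%:~R) -intrD ler_int lezD1.
by rewrite ge_min distrC; apply/orP; right; apply: le_trans (ler_norm _); lra.
Qed.

Lemma int_distE x : exists p : int, int_dist x = `|x - p%:~R|.
Proof.
have := floor_itv x; rewrite intrD => /andP[f1 f2].
rewrite /int_dist /Num.min; case: ifP => _.
  by exists (Num.floor x); rewrite ger0_norm // subr_ge0.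
exists (Num.floor x + 1); rewrite intrD distrC ger0_norm // subr_ge0; exact: ltW.
Qed.

Lemma irrational_neq0 (k p : int) : k != 0 -> k%:~R * alpha - p%:~R != 0.
Proof.
move=> k0; rewrite subr_eq0; apply/eqP => h.
have /eqP := irr (p%:~R / k%:~R); apply; rewrite fmorph_div /= !ratr_int -h mulrC mulKf //.
by rewrite intr_eq0.
Qed.

Lemma dirichlet (N : nat) : (0 < N)%N -> exists (k : nat) (p : int),
  (0 < k)%N /\ `|k%:R * alpha - p%:~R| < N%:R^-1.
Proof.
case: N => // N _; set M := N.+1.
have MR : 0 < M%:R :> R by rewrite ltr0n.
pose fr (j : nat) : R := j%:R * alpha - (Num.floor (j%:R * alpha))%:~R.
have fr0 j : 0 <= fr j < 1.
  by have := floor_itv (j%:R * alpha); rewrite intrD /fr => /andP[h1 h2]; apply/andP; split; lra.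
pose box (j : 'I_M.+1) : 'I_M := inord (Num.truncn (M%:R * fr j)).
have boxE (j : 'I_M.+1) : Num.truncn (M%:R * fr j) = box j :> nat.
  rewrite inordK // truncn_lt_nat; last by rewrite mulr_ge0 //; case/andP: (fr0 j).
  by rewrite gtr_pMr //; case/andP: (fr0 j).
have /injectivePn [i [j ij bij]] : ~~ injectiveb box.
  by apply/negP => /injectiveP /leq_card; rewrite !card_ord ltnn.
wlog lt_ij : i j ij bij / (i < j)%N => [h|].
  have := ij; rewrite -val_eqE neq_ltn => /orP[|] /= h1; first exact: (h i j).
  by apply: (h j i) => //; rewrite eq_sym.
exists (j - i)%N, (Num.floor (j%:R * alpha) - Num.floor (i%:R * alpha)); split; first by rewrite subn_gt0.
have -> : (j - i)%N%:R * alpha - (Num.floor (j%:R * alpha) - Num.floor (i%:R * alpha))%:~R = fr j - fr i.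
  by rewrite natrB 1?ltnW // intrB /fr; ring.
have b (l : 'I_M.+1) : (box l)%:R <= M%:R * fr l < (box l)%:R + 1.
  rewrite -boxE natr1 truncnS_gt truncn_le.
  by rewrite mulr_ge0 //; case/andP: (fr0 l).
have /andP[b1 b2] := b i; have /andP[b3 b4] := b j; rewrite -bij in b3 b4.
rewrite -(ltr_pM2l MR) divff ?gt_eqF // -[X in X * _]ger0_norm ?(ltW MR) // -normrM.
by rewrite ltr_norml mulrBr; apply/andP; split; lra.
Qed.

(* If delta is the least distance to the integers up to q', and q is the first index with a smaller
   distance, then the fractions p / q and p' / q' are distinct, whence 1 <= q' delta + q delta. *)
Lemma irrational_denominator (Q : nat) : exists q : nat, (Q < q)%N /\
  forall k p : int, (0 < `|k| < q)%N -> (2 * q%:R)^-1 <= `|k%:~R * alpha - p%:~R|.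
Proof.
pose nd (k : nat) := int_dist (k%:R * alpha).
have nd0 k : (0 < k)%N -> 0 < nd k.
  move=> k0; rewrite /nd; have [p ->] := int_distE (k%:R * alpha).
  by rewrite normr_gt0 (irrational_neq0 (k := k)) //; lia.
pose q0 := [arg min_(k < (ord0 : 'I_Q.+1)) nd k.+1]%O.
have hq0 (k : 'I_Q.+1) : nd q0.+1 <= nd k.+1.
  by rewrite /q0; case: arg_minP => // i _; apply.
set q' := q0.+1 in hq0; have d0 : 0 < nd q' by exact: nd0.
have [N hN] : exists N : nat, (nd q')^-1 < N%:R.
  by exists (Num.truncn (nd q')^-1).+1; exact: truncnS_gt.
have N0 : (0 < N)%N.
  by rewrite -(ltr_nat R); apply: lt_trans hN; rewrite invr_gt0.
have ex : exists k, (0 < k)%N && (nd k < nd q').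
  have [k [p [k0 hk]]] := dirichlet N0; exists k; rewrite k0 /=.
  apply: le_lt_trans (int_dist_le _ p) _; apply: lt_trans hk _.
  by rewrite -[ltRHS]invrK ltf_pV2 // posrE ?invr_gt0 ?ltr0n.
case: (ex_minnP ex) => q /andP[qp qd] qmin; exists q.
have qQ : (Q.+1 < q)%N.
  rewrite ltnNge; apply/negP => qle.
  have qi : (q.-1 < Q.+1)%N by lia.
  by have := hq0 (Ordinal qi); rewrite /= prednK // leNgt qd.
split; first by lia.
have q'q : (q' < q)%N by apply: leq_ltn_trans (ltn_ord q0) qQ.
have nle (k : nat) : (0 < k < q)%N -> nd q' <= nd k.
  move=> /andP[k0 kq]; rewrite leNgt; apply/negP => h.
  by have := qmin k; rewrite k0 h => /(_ isT); lia.
have low : (2 * q%:R)^-1 <= nd q'.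
  have [p hp] := int_distE (q%:R * alpha); have [p' hp'] := int_distE (q'%:R * alpha).
  have qR : 0 < q%:R :> R by rewrite ltr0n.
  have q'R : 0 < q'%:R :> R by rewrite ltr0n.
  have q'qR : q'%:R <= q%:R :> R by rewrite ler_nat ltnW.
  rewrite -/(nd q) in hp; rewrite -/(nd q') in hp'.
  set a := q%:R * alpha - p%:~R in hp; set b := q'%:R * alpha - p'%:~R in hp'.
  have eab : q'%:R * a - q%:R * b = (q%:Z * p' - q'%:Z * p)%:~R.
    by rewrite intrB !intrM /a /b -!pmulrn; ring.
  have n0 : q%:Z * p' - q'%:Z * p != 0.
    apply/eqP => e0; rewrite e0 in eab; move: eab => /eqP; rewrite subr_eq0 => /eqP eab.
    have : q'%:R * `|a| = q%:R * `|b|.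
      by rewrite -[X in X * _]ger0_norm ?(ltW q'R) // -normrM eab normrM ger0_norm // ltW.
    rewrite -hp -hp' => e1.
    have : q'%:R * nd q < q%:R * nd q'.
      by apply: (@lt_le_trans _ _ (q'%:R * nd q')); [rewrite ltr_pM2l | rewrite ler_wpM2r // ltW].
    by rewrite e1 ltxx.
  have one : 1 <= `|q'%:R * a - q%:R * b|.
    by rewrite eab -intr_norm -[1]/(1%:~R) ler_int -gtz0_ge1 normr_gt0.
  have up : `|q'%:R * a - q%:R * b| <= q'%:R * nd q + q%:R * nd q'.
    apply: le_trans (ler_normB _ _) _.
    by rewrite !normrM -hp -hp' !ger0_norm // ltW.
  have up2 : q'%:R * nd q + q%:R * nd q' <= 2 * q%:R * nd q'.
    rewrite [leRHS](_ : _ = q%:R * nd q' + q%:R * nd q'); last by ring.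
    rewrite lerD2r ler_pM // ltW //; exact: nd0.
  by rewrite -div1r ler_pdivrMr ?mulr_gt0 // mulrC; lra.
move=> k p hk; apply: le_trans low _; apply: le_trans (nle `|k|%N hk) _.
case: (intP k) hk => [//|n|n] _; first exact: int_dist_le.
by rewrite mulrNz mulNr -opprD normrN -[p%:~R]opprK -intrN; exact: int_dist_le.
Qed.

End Diophantine.

Lemma sum_pred1_uniq (V : nmodType) (I : eqType) (r : seq I) i (F : I -> V) :
  uniq r -> i \in r -> \sum_(j <- r | j == i) F j = F i.
Proof. by move=> ur ir; rewrite -big_filter filter_pred1_uniq // big_seq1. Qed.

Lemma coef_conj (R : realType) n (s : tpoly R) : coef n (tconj s) = conjc (coef (- n) s).
Proof.
rewrite /coef big_map rmorph_sum /=; apply: eq_bigl => p.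
by rewrite eqr_oppLR.
Qed.

Lemma coef_vpoly (R : realType) d (vhat : int -> R[i]) (n : int) : (`|n| <= d)%N ->
  coef n (vpoly d vhat) = vhat n.
Proof.
move=> nd; rewrite /coef big_map.
have e (k : nat) : (k%:Z - d%:Z == n) = (k == absz (n + d%:Z)) by apply/eqP/eqP; lia.
rewrite (eq_bigl (pred1 (absz (n + d%:Z)))); last exact: e.
rewrite sum_pred1_uniq ?iota_uniq //; first by rewrite /=; congr vhat; lia.
by rewrite mem_iota; lia.
Qed.

(** The difference between v and its conjugate vanishes as a function, so its coefficients vanish by
    [cm_coef_sup]. *)
Lemma vhat_conj (R : realType) d (vhat : int -> R[i]) :
  (forall x : R, complex.Im (trig_sum d vhat x) = 0) ->
  forall k : nat, (k <= d)%N -> vhat (- k%:Z) = conjc (vhat k%:Z).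
Proof.
move=> real k kd; pose V := vpoly d vhat.
have : cm (coef (- k%:Z) (V ++ tscale (- 1) (tconj V))) <= 0.
  apply: cm_coef_sup => x; rewrite ev_cat ev_scale ev_conj ev_vpoly.
  have := real x; case: (trig_sum d vhat x) => a b /= ->.
  by rewrite oppr0 mulN1r subrr cm0.
rewrite le_eqVlt ltNge cm_ge0 orbF cm_eq0 coef_cat coef_scale coef_conj opprK.
by rewrite !coef_vpoly ?abszN ?absz_nat // mulN1r subr_eq0 => /eqP.
Qed.

Lemma irange_uniq n : uniq (irange n).
Proof.
elim: n => [//|n IH]; rewrite /= inE !mem_irange IH andbT.
by apply/andP; split; lia.
Qed.

(** * The cohomological equation truncated at a denominator *)

Section Primitive.
Variables (R : realType) (f : R -> R).
Local Notation C := R[i].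

Lemma coef_interp n (k : int) : (`|k| <= n)%N -> coef k (interp n f) = dft n f k.
Proof.
by move=> kn; rewrite /coef big_map sum_pred1_uniq ?irange_uniq ?mem_irange.
Qed.

Lemma dft0_real n : cm (dft n f 0) = `|complex.Re (dft n f 0)|.
Proof.
have -> : dft n f 0 = ((\sum_(j < (2 * n).+1) f (j%:R / (2 * n).+1%:R)) / (2 * n).+1%:R)%:C%C.
  rewrite rmorphM fmorphV rmorph_nat rmorph_sum /=; congr (_ / _).
  by apply: eq_bigr => j _; rewrite mul0r oppr0 cexp0 mulr1.
by rewrite cmR.
Qed.

Variables (A c : R).
Hypothesis A0 : 0 < A.
Hypothesis c0 : 0 < c.

Let z c' : R := expR (- c').
Let zX c' k : z c' ^+ k = expR (- (c' * k%:R)).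
Proof. by rewrite -expRM_natl mulrN mulrC. Qed.
Let z01 c' : 0 < c' -> 0 <= z c' < 1.
Proof. by move=> c'0; rewrite expR_ge0 /= -[ltRHS]expR0 ltr_expR oppr_lt0. Qed.
Let S c' : R := 1 + 2 * z c' / (1 - z c').
Let S_ge0 c' : 0 < c' -> 0 <= S c'.
Proof.
move=> h; have /andP[h1 h2] := z01 h.
by rewrite addr_ge0 // !mulr_ge0 // invr_ge0 subr_ge0 ltW.
Qed.

Lemma wnorm_interp n c' :
  (forall k, (`|k| <= n)%N -> cm (dft n f k) <= A * expR (- (c * (`|k|%N)%:R))) ->
  c' < c -> wnorm c' (interp n f) <= A * S (c - c').
Proof.
move=> hd cc; rewrite /wnorm big_map.
apply: (@le_trans _ _ (\sum_(k <- irange n) A * z (c - c') ^+ `|k|)); last first.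
  rewrite -mulr_sumr ler_wpM2l ?(ltW A0) //; apply: sum_geometric_irange.
  by apply: z01; rewrite subr_gt0.
rewrite big_seq [leRHS]big_seq; apply: ler_sum => k; rewrite mem_irange => kn /=.
apply: le_trans (ler_wpM2r (expR_ge0 _) (hd k kn)) _.
rewrite -mulrA -expRD zX; apply: eq_ler; congr (_ * expR _); ring.
Qed.

Variables (alpha : R) (q : nat).
Hypothesis c1 : forall k p : int, (0 < `|k| < q)%N -> (2 * q%:R)^-1 <= `|k%:~R * alpha - p%:~R|.

(* Solves g(x + alpha) - g(x) = f(x) on the frequencies 0 < |k| < q. *)
Definition primitive n : tpoly R :=
  [seq (dft n f k / (cexp2pi (k%:~R * alpha) - 1), k) | k <- irange n & (0 < `|k| < q)%N].

Lemma divisor_ge (k : int) : (0 < `|k| < q)%N ->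
  (2 * q%:R)^-1 <= cm (cexp2pi (k%:~R * alpha) - 1).
Proof.
move=> hk; have [p hp] := int_distE (k%:~R * alpha).
have h2 : `|k%:~R * alpha - p%:~R| <= 2^-1.
  rewrite -hp /int_dist; have := floor_itv (k%:~R * alpha); rewrite intrD => /andP[f1 f2].
  rewrite ge_min; case: (leP (k%:~R * alpha - (Num.floor (k%:~R * alpha))%:~R) 2^-1) => //= h.
  by apply: ltW; lra.
have -> : cexp2pi (k%:~R * alpha) = cexp2pi (k%:~R * alpha - p%:~R).
  by rewrite cexpD -intrN cexp_int mulr1.
exact: le_trans (c1 p hk) (cexpB1_ge h2).
Qed.

Lemma divisor_neq0 (k : int) : (0 < `|k| < q)%N -> cexp2pi (k%:~R * alpha) - 1 != 0.
Proof.
move=> hk; rewrite -cm_gt0; apply: lt_le_trans (divisor_ge hk).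
by rewrite invr_gt0 mulr_gt0 // ltr0n; lia.
Qed.

(** What remains is the zero frequency and the frequencies with [|k| >= q]. For the latter half of
    the decay is spent on [exp(- c q / 2)] and the other half on summation. *)
Lemma primitive_diff n x : (forall k, (`|k| <= n)%N -> cm (dft n f k) <= A * expR (- (c * (`|k|%N)%:R))) ->
  cm (ev (primitive n) (x + alpha) - ev (primitive n) x - ev (interp n f) x) <=
    cm (dft n f 0) + A * S (c / 2) * expR (- (c / 2 * q%:R)).
Proof.
move=> hd.
have -> : ev (primitive n) (x + alpha) - ev (primitive n) x - ev (interp n f) x =
   - \sum_(k <- irange n | ~~ (0 < `|k| < q)%N) dft n f k * cexp2pi (k%:~R * x).
  have -> : ev (primitive n) (x + alpha) - ev (primitive n) x =
      \sum_(k <- irange n | (0 < `|k| < q)%N) dft n f k * cexp2pi (k%:~R * x).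
    rewrite /ev !big_map !big_filter -sumrB; apply: eq_bigr => k /divisor_neq0 hk /=.
    by rewrite mulrDr cexpD; field.
  have -> : ev (interp n f) x = \sum_(k <- irange n) dft n f k * cexp2pi (k%:~R * x).
    by rewrite /ev big_map.
  by rewrite [X in _ - X](bigID (fun k : int => (0 < `|k| < q)%N)) /= opprD addrA subrr sub0r.
rewrite cmN; apply: le_trans (cm_sum _ _ _) _.
set e := expR (- (c / 2 * q%:R)).
apply: (@le_trans _ _ (\sum_(k <- irange n)
   ((if k == 0 then cm (dft n f 0) else 0) + A * e * z (c / 2) ^+ `|k|))).
  rewrite big_seq_cond [leRHS]big_seq.
  rewrite [leRHS](bigID (fun k : int => ~~ (0 < `|k| < q)%N)) /=.
  have pos k : 0 <= (if k == 0 then cm (dft n f 0) else 0) + A * e * z (c / 2) ^+ `|k|.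
    apply: addr_ge0; first by case: ifP => // _; exact: cm_ge0.
    by rewrite !mulr_ge0 ?exprn_ge0 ?expR_ge0 // ltW.
  apply: ler_wpDr; first by apply: sumr_ge0 => k _; exact: pos.
  apply: ler_sum => k; rewrite mem_irange => /andP[kn hk]; rewrite cmM cm_cexp mulr1.
  have [->|k0] := eqVneq k 0.
    by rewrite lerDl !mulr_ge0 ?exprn_ge0 ?expR_ge0 // ltW.
  rewrite add0r; apply: le_trans (hd k kn) _; rewrite zX -mulrA -expRD ler_wpM2l ?(ltW A0) //.
  rewrite ler_expR; have qk : q%:R <= (`|k|%N)%:R :> R by rewrite ler_nat; lia.
  have := ler_wpM2l (ltW c0) qk; lra.
rewrite big_split /= -big_mkcond /= sum_pred1_uniq ?irange_uniq ?mem_irange // lerD2l.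
rewrite -mulr_sumr [leRHS]mulrAC; apply: ler_wpM2l; first by rewrite mulr_ge0 ?expR_ge0 // ltW.
by apply: sum_geometric_irange; apply: z01; rewrite divr_gt0.
Qed.

End Primitive.

(** * Sublinear growth of the primitive *)

Section PrimitiveNorm.
Variables (R : realType) (alpha : R).

(* The divisors are at least 1 / (2 q); only boundedly many frequencies see them with a
   coefficient that is not small, so the norm is o(q). *)
Lemma primitive_small (A c e : R) : 0 < A -> 0 < c -> 0 < e ->
  exists Q : nat, forall q, (Q < q)%N ->
  (forall k p : int, (0 < `|k| < q)%N -> (2 * q%:R)^-1 <= `|k%:~R * alpha - p%:~R|) ->
  forall f n, (forall k, (`|k| <= n)%N -> cm (dft n f k) <= A * expR (- (c * (`|k|%N)%:R))) ->
  wnorm (c / 2) (primitive f alpha q n) <= e * q%:R.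
Proof.
(* The weight [exp(c |k| / 2)] times the decay [exp(- c |k|)] is [z ^ |k|] twice: one factor is
   summed into [S], the other is at most [z ^ k0] beyond [k0] and compensates the divisor bound
   [2 q]. *)
move=> A0 c0 e0; pose z := expR (- (c / 4)).
have z01 : 0 <= z < 1 by rewrite expR_ge0 /= -[ltRHS]expR0 ltr_expR oppr_lt0 divr_gt0.
pose S := 1 + 2 * z / (1 - z).
have S0 : 0 < S.
  have /andP[h1 h2] := z01; rewrite ltr_wpDr // !mulr_ge0 // invr_ge0 subr_ge0 ltW //.
have [||k0 /(_ k0 (leqnn _)) hk0] := @expR_neg_small _ (4 * A * S / e) (c / 4).
- by rewrite !mulr_ge0 // ?invr_ge0 ltW.
- by rewrite divr_gt0.
have zX k : z ^+ k = expR (- (c / 4 * k%:R)) by rewrite -expRM_natl mulrN mulrC.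
rewrite -zX in hk0.
have hz : 2 * A * S * z ^+ k0 <= e / 4.
  have h : 4 * A * S * z ^+ k0 <= e / 2.
    by rewrite -ler_pdivrMl // mulrA (mulrC e^-1); apply: hk0.
  lra.
pose D := \sum_(k <- irange k0) (cm (cexp2pi (k%:~R * alpha) - 1))^-1.
have D0 : 0 <= D by apply: sumr_ge0 => k _; rewrite invr_ge0 cm_ge0.
have [Q hQ] := nat_above (4 * (A * D * S) / e).
exists Q => q qQ c1 f n hd; rewrite /wnorm big_map big_filter.
have qR : 0 < q%:R :> R by rewrite ltr0n; exact: leq_ltn_trans qQ.
have bound (k : int) : (`|k| <= n)%N -> (0 < `|k| < q)%N ->
    cm (dft n f k / (cexp2pi (k%:~R * alpha) - 1)) * expR (c / 2 * (`|k|%N)%:R) <=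
    (A * D + A * z ^+ k0 * (2 * q%:R)) * z ^+ `|k|.
  move=> kn hk; rewrite cmM cmV.
  have dv := divisor_ge c1 hk; set w := cm (_ - 1) in dv *.
  have w0 : 0 < w by apply: lt_le_trans dv; rewrite invr_gt0 mulr_gt0.
  have wi : w^-1 <= 2 * q%:R by rewrite -[leRHS]invrK lef_pV2 ?posrE ?invr_gt0 // mulr_gt0.
  have h1 : cm (dft n f k) * expR (c / 2 * (`|k|%N)%:R) <= A * (z ^+ `|k| * z ^+ `|k|).
    apply: le_trans (ler_wpM2r (expR_ge0 _) (hd k kn)) _.
    rewrite !zX -(mulrA A) -!expRD; apply: eq_ler.
    by congr (_ * expR _); field.
  rewrite mulrAC; apply: le_trans (ler_wpM2r (ltW (_ : 0 < w^-1)) h1) _; first by rewrite invr_gt0.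
  have /andP[z0 z1] := z01.
  have zk0 : 0 <= z ^+ `|k| by exact: exprn_ge0.
  rewrite [leLHS](_ : _ = A * (z ^+ `|k| * w^-1) * z ^+ `|k|); last by ring.
  rewrite ler_wpM2r // -mulrA -mulrDr ler_wpM2l ?(ltW A0) //.
  have [kk|kk] := leqP `|k| k0.
    apply: ler_wpDr; first by rewrite mulr_ge0 ?exprn_ge0 // mulr_ge0 // ltW.
    apply: (@le_trans _ _ w^-1).
      by rewrite ler_piMl ?invr_ge0 ?(ltW w0) // exprn_ile1 // ltW.
    rewrite /D (bigD1_seq k) ?irange_uniq ?mem_irange //= lerDl.
    by apply: sumr_ge0 => l _; rewrite invr_ge0 cm_ge0.
  apply: ler_wpDl => //; apply: ler_pM => //; first by rewrite invr_ge0 ltW.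
  by apply: ler_wiXn2l; [| exact: ltW | exact: ltnW].
have B0 : 0 <= A * D + A * z ^+ k0 * (2 * q%:R).
  have /andP[z0 _] := z01.
  by rewrite addr_ge0 ?mulr_ge0 ?exprn_ge0 // ltW.
apply: (@le_trans _ _ ((A * D + A * z ^+ k0 * (2 * q%:R)) * S)).
  apply: (@le_trans _ _ (\sum_(k <- irange n) (A * D + A * z ^+ k0 * (2 * q%:R)) * z ^+ `|k|)).
    rewrite big_seq_cond [leRHS]big_seq [leRHS](bigID (fun k : int => (0 < `|k| < q)%N)) /=.
    apply: ler_wpDr.
      by apply: sumr_ge0 => k _; rewrite mulr_ge0 // exprn_ge0 // expR_ge0.
    by apply: ler_sum => k; rewrite mem_irange => /andP[kn hk]; exact: bound.
  by rewrite -mulr_sumr ler_wpM2l // sum_geometric_irange.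
have hq : A * D * S <= e / 4 * q%:R.
  have : 4 * (A * D * S) <= e * q%:R.
    rewrite -ler_pdivrMl // mulrC.
    by apply: le_trans hQ _; rewrite ler_nat ltnW.
  lra.
have hz' := ler_wpM2r (ltW qR) hz.
rewrite [leLHS](_ : _ = A * D * S + 2 * (2 * A * S * z ^+ k0 * q%:R) / 2); last by field.
have eq0 : 0 <= e * q%:R by rewrite mulr_ge0 // ltW.
lra.
Qed.

End PrimitiveNorm.

(** * Polynomial approximation of analytic functions and of exponentials *)

Section Approximation.
Variable R : realType.
Local Notation C := R[i].

Lemma wnorm_mono (c c' : R) (s : tpoly R) : c <= c' -> wnorm c s <= wnorm c' s.
Proof.
move=> cc; apply: ler_sum => p _; rewrite ler_wpM2l ?cm_ge0 // ler_expR.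
by rewrite ler_wpM2r.
Qed.

Lemma analytic_approx (f : R -> R) : real_analytic f -> (forall x, f (x + 1) = f x) ->
  exists K c : R, [/\ 0 < K, 0 < c & forall tau, 0 < tau ->
    exists2 T : tpoly R, wnorm c T <= K & forall x, cm (ev T x - (f x)%:C%C) <= tau].
Proof.
move=> af pf; have [A [c [A0 c0 h]]] := trig_approx af pf.
have c2 : c / 2 < c by rewrite ltr_pdivrMr // ltr_pMr //; lra.
have [K hK] : exists K, forall n,
    (forall k, (`|k| <= n)%N -> cm (dft n f k) <= A * expR (- (c * (`|k|%N)%:R))) ->
    wnorm (c / 2) (interp n f) <= K.
  by eexists => n hn; exact: (wnorm_interp A0 hn c2).
exists (`|K| + 1), (c / 2); split; [by rewrite ltr_wpDl | by rewrite divr_gt0 |].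
move=> tau tau0; have [n [h1 h2]] := h tau tau0; exists (interp n f) => //.
apply: le_trans (hK n h2) _; apply: le_trans (ler_norm _) _; by rewrite lerDl.
Qed.

(** The approximant is [(1 + 2 pi i s / M) ^ M]. Its norm stays below the exponential of the norm
    for every [M], so the accuracy [tau] is free of charge; each of the [M] factors has an error of
    order [1 / M ^ 2]. *)
Lemma exp_approx (s : tpoly R) (g : R -> R) (c tau : R) : 0 <= c -> 0 < tau ->
  (forall x, ev s x = (g x)%:C%C) ->
  exists2 P : tpoly R, wnorm c P <= expR (2 * pi * wnorm c s) &
    forall x, cm (ev P x - cexp2pi (g x)) <= tau.
Proof.
move=> c0 tau0 hg; pose W := 2 * pi * wnorm 0 s.
have pi0 : 0 <= pi :> R by exact: pi_ge0.
have W0 : 0 <= W by rewrite !mulr_ge0 ?wnorm_ge0.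
have gW x : `|2 * pi * g x| <= W.
  rewrite normrM ger0_norm ?mulr_ge0 // ler_wpM2l ?mulr_ge0 //.
  by have := cm_ev_le s x; rewrite hg cmR.
(* The term [W] puts each factor in the range of [cexp_linear]; the other one makes the total error
   [M * (W / M) ^ 2 * exp W] at most [tau]. *)
have [N0 hN0] := nat_above (W + W ^+ 2 * expR W / tau).
have extra : 0 <= W ^+ 2 * expR W / tau.
  apply: divr_ge0; last exact: ltW.
  by apply: mulr_ge0; [exact: sqr_ge0 | exact: expR_ge0].
pose M := N0.+1; have MR : 0 < M%:R :> R by rewrite ltr0n.
have MN : W + W ^+ 2 * expR W / tau <= M%:R.
  by apply: le_trans hN0 _; rewrite ler_nat.
pose a0 : C := Complex 0 (2 * pi / M%:R).
pose P1 : tpoly R := (1, 0) :: tscale a0 s.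
have evP1 x : ev P1 x = 1 + Complex 0 (2 * pi * (M%:R^-1 * g x)).
  rewrite /P1 -cat1s ev_cat ev_scale hg /ev big_seq1 /= mul0r cexp0 mulr1; congr (_ + _).
  by apply: complex_ext => /=; ring.
have powexp (y : R) : 0 <= y -> (1 + y / M%:R) ^+ M <= expR y.
  move=> y0; apply: (@le_trans _ _ (expR (y / M%:R) ^+ M)).
    by apply: lerXn2r; rewrite ?nnegrE ?expR_ge0 ?addr_ge0 ?divr_ge0 ?expR_ge1Dx.
  by rewrite -expRM_natl mulrC divfK // gt_eqF.
exists (tpow P1 M).
  apply: le_trans (wnorm_pow _ _ c0) _.
  have -> : wnorm c P1 = 1 + 2 * pi * wnorm c s / M%:R.
    rewrite /P1 -cat1s wnorm_cat wnorm_scale /wnorm big_seq1 /= cm1 mulr0 expR0 mulr1.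
    congr (_ + _); rewrite mulrAC; congr (_ * _).
    by rewrite /a0 /cm /cabs2 /= expr0n /= add0r sqrtr_sqr ger0_norm // divr_ge0 ?mulr_ge0.
  by apply: powexp; rewrite !mulr_ge0 ?wnorm_ge0.
move=> x; rewrite ev_pow evP1 -(cexp_pow (g x) N0) -/M.
set a := 1 + _; set b := cexp2pi _.
have small : `|2 * pi * (M%:R^-1 * g x)| <= W / M%:R.
  rewrite (_ : _ * _ = (2 * pi * g x) / M%:R); last by ring.
  have Mi0 : 0 <= (M%:R : R)^-1 by rewrite invr_ge0 ltW.
  by rewrite normrM (ger0_norm Mi0) ler_wpM2r.
have WM : W / M%:R <= 1 by rewrite ler_pdivrMr // mul1r; lra.
have dab : cm (a - b) <= (W / M%:R) ^+ 2.
  apply: le_trans (cexp_linear _) _; first exact: le_trans small WM.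
  by rewrite -real_normK ?num_real // lerXn2r // nnegrE // divr_ge0 // ltW.
have na : cm a <= 1 + W / M%:R.
  apply: le_trans (cmD _ _) _; rewrite cm1 lerD2l.
  by apply: le_trans (cm_ReIm _) _; rewrite /= normr0 add0r.
have nb : cm b = 1 by exact: cm_cexp.
have y1 : 1 <= 1 + W / M%:R by rewrite lerDl divr_ge0 // ltW.
rewrite subrXX cmM.
apply: (@le_trans _ _ ((W / M%:R) ^+ 2 * (M%:R * expR W))).
  apply: ler_pM; rewrite ?cm_ge0 //; apply: le_trans (cm_sum _ _ _) _.
  apply: (@le_trans _ _ (\sum_(i < M) expR W)); last by rewrite sumr_const card_ord mulr_natl.
  apply: ler_sum => i _; rewrite cmM !cmX nb expr1n mulr1.
  apply: le_trans (powexp _ W0); apply: (@le_trans _ _ ((1 + W / M%:R) ^+ (M.-1 - i))).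
    by apply: lerXn2r; rewrite ?nnegrE ?cm_ge0 // (le_trans ler01).
  by apply: ler_weXn2l => //; apply: leq_trans (leq_subr _ _) (leq_pred _).
rewrite [leLHS](_ : _ = W ^+ 2 * expR W / M%:R); last by field; rewrite gt_eqF.
rewrite ler_pdivrMr // [leRHS]mulrC -ler_pdivrMr //.
by apply: le_trans MN; rewrite lerDr.
Qed.

End Approximation.

(** * Approximate solutions built from a reduction to rotations *)

Section ApproximateEigenfunctions.
Variables (R : realType) (alpha : R) (d : nat) (vhat : int -> R[i]) (E : R).
Local Notation C := R[i].
Local Notation res := (residual alpha d vhat E).
Variables (beta : R -> C) (psi : R -> R).
Hypothesis bloch : forall x, cexp2pi (psi x) * beta (x + alpha)
  + cexp2pi (- psi (x - alpha)) * beta (x - alpha) + (trig_sum d vhat x - E%:C%C) * beta x = 0.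
Variable wr : C.
Hypothesis wronsk : forall x, cexp2pi (psi (x - alpha)) * (beta x * conjc (beta (x - alpha)))
  - cexp2pi (- psi (x - alpha)) * (beta (x - alpha) * conjc (beta x)) = wr.
Variables (Kb cb : R).
Hypothesis Kb0 : 0 < Kb.
Hypothesis cb0 : 0 < cb.
Hypothesis beta_approx : forall tau, 0 < tau ->
  exists2 T : tpoly R, wnorm cb T <= Kb & forall x, cm (ev T x - beta x) <= tau.
Hypothesis psi_an : real_analytic psi.
Hypothesis psi_per : forall x, psi (x + 1) = psi x.
Hypothesis psi_mean : (\int[lebesgue_measure]_(x in `[0%R, 1%R]) (psi x)%:E = 0)%E.

(* f = exp(2 pi i g) beta with g(x + alpha) - g(x) = psi(x) up to an exponentially small error. *)
Lemma approx_eigenfunction : exists K c, [/\ 0 < K, 0 < c & forall e, 0 < e -> exists Q : nat,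
  forall q : nat, (Q < q)%N ->
  (forall k p : int, (0 < `|k| < q)%N -> (2 * q%:R)^-1 <= `|k%:~R * alpha - p%:~R|) ->
  exists f : tpoly R, [/\ wnorm c f <= K * expR (e * q%:R),
    forall x, cm (ev (res f) x) <= K * expR (- (c * q%:R)) &
    forall x, cm (ev f x * conjc (ev f (x - alpha)) - ev f (x - alpha) * conjc (ev f x) - wr)
      <= K * expR (- (c * q%:R))]].
Proof.
have [A [cp [A0 cp0 psi_approx]]] := trig_approx psi_an psi_per.
have [S hS] : exists S, forall q n x, (0 < q)%N ->
    (forall k p : int, (0 < `|k| < q)%N -> (2 * q%:R)^-1 <= `|k%:~R * alpha - p%:~R|) ->
    (forall k, (`|k| <= n)%N -> cm (dft n psi k) <= A * expR (- (cp * (`|k|%N)%:R))) ->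
    cm (ev (primitive psi alpha q n) (x + alpha) - ev (primitive psi alpha q n) x
        - ev (interp n psi) x) <= cm (dft n psi 0) + S * expR (- (cp / 2 * q%:R)).
  by eexists => q n x q0 hq hd; exact: (primitive_diff A0 cp0 hq x hd).
pose c := Num.min cb (cp / 2).
have c_gt0 : 0 < c by rewrite lt_min cb0 divr_gt0.
have c_cb : c <= cb by rewrite ge_min lexx.
have c_cp : c <= cp / 2 by rewrite ge_min lexx orbT.
pose B := Kb + 1; have B0 : 0 < B by rewrite addr_gt0.
have beta_le x : cm (beta x) <= B.
  have [T hT h] := beta_approx ltr01.
  rewrite -[beta x](subrK (ev T x)); apply: le_trans (cmD _ _) _; rewrite addrC.
  apply: lerD; last by rewrite cmB.
  by apply: le_trans hT; apply: le_trans (cm_ev_le _ _) _; apply: wnorm_mono; exact: ltW.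
pose V := wnorm 0 (vpoly d vhat) + `|E|.
have V0 : 0 <= V by rewrite addr_ge0 ?wnorm_ge0.
have V_le x : cm (trig_sum d vhat x - E%:C%C) <= V.
  by apply: le_trans (cm_triB _ _) _; rewrite cmR lerD2r -ev_vpoly cm_ev_le.
pose H := 2 + `|S|; have H0 : 0 <= H by rewrite addr_ge0.
pose F := 2 + B; have F0 : 0 <= F by rewrite addr_ge0 // ltW.
have pi0 : 0 <= pi :> R by exact: pi_ge0.
pose U := 2 * pi * H; have U0 : 0 <= U by rewrite !mulr_ge0.
pose K1 := (2 + V) * F + 2 * (U * B).
pose K2 := 2 * (F * (B + F) + B * F) + 2 * (U * (B * B)).
have B00 : 0 <= B := ltW B0.
have UB0 : 0 <= U * B by exact: mulr_ge0.
have K10 : 0 <= K1.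
  by apply: addr_ge0; apply: mulr_ge0 => //; exact: addr_ge0.
have K20 : 0 <= K2.
  apply: addr_ge0; apply: mulr_ge0 => //; last by apply: mulr_ge0 => //; exact: mulr_ge0.
  by apply: addr_ge0; apply: mulr_ge0 => //; exact: addr_ge0.
have K1le : K1 <= Kb + K1 + K2.
  by rewrite addrAC lerDr; apply: addr_ge0 => //; exact: ltW.
have K2le : K2 <= Kb + K1 + K2 by rewrite lerDr; apply: addr_ge0 => //; exact: ltW.
exists (Kb + K1 + K2), c; split.
- by apply: ltr_wpDr => //; exact: ltr_wpDr.
- exact: c_gt0.
move=> e e0.
(* Compensates the factor [2 * pi] in the exponent of [exp_approx]. *)
have e2pi : 0 < e / (2 * pi) by rewrite divr_gt0 // mulr_gt0 // pi_gt0.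
have [Q hQ] := primitive_small alpha A0 cp0 e2pi.
exists Q => q qQ hq; have q0 : (0 < q)%N by exact: leq_ltn_trans qQ.
pose w := expR (- (c * q%:R)); have w0 : 0 < w by exact: expR_gt0.
have w1 : w <= 1 by rewrite -[leRHS]expR0 ler_expR oppr_le0 mulr_ge0 // ltW.
have [n [hn1 hn2]] := psi_approx w w0.
pose G := primitive psi alpha q n; pose g x := complex.Re (ev G x).
(* The real part of the primitive, taken so that [exp(2 pi i g)] is unimodular. As psi is real it
   solves the same equation, and it has the same weighted norm. *)
pose Gr := tscale (2^-1)%:C%C (G ++ tconj G).
have evGr x : ev Gr x = (g x)%:C%C.
  rewrite /Gr ev_scale ev_cat ev_conj /g; case: (ev G x) => a b.
  by apply: complex_ext => /=; field.
have wGr : 2 * pi * wnorm c Gr <= e * q%:R.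
  have -> : wnorm c Gr = wnorm c G.
    by rewrite wnorm_scale wnorm_cat wnorm_conj cmR ger0_norm ?invr_ge0 //; field.
  rewrite mulrC -ler_pdivlMr ?mulr_gt0 ?pi_gt0 //.
  apply: le_trans (wnorm_mono _ c_cp) _; apply: le_trans (hQ q qQ hq _ _ hn2) _.
  by rewrite mulrAC.
have dg x : `|g (x + alpha) - g x - psi x| <= H * w.
  have d0 : cm (dft n psi 0) <= w.
    rewrite dft0_real -coef_interp //; exact: zero_mean_coef hn1.
  have e1 := hS q n x q0 hq hn2.
  have sw : S * expR (- (cp / 2 * q%:R)) <= `|S| * w.
    apply: le_trans (ler_norm _) _; rewrite normrM (ger0_norm (expR_ge0 _)) ler_wpM2l //.
    by rewrite ler_expR lerN2 ler_wpM2r.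
  have -> : g (x + alpha) - g x - psi x = complex.Re
     ((ev G (x + alpha) - ev G x - ev (interp n psi) x) + (ev (interp n psi) x - (psi x)%:C%C)).
    rewrite /g; case: (ev G _) (ev G x) (ev (interp _ _) _) => [? ?] [? ?] [? ?] /=; ring.
  apply: le_trans (cm_Re _) _; apply: le_trans (cmD _ _) _.
  have := hn1 x; rewrite /H; lra.
have eU (a b : R) : `|a - b| <= H * w -> cm (cexp2pi a - cexp2pi b) <= U * w.
  move=> h; apply: le_trans (cexpB_le _ _) _.
  by rewrite /U -[leRHS]mulrA ler_wpM2l // mulr_ge0.
have [T hT1 hT2] := beta_approx w0.
have [P hP1 hP2] := exp_approx (ltW c_gt0) w0 evGr.
pose f := tmul P T; exists f.
pose f0 x := cexp2pi (g x) * beta x.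
have f0B x : cm (f0 x) <= B by rewrite cmM cm_cexp mul1r.
have ff0 x : cm (ev f x - f0 x) <= F * w.
  have -> : ev f x - f0 x = ev P x * (ev T x - beta x) + (ev P x - cexp2pi (g x)) * beta x.
    by rewrite /f ev_mul /f0; ring.
  have P2 : cm (ev P x) <= 2.
    rewrite -[ev P x](subrK (cexp2pi (g x))); apply: le_trans (cmD _ _) _; rewrite cm_cexp.
    by have := hP2 x; lra.
  apply: le_trans (cmD _ _) _; rewrite !cmM /F [leRHS]mulrDl; apply: lerD.
    by rewrite ler_pM ?cm_ge0.
  by rewrite mulrC ler_pM ?cm_ge0.
have Fw : F * w <= F by rewrite ler_piMr.
have fB x : cm (ev f x) <= B + F.
  rewrite -[ev f x](subrK (f0 x)) addrC; apply: le_trans (cmD _ _) _.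
  by apply: lerD => //; exact: le_trans (ff0 x) Fw.
have Kw a b : a <= b -> a * w <= b * w by move=> ab; rewrite ler_wpM2r // ltW.
split.
- apply: le_trans (wnorm_mul _ _ (ltW c_gt0)) _; rewrite mulrC.
  apply: ler_pM; rewrite ?wnorm_ge0 //.
    apply: le_trans (wnorm_mono _ c_cb) _; apply: le_trans hT1 _.
    by rewrite -addrA lerDl addr_ge0.
  by apply: le_trans hP1 _; rewrite ler_expR.
- move=> x; apply: (@le_trans _ _ (K1 * w)); last exact: Kw.
  rewrite ev_residual.
  have -> : ev f (x + alpha) + ev f (x - alpha) + (trig_sum d vhat x - E%:C%C) * ev f x =
     ((ev f (x + alpha) - f0 (x + alpha)) + (ev f (x - alpha) - f0 (x - alpha))
      + (trig_sum d vhat x - E%:C%C) * (ev f x - f0 x))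
     + cexp2pi (g x) * ((cexp2pi (g (x + alpha) - g x) - cexp2pi (psi x)) * beta (x + alpha)
       + (cexp2pi (g (x - alpha) - g x) - cexp2pi (- psi (x - alpha))) * beta (x - alpha)).
    have -> : f0 (x + alpha) = cexp2pi (g x) * (cexp2pi (g (x + alpha) - g x) * beta (x + alpha)).
      by rewrite mulrA -cexpD subrKC.
    have -> : f0 (x - alpha) = cexp2pi (g x) * (cexp2pi (g (x - alpha) - g x) * beta (x - alpha)).
      by rewrite mulrA -cexpD subrKC.
    have -> : f0 x = cexp2pi (g x) * beta x by [].
    apply/eqP; rewrite -subr_eq0; apply/eqP.
    rewrite -[RHS](mulr0 (cexp2pi (g x))) -(bloch x); ring.
  apply: le_trans (cmD _ _) _; rewrite /K1 [leRHS]mulrDl; apply: lerD.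
    rewrite [leRHS](_ : _ = F * w + F * w + V * (F * w)); last by ring.
    apply: le_trans (cmD _ _) _; apply: lerD; last by rewrite cmM ler_pM ?cm_ge0.
    by apply: le_trans (cmD _ _) _; apply: lerD.
  rewrite cmM cm_cexp mul1r [leRHS](_ : _ = U * w * B + U * w * B); last by ring.
  apply: le_trans (cmD _ _) _; rewrite !cmM; apply: lerD; apply: ler_pM; rewrite ?cm_ge0 //.
    exact: eU.
  apply: eU; have := dg (x - alpha); rewrite subrK distrC; congr (`| _ | <= _); ring.
move=> x; apply: (@le_trans _ _ (K2 * w)); last exact: Kw.
set y := x - alpha.
pose dl := g x - g y.
have conjM (u v : C) : conjc (u * v) = conjc u * conjc v by exact: rmorphM.
have conjB (u v : C) : conjc (u - v) = conjc u - conjc v by exact: rmorphB.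
have f0E : f0 x * conjc (f0 y) = cexp2pi dl * (beta x * conjc (beta y)).
  by rewrite /f0 /dl conjM conj_cexp cexpD; ring.
have f0E' : f0 y * conjc (f0 x) = cexp2pi (- dl) * (beta y * conjc (beta x)).
  by rewrite /f0 /dl conjM conj_cexp opprB cexpD; ring.
have -> : ev f x * conjc (ev f y) - ev f y * conjc (ev f x) - wr =
   (((ev f x - f0 x) * conjc (ev f y) + f0 x * conjc (ev f y - f0 y))
   - ((ev f y - f0 y) * conjc (ev f x) + f0 y * conjc (ev f x - f0 x)))
   + ((cexp2pi dl - cexp2pi (psi y)) * (beta x * conjc (beta y))
   - (cexp2pi (- dl) - cexp2pi (- psi y)) * (beta y * conjc (beta x))).
  rewrite -(wronsk x) -/y !mulrBl -f0E -f0E' !conjB; ring.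
have prod (u u' v' : C) a b : cm u <= a -> cm v' <= b -> cm (u * conjc v') <= a * b.
  by move=> h1 h2; rewrite cmM cmJ ler_pM ?cm_ge0.
have sum4 (u v u' v' : C) a b : cm u <= a -> cm u' <= a -> cm v <= b -> cm v' <= b ->
    cm ((u + v) - (u' + v')) <= 2 * (a + b).
  move=> h1 h2 h3 h4; apply: le_trans (cm_triB _ _) _.
  have := cmD u v; have := cmD u' v'; lra.
apply: le_trans (cmD _ _) _; rewrite /K2 [leRHS]mulrDl; apply: lerD.
  rewrite [leRHS](_ : _ = 2 * (F * w * (B + F) + B * (F * w))); last by ring.
  by apply: sum4; apply: prod.
rewrite [leRHS](_ : _ = U * w * (B * B) + U * w * (B * B)); last by ring.
have dl1 : `|dl - psi y| <= H * w by have := dg y; rewrite subrK.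
apply: le_trans (cm_triB _ _) _; rewrite [X in X + _]cmM [X in _ + X]cmM.
apply: lerD; apply: ler_pM; rewrite ?cm_ge0 // ?prod //; apply: eU => //.
by rewrite -opprD normrN.
Qed.

End ApproximateEigenfunctions.

(** * The Bloch wave of a cocycle conjugate to rotations *)

Section ReducibleCocycle.
Variables (R : realType) (alpha : R) (v : R -> R) (E : R) (B : R -> 'M[R]_2) (psi : R -> R).
Local Notation C := R[i].
Hypothesis detB : forall x, \det (B x) = 1.
Hypothesis conjB : forall x, invmx (B (x + alpha)) *m Schr E v x *m B x = Rot (psi x).
Local Notation i1 := (lift ord0 ord0 : 'I_2).

(** A row [(b0, b1)] of [B] coded as [b0 - i b1]: right multiplication by [Rot t] becomes
    multiplication by [cexp2pi t]. *)
Definition column_wave (i : 'I_2) x : C := Complex (B x i ord0) (- B x i i1).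
Local Notation beta := (column_wave ord0).

Lemma reducible_entries x :
  [/\ (E - v x) * B x ord0 ord0 - B x i1 ord0
        = B (x + alpha) ord0 ord0 * cos (2 * pi * psi x) + B (x + alpha) ord0 i1 * sin (2 * pi * psi x),
      (E - v x) * B x ord0 i1 - B x i1 i1
        = - (B (x + alpha) ord0 ord0 * sin (2 * pi * psi x)) + B (x + alpha) ord0 i1 * cos (2 * pi * psi x),
      B x ord0 ord0
        = B (x + alpha) i1 ord0 * cos (2 * pi * psi x) + B (x + alpha) i1 i1 * sin (2 * pi * psi x)
    & B x ord0 i1
        = - (B (x + alpha) i1 ord0 * sin (2 * pi * psi x)) + B (x + alpha) i1 i1 * cos (2 * pi * psi x)].
Proof.
have uB : B (x + alpha) \in unitmx by rewrite unitmxE detB unitr1.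
have eqM : Schr E v x *m B x = B (x + alpha) *m Rot (psi x).
  by rewrite -conjB -mulmxA mulKVmx.
have ent i j := congr1 (fun M : 'M[R]_2 => fun_of_matrix M i j) eqM.
have := ent ord0 ord0; have := ent ord0 i1; have := ent i1 ord0; have := ent i1 i1.
rewrite !mxE !big_ord_recl !big_ord0 !mxE /= => e1 e2 e3 e4.
split.
- by move: e4; lra.
- by move: e3; lra.
- by move: e2; lra.
- by move: e1; lra.
Qed.

(** The second row of the Schrodinger matrix is [(1, 0)], so the first row of [B] at [x - alpha] is
    the second row of [B x] rotated by [psi (x - alpha)]. *)
Lemma column_wave_shift x : column_wave i1 x = cexp2pi (- psi (x - alpha)) * beta (x - alpha).
Proof.
have := reducible_entries (x - alpha); rewrite subrK => -[_ _ h1 h2].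
rewrite -conj_cexp /column_wave /cexp2pi h1 h2.
have := cos2Dsin2 (2 * pi * psi (x - alpha)).
set c := cos _; set s := sin _ => cs.
set p := B x i1 ord0; set q := B x i1 i1.
have e (a : R) : a = a * (c ^+ 2 + s ^+ 2) by rewrite cs mulr1.
apply: complex_ext => /=.
  by rewrite [LHS]e; ring.
by rewrite [in LHS](e q); ring.
Qed.

Lemma column_wave_bloch x : cexp2pi (psi x) * beta (x + alpha)
  + cexp2pi (- psi (x - alpha)) * beta (x - alpha) + ((v x)%:C%C - E%:C%C) * beta x = 0.
Proof.
rewrite -column_wave_shift; have [h1 h2 _ _] := reducible_entries x.
apply: complex_ext => /=.
  by move: h1; lra.
by move: h2; lra.
Qed.

(** By [column_wave_shift] the left side is twice i times the imaginary part of the first wave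
    against the conjugate of the second, both at [x], and this imaginary part is [\det (B x)]. *)
Lemma column_wave_wronskian x :
  cexp2pi (psi (x - alpha)) * (beta x * conjc (beta (x - alpha)))
  - cexp2pi (- psi (x - alpha)) * (beta (x - alpha) * conjc (beta x)) = Complex 0 2.
Proof.
have -> : cexp2pi (psi (x - alpha)) * (beta x * conjc (beta (x - alpha)))
    = beta x * conjc (column_wave i1 x).
  have conjM (a b : C) : conjc (a * b) = conjc a * conjc b by exact: rmorphM.
  by rewrite column_wave_shift conjM conj_cexp opprK mulrCA.
rewrite mulrA -column_wave_shift.
have := detB x; rewrite (expand_det_row _ ord0) !big_ord_recl big_ord0 /cofactor.
rewrite !det_mx11 !mxE /= => h.
apply: complex_ext => /=; first by ring.
move: h; rewrite (_ : lift i1 ord0 = ord0); last by exact/val_inj.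
by rewrite /bump /= expr0 expr1; lra.
Qed.

End ReducibleCocycle.

(** * The contradiction between a solution and its conjugate *)

Lemma expR_le_mono (R : realType) (K a b : R) : 0 <= K -> a <= b -> K * expR a <= K * expR b.
Proof. by move=> K0 ab; rewrite ler_wpM2l // ler_expR. Qed.

Theorem theorem1p6 (R : realType) (alpha : R) (d : nat) (vhat : int -> R[i]) (E : R) :
  (forall q : rat, alpha != ratr q) ->
  (1 <= d)%N ->
  vhat d%:Z != 0 ->
  (forall x : R, complex.Im (trig_sum d vhat x) = 0) ->
  PH2 alpha (dualL d vhat E) ->
  ~ exists (B : R -> 'M[R]_2) (psi : R -> R),
      (forall i j : 'I_2, real_analytic (fun x => B x i j)) /\
      (forall x, B (x + 1) = B x) /\
      (forall x, \det (B x) = 1) /\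
      real_analytic psi /\
      (forall x, psi (x + 1) = psi x) /\
      (\int[lebesgue_measure]_(x in `[0%R, 1%R]) (psi x)%:E = 0)%E /\
      (forall x, invmx (B (x + alpha)) *m Schr E (trig_val d vhat) x *m B x
                 = Rot (psi x)).
Proof.
move=> irr d1 vd real [dom _] [B [psi [Ban [Bper [Bdet [psi_an [psi_per [psi_mean conj]]]]]]]].
have v_conj := vhat_conj real.
pose beta := column_wave B ord0.
have bloch x : cexp2pi (psi x) * beta (x + alpha)
    + cexp2pi (- psi (x - alpha)) * beta (x - alpha) + (trig_sum d vhat x - E%:C%C) * beta x = 0.
  have -> : trig_sum d vhat x = (trig_val d vhat x)%:C%C.
    by rewrite /trig_val; have := real x; case: (trig_sum d vhat x) => a b /= ->.
  exact: column_wave_bloch Bdet conj x.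
have wronsk := column_wave_wronskian Bdet conj.
have Bp i j x : B (x + 1) i j = B x i j by rewrite Bper.
have [Ka [ca [Ka0 ca0 app_a]]] := analytic_approx (Ban ord0 ord0) (Bp ord0 ord0).
have [Kb [cb [Kb0 cb0 app_b]]] := analytic_approx (Ban ord0 (lift ord0 ord0)) (Bp ord0 (lift ord0 ord0)).
have beta_approx tau : 0 < tau -> exists2 T : tpoly R, wnorm (Num.min ca cb) T <= Ka + Kb &
    forall x, cm (ev T x - beta x) <= tau.
  move=> tau0; have tau2 : 0 < tau / 2 by rewrite divr_gt0.
  have cmi : cm (Complex 0 (-1) : R[i]) = 1.
    by rewrite /cm /cabs2 /= expr0n /= add0r sqrrN expr1n sqrtr1.
  have [S S1 S2] := app_a _ tau2; have [T T1 T2] := app_b _ tau2.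
  exists (S ++ tscale (Complex 0 (-1)) T).
    rewrite wnorm_cat wnorm_scale cmi mul1r; apply: lerD.
      by apply: le_trans S1; apply: wnorm_mono; rewrite ge_min lexx.
    by apply: le_trans T1; apply: wnorm_mono; rewrite ge_min lexx orbT.
  move=> x; rewrite ev_cat ev_scale.
  have -> : ev S x + Complex 0 (-1) * ev T x - beta x = (ev S x - (B x ord0 ord0)%:C%C)
      + Complex 0 (-1) * (ev T x - (B x ord0 (lift ord0 ord0))%:C%C).
    have -> : beta x = (B x ord0 ord0)%:C%C + Complex 0 (-1) * (B x ord0 (lift ord0 ord0))%:C%C.
      by apply: complex_ext => /=; ring.
    by ring.
  apply: le_trans (cmD _ _) _; rewrite cmM cmi mul1r.
  by rewrite [leRHS](splitr tau); apply: lerD.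
have K00 : 0 < Ka + Kb by exact: addr_gt0.
have c00 : 0 < Num.min ca cb by rewrite lt_min ca0 cb0.
have [K [c [K0 c0 almost]]] :=
  approx_eigenfunction bloch wronsk K00 c00 beta_approx psi_an psi_per psi_mean.
have [b [n0 [b0 prop]]] := almost_proportional d1 vd v_conj dom c0 K0 c0.
have bR : 0 < b%:R :> R by rewrite ltr0n.
(* With [n = q %/ b] one has [q <= 2 * b * n], so [exp(e q)] is at most [exp(c n / 4)], the growth
   that [almost_proportional] tolerates. *)
have e0 : 0 < c / (8 * b%:R) by rewrite divr_gt0 // mulr_gt0.
have [Q hQ] := almost _ e0; have [q0 hq0] := expR_neg_small (ltW K0) c0.
(* The three terms guarantee the existence of [f], an error at most 1/2 in its Wronskian, and
   [n > n0]. *)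
have [q [qbig dio]] := irrational_denominator irr (Q + q0 + b * n0.+1)%N.
have [qQ qq0 qb] : [/\ (Q < q)%N, (q0 <= q)%N & (b * n0.+1 <= q)%N].
  split; last by exact: leq_trans (leq_addl _ _) (ltnW qbig).
    by apply: leq_ltn_trans qbig; rewrite -addnA leq_addr.
  by apply: leq_trans (ltnW qbig); rewrite addnAC leq_addl.
have [f [f1 f2 f3]] := hQ q qQ dio.
pose n := (q %/ b)%N.
have n1 : (n0 < n)%N by rewrite /n leq_divRL // mulnC.
have nq : (b * n <= q)%N by rewrite mulnC leq_trunc_div.
have qn : (q <= 2 * (b * n))%N.
  have := ltn_ceil q b0; rewrite -/n => h.
  apply: leq_trans (ltnW h) _; rewrite mulnC mulnCA leq_pmul2l // mul2n -addnn -addn1.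
  by rewrite leq_add2l (leq_trans _ n1).
have f1' : wnorm c f <= K * expR (c / 4 * n%:R).
  apply: le_trans f1 _; apply: expR_le_mono; first exact: ltW.
  rewrite mulrAC ler_pdivrMr ?mulr_gt0 //.
  rewrite [leRHS](_ : _ = c * (2 * (b * n))%:R); last by rewrite !natrM; field.
  by apply: ler_wpM2l; [exact: ltW | rewrite ler_nat].
have f2' x : cm (ev (residual alpha d vhat E f) x) <= K * expR (- (c * b%:R * n%:R)).
  apply: le_trans (f2 x) _; apply: expR_le_mono; first exact: ltW.
  by rewrite lerN2 -mulrA -natrM; apply: ler_wpM2l; [exact: ltW | rewrite ler_nat].
(* The conjugate is an equally good approximate solution because v and [E] are real. *)
have g1 : wnorm c (tconj f) <= K * expR (c / 4 * n%:R) by rewrite wnorm_conj.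
have g2 x : cm (ev (residual alpha d vhat E (tconj f)) x) <= K * expR (- (c * b%:R * n%:R)).
  apply: le_trans (f2' x); rewrite -[leRHS]cmJ !ev_residual !ev_conj.
  have -> : trig_sum d vhat x - E%:C%C = (trig_val d vhat x - E)%:C%C.
    rewrite /trig_val; have := real x; case: (trig_sum d vhat x) => a b' /= ->.
    by apply: complex_ext; rewrite /= ?subr0.
  case: (ev f _) (ev f _) (ev f _) => [? ?] [? ?] [? ?].
  apply: eq_ler; congr cm.
  by apply: complex_ext => /=; ring.
(* At the points 0 and [- alpha] the antisymmetric expression has modulus at most 1, yet it is
   within 1/2 of [2 i]. *)
have := prop n (ltnW n1) f (tconj f) f1' g1 f2' g2 0 (0 - alpha).
rewrite !ev_conj; have := f3 0; have := hq0 q qq0.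
set w := Complex 0 2; set z := _ - ev f (0 - alpha) * _ => h1 h2 h3.
have w2 : cm w = 2 by rewrite /cm /cabs2 /= expr0n /= add0r sqrtr_sqr ger0_norm.
have := cm_triB z (z - w); rewrite (_ : z - (z - w) = w); last by ring.
by rewrite w2; lra.
Qed.
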